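(* Let $G$ be a finitely generated Fuchsian group. Then any virtually central extension of $G$ by a finitely generated abelian group has a biautomatic structure.
   Context: A Fuchsian group here means any finitely generated discrete subgroup of $\mathrm{Isom}(\mathbb H^2)$ (orientation-preserving or not). An extension $0\to A\to E\to G\to1$ with $A$ abelian is virtually central if the induced action of $G$ on $A$ has finite image in $\mathrm{Aut}(A)$. **Biautomatic structures.** Let $E$ be a finitely generated group and $X$ a finite set with a map $X\to E$ whose image generates $E$ as a monoid and is symmetric ($\overline X=\overline X^{-1}$). The induced monoid homomorphism $X^*\to E$ is written $w\mapsto\overline w$. The Cayley graph $\Gamma_X(E)$ has vertex set $E$ and an edge labelled $x$ from $g$ to $g\overline x$ for all $g\in E$, $x\in X$; $d$ is its path metric. A word $w\in X^*$ gives a path $w:[0,\infty)\to\Gamma_X(E)$ where $w(t)$ is the value of the length-$t$ initial segment for integers $0\le t\le \mathrm{len}(w)$, $w(t)$ runs along the corresponding edge in between, and $w(t)=\overline w$ for $t\ge\mathrm{len}(w)$; for $h\in E$, $hw$ denotes the translated path. Two paths $v,w$ synchronously $\delta$-fellow-travel if $d(v(t),w(t))\le\delta$ for all $t$. A biautomatic structure on $E$ is a regular language $L\subset X^*$ (for some such $X$) which surjects to $E$ and for which there is a constant $\delta$ such that (a) any $u,v\in L$ with $d(\overline u,\overline v)\le1$ synchronously $\delta$-fellow-travel, and (b) whenever $v,w\in L$, $x\in X$ and $\overline w=\overline{xv}$, the paths $\overline xv$ and $w$ synchronously $\delta$-fellow-travel. *)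

(* Defs.v *)
From HB Require Import structures.
From mathcomp Require Import all_boot all_order all_algebra.
From mathcomp Require Import all_classical all_reals all_analysis.

Set Implicit Arguments.
Unset Strict Implicit.
Unset Printing Implicit Defensive.

Import Order.TTheory GRing.Theory Num.Theory.
Import numFieldNormedType.Exports.

Local Open Scope classical_set_scope.
Local Open Scope ring_scope.

Definition subgroup (G : groupType) (H : set G) : Prop :=
  H 1%g /\ forall g h, H g -> H h -> H (g * h^-1)%g.

Definition finitely_generated (G : groupType) : Prop :=
  exists s : seq G, forall H : set G,
    subgroup H -> (forall g, g \in s -> H g) -> H = [set: G].

Definition finitely_generated_zmod (A : zmodType) : Prop :=
  exists (n : nat) (s : n.-tuple A), forall a, inIntSpan s a.

(** The hyperbolic plane is the upper half-plane, whose subset topology in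
    [R * R] is the topology of the hyperbolic distance. *)
Definition hyperbolic_plane (R : realType) : set (R * R) :=
  [set z | 0 < z.2].

Arguments hyperbolic_plane : clear implicits.

(** [arcosh c], with [arcosh] written as a logarithm. *)
Definition hyperbolic_dist (R : realType) (z w : hyperbolic_plane R) : R :=
  let: (x1, y1) := val z in
  let: (x2, y2) := val w in
  let c := 1 + ((x1 - x2) ^+ 2 + (y1 - y2) ^+ 2) / (2 * y1 * y2) in
  ln (c + Num.sqrt (c ^+ 2 - 1)).

Definition hyperbolic_isometry (R : realType)
    (f : hyperbolic_plane R -> hyperbolic_plane R) : Prop :=
  bijective f /\
  forall z w, hyperbolic_dist (f z) (f w) = hyperbolic_dist z w.

(** The topology of the isometry group is the compact-open topology. *)
Definition discrete_maps (R : realType)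
    (S : set {compact-open, hyperbolic_plane R -> hyperbolic_plane R}) : Prop :=
  S `<=` isolated S.

(** [rho] identifies [G] with a discrete subgroup of the isometry group. *)
Definition fuchsian (R : realType) (G : groupType) : Prop :=
  finitely_generated G /\
  exists rho : G -> hyperbolic_plane R -> hyperbolic_plane R,
    [/\ forall g, hyperbolic_isometry (rho g),
        forall g h, rho (g * h)%g = rho g \o rho h,
        injective rho
      & discrete_maps (range rho)].

(** [0 -> A -> E -> G -> 1], with [A] written additively. *)
Definition group_extension (A : zmodType) (E G : groupType)
    (iota : A -> E) (pi : {multiplicative E -> G}) : Prop :=
  [/\ {morph iota : a b / a + b >-> (a * b)%g},
      injective iota,
      range iota = [set e | pi e = 1%g]
    & range pi = [set: G]].

Definition induced_action (A : zmodType) (E G : groupType)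
    (iota : A -> E) (pi : {multiplicative E -> G}) (g : G) (alpha : A -> A) :
    Prop :=
  forall e a, pi e = g -> iota (alpha a) = (e * iota a * e^-1)%g.

Definition virtually_central (A : zmodType) (E G : groupType)
    (iota : A -> E) (pi : {multiplicative E -> G}) : Prop :=
  finite_set [set alpha : A -> A | exists g, induced_action iota pi g alpha].

Definition regular_language (X : finType) (L : set (seq X)) : Prop :=
  exists (Q : finType) (q0 : Q) (step : Q -> X -> Q) (F : {set Q}),
    L = [set w | foldl step q0 w \in F].

Definition word_value (E : groupType) (X : finType) (xbar : X -> E)
    (w : seq X) : E :=
  (\prod_(x <- w) xbar x)%g.

(** Points of the geometric realization of the Cayley graph:
    [EdgePoint g x s], for [s] in [[0, 1]], is at distance [s] from [g] on the
    edge labelled [x] from [g] to [g * xbar x].  The representation is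
    redundant: an endpoint of an edge is also a [Vertex], and [cayley_dist]
    below vanishes between representatives of the same point. *)
Inductive cayley_point (R : realType) (E : groupType) (X : finType) : Type :=
| Vertex of E
| EdgePoint of E & X & R.

Arguments Vertex {R E X} g.
Arguments EdgePoint {R E X} g x s.

(** [p] is the point with parameter [s] on the edge labelled [x] from [g]. *)
Definition edge_param (R : realType) (E : groupType) (X : finType)
    (xbar : X -> E) (g : E) (x : X) (s : R) (p : cayley_point R E X) : Prop :=
  0 <= s <= 1 /\
  [\/ p = EdgePoint g x s,
      s = 0 /\ p = Vertex g
    | s = 1 /\ p = Vertex (g * xbar x)%g].

(** [cayley_path xbar p q l]: some path from [p] to [q] of length [l] is a
    concatenation of finitely many segments, each inside one edge. *)
Inductive cayley_path (R : realType) (E : groupType) (X : finType)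
    (xbar : X -> E) : cayley_point R E X -> cayley_point R E X -> R -> Prop :=
| cayley_path_nil p : cayley_path xbar p p 0
| cayley_path_cons g x s t p q r l :
    edge_param xbar g x s p -> edge_param xbar g x t q ->
    cayley_path xbar q r l -> cayley_path xbar p r (`|s - t| + l).

(** When [xbar] generates [E] the graph is connected, so that the infimum is
    that of a nonempty set of nonnegative numbers. *)
Definition cayley_dist (R : realType) (E : groupType) (X : finType)
    (xbar : X -> E) (p q : cayley_point R E X) : R :=
  inf [set l | cayley_path xbar p q l].

(** The position at time [t >= 0] on the translate by [h] of the path of [w]. *)
Fixpoint word_path (R : realType) (E : groupType) (X : finType)
    (xbar : X -> E) (h : E) (w : seq X) (t : R) : cayley_point R E X :=
  if w is x :: w' then
    if t < 1 then EdgePoint h x t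
    else word_path xbar (h * xbar x)%g w' (t - 1)
  else Vertex h.

Definition fellow_travel (R : realType) (E : groupType) (X : finType)
    (xbar : X -> E) (delta : R) (v w : R -> cayley_point R E X) : Prop :=
  forall t : R, 0 <= t -> cayley_dist xbar (v t) (w t) <= delta.

Definition biautomatic_structure (R : realType) (E : groupType) (X : finType)
    (xbar : X -> E) (L : set (seq X)) : Prop :=
  [/\ range (word_value xbar) = [set: E],
      range xbar = [set g^-1%g | g in range xbar],
      regular_language L,
      [set word_value xbar w | w in L] = [set: E]
    & exists delta : R,
        (forall u v, L u -> L v ->
           cayley_dist xbar (Vertex (word_value xbar u) : cayley_point R E X)
             (Vertex (word_value xbar v)) <= 1 ->
           fellow_travel xbar delta
             (word_path xbar 1%g u) (word_path xbar 1%g v)) /\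
        (forall v w x, L v -> L w ->
           word_value xbar w = word_value xbar (x :: v) ->
           fellow_travel xbar delta
             (word_path xbar (xbar x) v) (word_path xbar 1%g w))].

Definition has_biautomatic_structure (R : realType) (E : groupType) : Prop :=
  exists (X : finType) (xbar : X -> E) (L : set (seq X)),
    biautomatic_structure R xbar L.

(* Main.v *)
Require Import Defs.
From mathcomp Require Import all_boot all_order all_algebra.
From mathcomp Require Import all_classical all_reals all_analysis.
From mathcomp Require Import zify ring lra.

(** The word metric of a Fuchsian group [G] satisfies a linear filling inequality for 1-cochains with
    bounded defect: a loop in the binary tiling of the upper half-plane has winding numbers of total
    size at most its length, and they vanish at the tiles far from the orbit, since these are joined
    to infinity by a far chain of tiles.  Applied to [F dpsi], with [F] the distance to a quasi-geodesic,
    the inequality shows that geodesics stay near quasi-geodesics with the same endpoints; applied to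
    the cocycle of the extension, it shows that two lifts of words with the same value in [G] differ by
    an element of [A] of size at most linear in the lengths.

    Choose a finite set [Phi] of homomorphisms [A -> Z], invariant under the action and bounding the
    elements of [A] up to finitely many.  For [f] in [Phi] let [H f e] be the least value of
    [f((lift u)^-1 e) + K |u|] over the words [u] in [G] representing the image of [e]; as [K] is large,
    optimal words are quasi-geodesic, so that along geodesics [H] splits up to a bounded choice and has
    finitely many cone types.  Paths in [E] that project to geodesics and along which
    the moments of [H] stay bounded therefore form a regular language, reach every fibre of [E -> G]
    and fellow-travel.  The element of [A] that remains is written as a word that runs through
    the faces of a cone of the hyperplane arrangement of [Phi], in decreasing order of dimension;
    these words are permuted by the action, and fellow-travel by Dickson's lemma. *)

Set Implicit Arguments.
Unset Strict Implicit.
Unset Printing Implicit Defensive.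

Import Order.TTheory GRing.Theory Num.Theory.
Import numFieldNormedType.Exports.

Local Open Scope classical_set_scope.
Local Open Scope ring_scope.

(** * Fellow travelling in the Cayley graph *)

(** Biautomaticity asks for control under left and right multiplication, so lifts of geodesics of
    [G] to [E] must move boundedly under both. The functions [H f] supply this: [H f] is translated
    by [f a] along the fibres, while multiplication by a fixed element, on the right (up to twisting
    [f]) or on the left, changes it boundedly. Elements where the vector of all [H f] is nearly as
    short as possible in its fibre thus form a coarse section of [E -> G] that is almost invariant.
    Testing this by moments against a finite invariant set of generators of [A] keeps the condition
    compatible with the action.

    The action is also why an arbitrary normal form of [A] does not serve: comparing two words
    carries the abelian part past an element of [E], which applies an automorphism to it, so the
    language for [A] must be preserved by all these automorphisms.

    [G] may be finite, cocompact, or have cusps or infinite covolume. The filling inequality needs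
    no case distinction: the part of the plane far from an orbit is handled through its chain
    components, which are finitely many up to [G]. *)

Section CayleyGraph.
Variables (R : realType) (E : groupType) (X : finType) (xbar : X -> E).
Implicit Types (p q r : cayley_point R E X) (g h : E) (w : seq X).

Lemma word_value_cons x w : word_value xbar (x :: w) = (xbar x * word_value xbar w)%g.
Proof. by rewrite /word_value big_cons. Qed.

Lemma word_value_nil : word_value xbar [::] = 1%g.
Proof. by rewrite /word_value big_nil. Qed.

Lemma cayley_path_cat p q r l m :
  cayley_path xbar p q l -> cayley_path xbar q r m -> cayley_path xbar p r (l + m).
Proof.
elim=> [{}p|g x s t {}p p' q' {}l hp hp' _ IH] hm; first by rewrite add0r.
by rewrite -addrA; apply: cayley_path_cons hp hp' (IH hm).
Qed.

Lemma cayley_path_rev p q l : cayley_path xbar p q l -> cayley_path xbar q p l.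
Proof.
elim=> [{}p|g x s t {}p p' q' {}l hp hp' _ IH]; first exact: cayley_path_nil.
rewrite addrC; apply: cayley_path_cat IH _.
by rewrite -[`|_|]addr0 distrC; apply: cayley_path_cons hp' hp _; exact: cayley_path_nil.
Qed.

Lemma cayley_path_word g w :
  cayley_path xbar (Vertex g : cayley_point R E X)
    (Vertex (g * word_value xbar w)%g) (size w)%:R.
Proof.
elim: w g => [|x w IH] g /=.
  by rewrite word_value_nil mulg1; exact: cayley_path_nil.
rewrite word_value_cons mulgA -natr1 addrC.
have -> : 1 + (size w)%:R = `|(0 : R) - 1| + (size w)%:R by rewrite sub0r normrN1.
apply: (@cayley_path_cons _ _ _ _ g x 0 1 _ (Vertex (g * xbar x)%g)) (IH _).
  by split; [rewrite lexx ler01|apply: Or32].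
by split; [rewrite lexx ler01|apply: Or33].
Qed.

Lemma word_path_near w h t (n : nat) : n%:R <= t < n.+1%:R ->
  exists2 l : R, l <= 1 &
    cayley_path xbar (word_path xbar h w t) (Vertex (h * word_value xbar (take n w))%g) l.
Proof.
elim: w h t n => [|x w IH] h t n /= /andP[nt tn].
  by exists 0; rewrite ?ler01// word_value_nil mulg1; exact: cayley_path_nil.
case: ifPn => t1.
  have -> : n = 0%N.
    by case: n nt tn => // n nt _; have := le_lt_trans nt t1; rewrite ltrn1.
  have t0 : 0 <= t by apply: le_trans nt.
  exists (`|t - 0| + 0); first by rewrite addr0 subr0 ger0_norm// ltW.
  apply: (@cayley_path_cons _ _ _ _ h x t 0 _ (Vertex h)).
  - by split; [rewrite t0 ltW|apply: Or31].
  - by split; [rewrite lexx ler01|apply: Or32].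
  - by rewrite word_value_nil mulg1; exact: cayley_path_nil.
rewrite -leNgt in t1.
case: n nt tn => [|n] nt tn; first by move: tn; rewrite ltNge t1.
rewrite word_value_cons mulgA; apply: IH.
by rewrite lerBrDr natr1 nt ltrBlDr natr1.
Qed.

Lemma cayley_path_ge0 p q l : cayley_path xbar p q l -> 0 <= l.
Proof. by elim=> // *; rewrite addr_ge0. Qed.

Lemma cayley_dist_le p q l : cayley_path xbar p q l -> cayley_dist xbar p q <= l.
Proof.
move=> pql; apply: ge_inf => //; exists 0 => m; exact: cayley_path_ge0.
Qed.

(** The [2] pays for moving each of the two points back along its edge to the last vertex passed. *)
Lemma fellow_travel_words (D : nat) h h' w w' :
  (forall n : nat, exists2 z, (size z <= D)%N &
     ((h * word_value xbar (take n w))^-1 * (h' * word_value xbar (take n w')))%g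
       = word_value xbar z) ->
  fellow_travel xbar (D%:R + 2) (word_path xbar h w : R -> _) (word_path xbar h' w').
Proof.
move=> H t t0.
have /andP[nt tn] := truncn_itv t0.
set n := Num.truncn t in nt tn.
have nP : n%:R <= t < n.+1%:R by rewrite nt.
have [l l1 lP] := word_path_near w h nP.
have [l' l1' lP'] := word_path_near w' h' nP.
have [z zD zP] := H n.
have := cayley_path_word (h * word_value xbar (take n w))%g z.
rewrite -zP mulVKg => mP.
apply: le_trans (cayley_dist_le (cayley_path_cat lP (cayley_path_cat mP (cayley_path_rev lP')))) _.
have : (size z)%:R <= D%:R :> R by rewrite ler_nat.
lra.
Qed.

Hypothesis xbar_sym : range xbar = [set g^-1%g | g in range xbar].

(** A lower bound for an infimum of path lengths. [rank1 g] is the distance from [g] cut off at 2,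
    and [rankp] extends it linearly over the edges. Along a path it grows by at most the length, so
    a path from [g] shorter than 2 that ends at a vertex ends at [g] or at a neighbour. *)
Let rank1 g h : R := if h == g then 0 else if `[< exists x, h = (g * xbar x)%g >] then 1 else 2.

Let rank1_edge g h x : `|rank1 g h - rank1 g (h * xbar x)%g| <= 1.
Proof.
rewrite /rank1; case: eqVneq => [->|hg].
  case: eqVneq => _; first by rewrite subrr normr0.
  by rewrite ifT ?sub0r ?normrN1//; apply/asboolP; exists x.
case: asboolP => [_|hN].
  by case: ifP => _; [|case: ifP => _]; rewrite ler_norml; lra.
rewrite ifF; last first.
  apply/eqP => hx; apply: hN.
  have : [set g^-1%g | g in range xbar] (xbar x)^-1%g by exists (xbar x) => //; exists x.
  by rewrite -xbar_sym => -[y _ yx]; exists y; rewrite yx -hx mulgK.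
by case: ifP => _; rewrite ler_norml; lra.
Qed.

Let rankp g p : R :=
  match p with
  | Vertex h => rank1 g h
  | EdgePoint h x s => (1 - s) * rank1 g h + s * rank1 g (h * xbar x)%g
  end.

Let rankp_path g p q l : cayley_path xbar p q l -> rankp g q <= rankp g p + l.
Proof.
have edgeE h x s q' : edge_param xbar h x s q' ->
    rankp g q' = (1 - s) * rank1 g h + s * rank1 g (h * xbar x)%g.
  by move=> [_ [->|[-> ->]|[-> ->]]] //=; rewrite ?subr0 ?subrr; lra.
elim=> [{}p|h x s t {}p p' q' {}l hp hp' _ IH]; first by rewrite addr0.
apply: le_trans IH _; rewrite addrA lerD2r.
rewrite (edgeE _ _ _ _ hp) (edgeE _ _ _ _ hp').
have := rank1_edge g h x; set a := rank1 _ _; set b := rank1 _ _ => ab.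
rewrite -lerBlDl; have -> : (1 - t) * a + t * b - ((1 - s) * a + s * b) = (s - t) * (a - b) by ring.
by rewrite (le_trans (ler_norm _))// normrM ler_piMr.
Qed.

Hypothesis xbar_gen : range (word_value xbar) = [set: E].

Lemma cayley_dist_le1 g h :
  cayley_dist xbar (Vertex g : cayley_point R E X) (Vertex h) <= 1 ->
  h = g \/ exists x, h = (g * xbar x)%g.
Proof.
move=> gh1.
(* The infimum need not be attained here: a path of length below 2 suffices. *)
have [] := @inf_adherent R [set l | cayley_path xbar (Vertex g) (Vertex h) l] 1 ltr01.
  split; last by exists 0 => m; exact: cayley_path_ge0.
  have [w _ wE] : range (word_value xbar) (g^-1 * h)%g by rewrite xbar_gen.
  by exists (size w)%:R; have := cayley_path_word g w; rewrite wE mulVKg.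
move=> l lP; rewrite -/(cayley_dist _ _ _) => l2.
have {}l2 : l < 2 by lra.
have := rankp_path g lP; rewrite /= /rank1 eqxx add0r.
case: eqVneq => [->|_]; first by left.
by case: asboolP => [|_]; [right|rewrite leNgt l2].
Qed.

(** Both fellow-traveller conditions at once: [x = 1] gives (a), and [x] a letter with [n = 1] gives
    (b). Finitely many differences at integer times have bounded word length. *)
Lemma biautomatic_of_discrete (L : set (seq X)) (F : seq E) :
  regular_language L ->
  [set word_value xbar w | w in L] = [set: E] ->
  (forall w w' x n, L w -> L w' ->
     x = 1%g \/ (exists y, x = xbar y) -> n = 1%g \/ (exists y, n = xbar y) ->
     word_value xbar w' = (x * word_value xbar w * n)%g ->
     forall t, ((x * word_value xbar (take t w))^-1 * word_value xbar (take t w'))%g \in F) ->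
  biautomatic_structure R xbar L.
Proof.
move=> regL surjL HF; split=> //.
have [D DP] : exists D : nat, forall f, f \in F -> exists2 z, (size z <= D)%N & f = word_value xbar z.
  elim: F {HF} => [|f F [D DP]]; first by exists 0%N.
  have [w _ wE] : range (word_value xbar) f by rewrite xbar_gen.
  exists (maxn D (size w)) => f'; rewrite inE => /orP[/eqP->|/DP[z zD ->]].
    by exists w; rewrite ?leq_maxr.
  by exists z => //; rewrite leq_max zD.
exists (D%:R + 2); split.
- move=> u v Lu Lv /cayley_dist_le1 uv.
  apply: fellow_travel_words => n; rewrite !mul1g.
  have nP : ((word_value xbar u)^-1 * word_value xbar v)%g = 1%g \/
      exists y, ((word_value xbar u)^-1 * word_value xbar v)%g = xbar y.
    case: uv => [->|[x ->]]; [left|right]; first by rewrite mulVg.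
    by exists x; rewrite mulKg.
  have [|z zD zE] := DP _ (HF u v 1%g _ Lu Lv (or_introl erefl) nP _ n).
    by rewrite mul1g mulVKg.
  by exists z => //; rewrite -zE mul1g.
- move=> v w x Lv Lw wv; apply: fellow_travel_words => n; rewrite mul1g.
  have xP : xbar x = 1%g \/ exists y, xbar x = xbar y by right; exists x.
  have [|z zD zE] := DP _ (HF v w (xbar x) 1%g Lv Lw xP (or_introl erefl) _ n).
    by rewrite wv word_value_cons mulg1.
  by exists z.
Qed.

End CayleyGraph.

(** * Regular languages *)

(** The Myhill-Nerode criterion with a finite invariant in place of the syntactic congruence. One
    implication is enough, since equality of invariants is symmetric. *)
Definition finite_quotients (X : finType) (L : set (seq X)) : Prop :=
  exists (Q : finType) (f : seq X -> Q),
    forall u u', f u = f u' -> forall v, L (u ++ v) -> L (u' ++ v).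

(** [f] need not be compatible with appending letters, so after each letter the automaton replaces
    the word read by a chosen representative of its invariant; by [key] this preserves the accepted
    continuations. *)
Lemma regular_of_finite_quotients (X : finType) (L : set (seq X)) :
  finite_quotients L -> regular_language L.
Proof.
case=> Q [f fP].
have [rep repP] : exists rep : Q -> seq X, forall u, f (rep (f u)) = f u.
  have /choice[rep repP] : forall q, exists w, forall u, f u = q -> f w = q.
    move=> q; have [[u uq]|nq] := pselect (exists u, f u = q); first by exists u.
    by exists [::] => u uq; case: nq; exists u.
  by exists rep => u; apply: repP.
pose step q x := f (rcons (rep q) x).
have key w v : L (rep (foldl step (f [::]) w) ++ v) <-> L (w ++ v).
  elim/last_ind: w v => [|w x IH] v /=.
    by rewrite -[X in _ <-> L X]cat0s; split; apply: fP; rewrite repP.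
  rewrite -cats1 foldl_cat /= -catA -IH catA cats1 -/(step _ _).
  by split; apply: fP; rewrite /step repP.
exists Q, (f [::]), step, (finset (fun q : Q => `[< L (rep q) >])).
by apply/funext => w /=; apply/propext; rewrite inE asboolE; have := key w [::]; rewrite !cats0 => ->.
Qed.

Lemma finite_quotientsI (X : finType) (L M : set (seq X)) :
  finite_quotients L -> finite_quotients M -> finite_quotients (L `&` M).
Proof.
move=> [Q [f fP]] [P [g gP]]; exists (Q * P)%type, (fun w => (f w, g w)).
by move=> u u' [fu gu] v [Lu Mu]; split; [apply: fP fu v Lu|apply: gP gu v Mu].
Qed.

Lemma finite_quotients_pmap (X Y : finType) (h : X -> option Y) (L : set (seq Y)) :
  finite_quotients L -> finite_quotients [set w | L (pmap h w)].
Proof.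
move=> [Q [f fP]]; exists Q, (f \o pmap h) => u u' /= fu v /=.
by rewrite !pmap_cat; exact: fP.
Qed.

Lemma finite_quotients_all (X : finType) (P : pred X) :
  finite_quotients [set w | all P w].
Proof.
exists bool, (all P) => u u' uu' v /=.
by rewrite !all_cat uu'.
Qed.

Lemma finite_quotients_pairwise (X : finType) (r : rel X) :
  finite_quotients [set w | pairwise r w].
Proof.
exists ({set X} * bool)%type, (fun w => ([set x in w], pairwise r w)) => u u' [uE puE] v /=.
rewrite !pairwise_cat puE => /and3P[/allrelP uv -> ->]; rewrite !andbT.
apply/allrelP => x y xu' yv; apply: uv => //.
by have /setP/(_ x) := uE; rewrite !inE xu'.
Qed.

(** * Winding numbers in the binary tiling *)

Fixpoint path_sum (T : Type) (V : zmodType) (f : T -> T -> V) (x : T) (s : seq T) : V :=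
  if s is y :: s' then f x y + path_sum f y s' else 0.

Lemma path_sum_cat (T : Type) (V : zmodType) (f : T -> T -> V) x s1 s2 :
  path_sum f x (s1 ++ s2) = path_sum f x s1 + path_sum f (last x s1) s2.
Proof. by elim: s1 x => [|y s IH] x /=; rewrite ?add0r// IH addrA. Qed.

Lemma path_sumB (T : Type) (V : zmodType) (f g : T -> T -> V) x s :
  path_sum (fun a b => f a b - g a b) x s = path_sum f x s - path_sum g x s.
Proof. by elim: s x => [|y s IH] x /=; rewrite ?subr0// IH opprD addrACA. Qed.

Lemma path_sum_tel (T : Type) (V : zmodType) (r : rel T) (f : T -> T -> V) (g : T -> V) x s :
  path r x s -> (forall a b, r a b -> f a b = g b - g a) ->
  path_sum f x s = g (last x s) - g x.
Proof.
move=> + fg; elim: s x => [|y s IH] x /=; first by rewrite subrr.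
by move=> /andP[xy ys]; rewrite IH// fg// addrC subrKA.
Qed.

Lemma eq_path_sum (T : eqType) (V : zmodType) (r : rel T) (f g : T -> T -> V) x s :
  path r x s ->
  (forall a b, r a b -> a \in x :: s -> b \in x :: s -> f a b = g a b) ->
  path_sum f x s = path_sum g x s.
Proof.
elim: s x => [|y s IH] x //= /andP[xy ys] fg; rewrite IH//; last first.
  by move=> a b ab aS bS; apply: fg => //; rewrite inE ?aS ?bS orbT.
by rewrite fg// !inE eqxx ?orbT.
Qed.

Lemma raddf_path_sum (T : Type) (U V : zmodType) (h : U -> V) (f : T -> T -> U) x s :
  {morph h : u v / u + v} -> h 0 = 0 ->
  h (path_sum f x s) = path_sum (fun a b => h (f a b)) x s.
Proof. by move=> hD h0; elim: s x => [|y s IH] x //=; rewrite hD IH. Qed.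

Lemma ler_norm_path_sum (T : Type) (F : numDomainType) (r : rel T) (f : T -> T -> F) (K : F) x s :
  path r x s -> (forall a b, r a b -> `|f a b| <= K) ->
  `|path_sum f x s| <= K * (size s)%:R.
Proof.
move=> + fK; elim: s x => [|y s IH] x /=; first by rewrite normr0 mulr0.
move=> /andP[xy ys]; rewrite -nat1r mulrDr mulr1.
by rewrite (le_trans (ler_normD _ _))// lerD ?fK ?IH.
Qed.

Lemma ler_norm_path_sum_norm (T : Type) (F : numDomainType) (f : T -> T -> F) x s :
  `|path_sum f x s| <= path_sum (fun a b => `|f a b|) x s.
Proof.
elim: s x => [|b t IH] a /=; first by rewrite normr0.
by rewrite (le_trans (ler_normD _ _))// lerD2l.
Qed.

Section Zsum.
Variable V : zmodType.
Implicit Type F : int -> V.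

(** The range is [-N <= i < N]. Being half-open, it is exactly what the range for [N.*2] becomes
    under halving, as [zsum_double] needs. *)
Definition zsum (N : nat) F : V := \sum_(0 <= a < N.*2) F (a%:Z - N%:Z).

Lemma zsumD N F G : zsum N (fun i => F i + G i) = zsum N F + zsum N G.
Proof. exact: big_split. Qed.

Lemma zsumB N F G : zsum N (fun i => F i - G i) = zsum N F - zsum N G.
Proof. by rewrite /zsum sumrB. Qed.

Lemma eq_zsum N F G : (forall i, F i = G i) -> zsum N F = zsum N G.
Proof. by move=> FG; apply: eq_bigr => i _. Qed.

Lemma zsum0 N F : (forall i, F i = 0) -> zsum N F = 0.
Proof. by move=> F0; apply: big1. Qed.

Lemma zsum_widen N M F : (N <= M)%N ->
  (forall i, F i != 0 -> - N%:Z <= i < N%:Z) -> zsum M F = zsum N F.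
Proof.
move=> NM F0.
have {}F0 i : ~~ (- N%:Z <= i < N%:Z) -> F i = 0.
  by move=> h; apply/eqP/negPn; apply: contra h => /F0.
elim: M NM => [|M IH]; first by rewrite leqn0 => /eqP->.
rewrite leq_eqVlt => /orP[/eqP->//|]; rewrite ltnS => NM.
rewrite -IH// /zsum doubleS big_nat_recl// big_nat_recr//=.
rewrite [X in X + _]F0; last by lia.
rewrite [X in _ + (_ + X)]F0; last by lia.
by rewrite addr0 add0r; apply: eq_bigr => i _; congr F; lia.
Qed.

Lemma zsum_shift N F : (forall i, F i != 0 -> - N%:Z <= i < N%:Z - 1) ->
  zsum N (fun i => F (i - 1)) = zsum N F.
Proof.
move=> F0.
have {}F0 i : ~~ (- N%:Z <= i < N%:Z - 1) -> F i = 0.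
  by move=> h; apply/eqP/negPn; apply: contra h => /F0.
case: N F0 => [|N] F0; first by rewrite /zsum !big_nil.
rewrite /zsum doubleS big_nat_recl// [RHS]big_nat_recr//=.
rewrite [X in X + _]F0; last by lia.
rewrite [X in _ = _ + X]F0; last by lia.
by rewrite addr0 add0r; apply: eq_bigr => i _; congr F; lia.
Qed.

Lemma zsum_double N F : zsum N.*2 F = zsum N (fun i => F (2 * i) + F (2 * i + 1)).
Proof.
rewrite /zsum; have : forall m, \sum_(0 <= a < m.*2) F (a%:Z - (N.*2)%:Z) =
   \sum_(0 <= a < m) (F (2 * (a%:Z - N%:Z)) + F (2 * (a%:Z - N%:Z) + 1)).
  elim=> [|m IH]; first by rewrite !big_nil.
  rewrite doubleS !big_nat_recr//= IH -addrA; congr (_ + (F _ + F _)); lia.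
by move=> ->.
Qed.

End Zsum.

Lemma zsum_delta (F : nzRingType) N j (f : int -> F) : - N%:Z <= j < N%:Z ->
  zsum N (fun i => (i == j)%:R * f i) = f j.
Proof.
move=> jN; rewrite /zsum (bigD1_seq (absz (j + N%:Z))) ?iota_uniq//=; last first.
  by rewrite mem_index_iota; lia.
have -> : (`|(j + N)%R|%N : int) - N%:Z = j by lia.
rewrite eqxx mul1r big1 ?addr0// => i ij.
by rewrite (negbTE (_ : i%:Z - N%:Z != j)) ?mul0r//; lia.
Qed.

Lemma zsumMl (F : nzRingType) N (f : int -> F) a : zsum N (fun i => a * f i) = a * zsum N f.
Proof. by rewrite /zsum mulr_sumr. Qed.

Lemma zsum_delta2 (F : nzRingType) N i0 k0 (f : int -> int -> F) :
  - N%:Z <= i0 < N%:Z -> - N%:Z <= k0 < N%:Z ->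
  zsum N (fun k => zsum N (fun i => ((i == i0) && (k == k0))%:R * f i k)) = f i0 k0.
Proof.
move=> iN kN; rewrite -[RHS](zsum_delta (f i0) kN); apply: eq_zsum => k.
rewrite -(zsum_delta (fun i => f i k) iN) -zsumMl; apply: eq_zsum => i.
by rewrite mulrA -natrM mulnb andbC.
Qed.

Lemma zsum_delta_le1 (F : numDomainType) N (j : int) : zsum N (fun i => (i == j)%:R) <= 1 :> F.
Proof.
have [jN|jN] := boolP (- N%:Z <= j < N%:Z).
  by rewrite -{2}(zsum_delta (fun=> 1 : F) jN) (@eq_zsum _ _ _ (fun i => (i == j)%:R * 1))// => i; rewrite mulr1.
rewrite /zsum big_nat_cond big1 ?ler01// => i iP.
by rewrite (negbTE (_ : i%:Z - N%:Z != j))//; lia.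
Qed.

Lemma ler_zsum (F : numDomainType) N (f g : int -> F) :
  (forall i, f i <= g i) -> zsum N f <= zsum N g.
Proof. by move=> fg; apply: ler_sum. Qed.

Lemma zsum_path_sum (V : zmodType) T (f : int -> T -> T -> V) N x s :
  zsum N (fun i => path_sum (f i) x s) = path_sum (fun a b => zsum N (fun i => f i a b)) x s.
Proof.
elim: s x => [|y s IH] x /=; first exact: zsum0.
by rewrite zsumD IH.
Qed.

(* The node [(i, k)] is the point of the upper half-plane with abscissa [i 2^k] and ordinate [2^k]
   (see [gpt]).  The tile [(i, k)] of the binary tiling has the bottom edges from [(2i, k)] to
   [(2i + 2, k)], the top edge from [(i, k + 1)] to [(i + 1, k + 1)], and two vertical edges. *)
Local Notation node := (int * int)%type.

Definition hstep (a b : node) := (b.1 == a.1 + 1) && (b.2 == a.2).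
Definition vstep (a b : node) := (a.1 == 2 * b.1) && (b.2 == a.2 + 1).
Definition gadj : rel node :=
  fun a b => [|| hstep a b, hstep b a, vstep a b | vstep b a].

Section Winding.

Let cross (i k : int) (a b : node) : int :=
  (vstep a b && (i < b.1) && (a.2 == k))%:Z - (vstep b a && (i < a.1) && (b.2 == k))%:Z.
(** With [vnet]: the signed number of times that a step runs along one fixed edge, here the
    horizontal edge leaving [(i, k)], in [vnet] the vertical edge arriving at [(i, k + 1)]. Winding
    numbers of adjacent tiles differ by these counts. *)
Let hnet (i k : int) (a b : node) : int :=
  (hstep a b && (a.1 == i) && (a.2 == k))%:Z - (hstep b a && (b.1 == i) && (b.2 == k))%:Z.
Let vnet (i k : int) (a b : node) : int :=
  (vstep a b && (b.1 == i) && (a.2 == k))%:Z - (vstep b a && (a.1 == i) && (b.2 == k))%:Z.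

(* The signed number of vertical edges of the loop crossing the level [k] to the right of the
   tile [(i, k)]. *)
Definition winding (x : node) (s : seq node) (i k : int) : int := path_sum (cross i k) x s.

Variables (x : node) (s : seq node).
Hypotheses (xs : path gadj x s) (sx : last x s = x).

Let winding_left i k : winding x s (i - 1) k - winding x s i k = path_sum (vnet i k) x s.
Proof.
rewrite /winding -path_sumB; apply: (eq_path_sum xs) => a b _ _ _.
by rewrite /cross /vnet; case: (vstep a b); case: (vstep b a); rewrite ?andTb ?andFb; lia.
Qed.

(** These are the tiles on the two sides of the horizontal edge leaving [(i, k)]. A closed loop
    leaves the half-row of nodes [(j, k)], [j > i], as often as it enters it, and it can do so only
    through this edge or through vertical edges; the indicator of the half-row is the potential
    below. *)
Let winding_up i k :
  winding x s (i %/ 2)%Z k - winding x s i (k - 1) = path_sum (hnet i k) x s.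
Proof.
apply/eqP; rewrite -subr_eq0 /winding -!path_sumB; apply/eqP.
rewrite (@path_sum_tel _ _ gadj _ (fun c : node => - ((c.2 == k) && (i < c.1))%:Z)) ?sx ?subrr//.
move=> [a1 a2] [b1 b2]; rewrite /gadj /cross /hnet /hstep /vstep /=.
have e1 (z : int) : (z == z + 1) = false by lia.
have e2 (z : int) : (z + 1 == z) = false by lia.
have e3 (z : int) : (z == z + 1 + 1) = false by lia.
by case/or4P => /andP[/eqP -> /eqP ->]; rewrite ?e1 ?e2 ?e3 ?andbF ?eqxx /=; lia.
Qed.

Lemma winding_supp : exists N : nat, forall i k, winding x s i k != 0 ->
  (- N%:Z <= i < N%:Z) && (- N%:Z <= k < N%:Z).
Proof.
have [N NP] : exists N : nat, forall a : node, a \in x :: s ->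
    (- N%:Z < a.1 < N%:Z) && (- N%:Z < a.2 < N%:Z).
  elim: (x :: s) => [|a t [N NP]]; first by exists 0%N.
  exists (N + absz a.1 + absz a.2 + 1)%N => b; rewrite inE => /orP[/eqP->|/NP]; lia.
exists N => i k; apply: contraNT => h.
have e1 (z : int) : (z == z + 1) = false by lia.
have e2 (z : int) : (z + 1 == z) = false by lia.
have e3 (z : int) : (z == z + 1 + 1) = false by lia.
(* To the left of the loop every vertical edge at level [k] counts, so the sum telescopes to a net
   change of level, which is zero. In the other directions no edge counts. *)
have [iN|iN] := boolP (i < - N%:Z).
  rewrite /winding (@eq_path_sum _ _ gadj _ (fun a b : node => (k < b.2)%R%:Z - (k < a.2)%R%:Z) _ _ xs).
    by rewrite (path_sum_tel xs (g := fun a : node => (k < a.2)%R%:Z)) ?sx ?subrr.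
  move=> [a1 a2] [b1 b2] + /NP + /NP; rewrite /gadj /cross /hstep /vstep /=.
  by case/or4P => /andP[/eqP -> /eqP ->]; rewrite ?e1 ?e2 ?e3 ?andbF ?eqxx /=; lia.
rewrite /winding (@eq_path_sum _ _ gadj _ (fun a b => 0) _ _ xs).
  by rewrite (path_sum_tel xs (g := fun=> 0)) // => *; rewrite subrr.
move=> [a1 a2] [b1 b2] + /NP + /NP; rewrite /gadj /cross /hstep /vstep /=.
by case/or4P => /andP[/eqP -> /eqP ->]; rewrite ?e1 ?e2 ?e3 ?andbF ?eqxx /=; lia.
Qed.

(** The edge between the two tiles ends at [(i, k + 1)]; the one in [winding_up_eq] starts there. *)
Lemma winding_left_eq i k : (i, k + 1) \notin x :: s ->
  winding x s (i - 1) k = winding x s i k.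
Proof.
move=> h; apply/eqP; rewrite -subr_eq0 winding_left.
rewrite (@eq_path_sum _ _ gadj _ (fun a b => 0) _ _ xs).
  by rewrite (path_sum_tel xs (g := fun=> 0)) // => *; rewrite subrr.
move=> a b _ /(memPn h) + /(memPn h); rewrite /vnet /vstep.
case: a b => [a1 a2] [b1 b2] /=; rewrite !xpair_eqE; lia.
Qed.

Lemma winding_up_eq i k : (i, k + 1) \notin x :: s ->
  winding x s (i %/ 2)%Z (k + 1) = winding x s i k.
Proof.
move=> h; apply/eqP; rewrite -subr_eq0 -{2}[k](addrK 1) winding_up.
rewrite (@eq_path_sum _ _ gadj _ (fun a b => 0) _ _ xs).
  by rewrite (path_sum_tel xs (g := fun=> 0)) // => *; rewrite subrr.
move=> a b _ /(memPn h) + /(memPn h); rewrite /hnet /hstep.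
case: a b => [a1 a2] [b1 b2] /=; rewrite !xpair_eqE; lia.
Qed.


Let hnet1 (a b : node) : gadj a b -> exists j l, forall i k, `|hnet i k a b| <= ((k == l) && (i == j))%:R.
Proof.
move: a b => [a1 a2] [b1 b2]; rewrite /gadj /hnet /hstep /vstep /=.
have e1 (z : int) : (z == z + 1) = false by lia.
have e2 (z : int) : (z + 1 == z) = false by lia.
case/or4P => /andP[/eqP -> /eqP ->].
- exists a1, a2 => i k; rewrite ?e1 ?e2 ?andbF ?eqxx /=; lia.
- exists b1, b2 => i k; rewrite ?e1 ?e2 ?andbF ?eqxx /=; lia.
- exists 0, 0 => i k; rewrite ?e1 ?e2 ?andbF ?eqxx /=; lia.
- exists 0, 0 => i k; rewrite ?e1 ?e2 ?andbF ?eqxx /=; lia.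
Qed.

(* Each value of the winding number is, up to horizontal edges of the loop, the mean of two
   values one level below, so that the sums over the levels decrease geometrically. *)
Lemma winding_sum_le N :
  (forall i k, winding x s i k != 0 -> (- N%:Z <= i < N%:Z) && (- N%:Z <= k < N%:Z)) ->
  zsum N (fun k => zsum N (fun i => `|winding x s i k|)) <= (size s)%:Z.
Proof.
move=> NP; pose M := N.+1.
pose W k := zsum M (fun i => `|winding x s i k|).
pose H k := zsum M.*2 (fun i => `|path_sum (hnet i k) x s|).
have WE k : zsum N (fun i => `|winding x s i k|) = W k.
  by rewrite /W (@zsum_widen _ N M)// => i; rewrite normr_eq0 => /NP/andP[].
have W0 k : W k != 0 -> - N%:Z <= k < N%:Z.
  apply: contraNT => kN; rewrite /W zsum0// => i; apply/eqP; rewrite normr_eq0.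
  by apply: contraNT kN => /NP/andP[].
have -> : zsum N (fun k => zsum N (fun i => `|winding x s i k|)) = zsum M W.
  by rewrite (@zsum_widen _ N M)//; apply: eq_zsum.
have step k : 2 * W k <= W (k - 1) + H k.
  rewrite /H zsum_double [W (k - 1)](_ : _ = zsum M.*2 (fun i => `|winding x s i (k - 1)|)); last first.
    by rewrite (@zsum_widen _ M M.*2)//; [lia|move=> i; rewrite normr_eq0 => /NP; lia].
  rewrite zsum_double -zsumD -zsumMl; apply: ler_zsum => i.
  have := winding_up (2 * i) k; have := winding_up (2 * i + 1) k.
  have -> : ((2 * i + 1) %/ 2)%Z = i by lia.
  have -> : ((2 * i) %/ 2)%Z = i by lia.
  lia.
have Hs : zsum M H <= (size s)%:Z.
  have : zsum M H <= zsum M (fun k => zsum M.*2 (fun i => path_sum (fun a b => `|hnet i k a b|) x s)).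
    apply: ler_zsum => k; apply: ler_zsum => i.
    exact: ler_norm_path_sum_norm.
  move=> /le_trans; apply.
  rewrite (@eq_zsum _ _ _ (fun k => path_sum (fun a b => zsum M.*2 (fun i => `|hnet i k a b|)) x s)); last first.
    by move=> k; rewrite zsum_path_sum.
  rewrite zsum_path_sum; set f := (X in path_sum X).
  have : forall a b, gadj a b -> `|f a b| <= 1.
    move=> a b /hnet1[j [l jl]]; rewrite /f ger0_norm; last first.
      by apply: sumr_ge0 => k _; apply: sumr_ge0.
    apply: (@le_trans _ _ (zsum M (fun k => (k == l)%:R))); last exact: zsum_delta_le1.
    apply: ler_zsum => k; apply: (@le_trans _ _ (zsum M.*2 (fun i => (k == l)%:R * (i == j)%:R))).
      by apply: ler_zsum => i; rewrite -natrM mulnb.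
    by rewrite zsumMl ler_piMr// zsum_delta_le1.
  move=> /(ler_norm_path_sum xs); rewrite mul1r natz; apply: le_trans; exact: ler_norm.
have : zsum M (fun k => 2 * W k) <= zsum M (fun k => W (k - 1) + H k) by exact: ler_zsum.
rewrite zsumMl zsumD zsum_shift; last by move=> k /W0; rewrite /M; lia.
rewrite -/(zsum M W); move: Hs; set a := zsum M W; set b := zsum M H; lia.
Qed.

Variables (F : realFieldType) (c : node -> node -> F) (K : F).
Hypothesis cN : forall a b, c a b = - c b a.

(* The integral of [c] along the boundary of the tile [(i, k)]. *)
Definition tile (i k : int) : F :=
  c (2 * (i + 1), k) (i + 1, k + 1) - c (2 * i, k) (i, k + 1)
  + (c (2 * i, k) (2 * i + 1, k) + c (2 * i + 1, k) (2 * i + 1 + 1, k))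
  - c (i, k + 1) (i + 1, k + 1).

Let cH i k := c (i, k) (i + 1, k).
Let cV i k := c (2 * i, k) (i, k + 1).

Let step_tiles T (a b : node) : gadj a b ->
  (- T%:Z <= a.1 < T%:Z) && (- T%:Z <= a.2 < T%:Z) ->
  (- T%:Z <= b.1 < T%:Z) && (- T%:Z <= b.2 < T%:Z) ->
  c a b = zsum T (fun k => zsum T (fun i =>
            (hnet i k a b)%:~R * cH i k + (vnet i k a b)%:~R * cV i k)).
Proof.
move: a b => [a1 a2] [b1 b2]; rewrite /gadj /hnet /vnet /hstep /vstep /=.
have e1 (z : int) : (z == z + 1) = false by lia.
have e2 (z : int) : (z + 1 == z) = false by lia.
have e3 (z : int) : (z == z + 1 + 1) = false by lia.
case/or4P => /andP[/eqP -> /eqP ->] /andP[aT1 aT2] /andP[bT1 bT2].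
- rewrite -[LHS](zsum_delta2 (i0 := a1) (k0 := a2) cH aT1 aT2).
  apply: eq_zsum => k; apply: eq_zsum => i.
  by rewrite ?e1 ?e2 ?e3 ?andbF ?eqxx /= ?subr0 mul0r addr0 (eq_sym a1) (eq_sym a2).
- rewrite cN -[X in - X](zsum_delta2 (i0 := b1) (k0 := b2) cH bT1 bT2) -mulN1r -zsumMl.
  apply: eq_zsum => k; rewrite -zsumMl; apply: eq_zsum => i.
  rewrite ?e1 ?e2 ?e3 ?andbF ?eqxx /= ?subr0 ?sub0r mul0r addr0 (eq_sym b1) (eq_sym b2).
  by rewrite mulN1r -mulNr mulrNz.
- rewrite -[LHS](zsum_delta2 (i0 := b1) (k0 := a2) cV bT1 aT2).
  apply: eq_zsum => k; apply: eq_zsum => i.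
  by rewrite ?e1 ?e2 ?e3 ?andbF ?eqxx /= ?subr0 mul0r add0r (eq_sym b1) (eq_sym a2).
- rewrite cN -[X in - X](zsum_delta2 (i0 := a1) (k0 := b2) cV aT1 bT2) -mulN1r -zsumMl.
  apply: eq_zsum => k; rewrite -zsumMl; apply: eq_zsum => i.
  rewrite ?e1 ?e2 ?e3 ?andbF ?eqxx /= ?subr0 ?sub0r mul0r add0r (eq_sym a1) (eq_sym b2).
  by rewrite mulN1r -mulNr mulrNz.
Qed.

(** Discrete Stokes: write the sum over the loop as a sum over edges with their net multiplicities,
    replace each multiplicity by the difference of the winding numbers on its two sides, and sum by
    parts. *)
Lemma path_sum_tiles N :
  (forall i k, winding x s i k != 0 -> (- N%:Z <= i < N%:Z) && (- N%:Z <= k < N%:Z)) ->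
  path_sum c x s = zsum N (fun k => zsum N (fun i => (winding x s i k)%:~R * tile i k)).
Proof.
move=> NP.
have [N' N'P] : exists N : nat, forall a : node, a \in x :: s ->
    (- N%:Z < a.1 < N%:Z) && (- N%:Z < a.2 < N%:Z).
  elim: (x :: s) => [|a t [N0 N0P]]; first by exists 0%N.
  exists (N0 + absz a.1 + absz a.2 + 1)%N => b; rewrite inE => /orP[/eqP->|/N0P]; lia.
(* [T] is even and leaves room around the support, so halving the horizontal range and shifting
   either range by one lose no term. *)
pose M := (N + N').+1; pose T := M.*2.
pose w i k : F := (winding x s i k)%:~R.
have w0 i k : w i k != 0 -> (- N%:Z <= i < N%:Z) && (- N%:Z <= k < N%:Z).
  by rewrite intr_eq0 => /NP.
have wM0 i k a : w i k * a != 0 -> (- N%:Z <= i < N%:Z) && (- N%:Z <= k < N%:Z).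
  by move=> wa; apply: w0; apply: contraNneq wa => ->; rewrite mul0r.
have sum0 k (f : int -> F) m : zsum m (fun i => w i k * f i) != 0 -> - N%:Z <= k < N%:Z.
  apply: contraNT => kN; rewrite zsum0// => i; apply/eqP; apply: contraNT kN.
  by move=> /wM0/andP[].
have -> : path_sum c x s = zsum T (fun k => zsum T (fun i =>
    (path_sum (hnet i k) x s)%:~R * cH i k + (path_sum (vnet i k) x s)%:~R * cV i k)).
  rewrite (eq_path_sum xs (g := fun a b => zsum T (fun k => zsum T (fun i =>
            (hnet i k a b)%:~R * cH i k + (vnet i k a b)%:~R * cV i k)))); last first.
    by move=> a b ab /N'P aN /N'P bN; apply: step_tiles => //; lia.
  rewrite -zsum_path_sum; apply: eq_zsum => k; rewrite -zsum_path_sum; apply: eq_zsum => i.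
  elim: s x => [|b t IH] a /=; first by rewrite !mul0r addr0.
  by rewrite IH !rmorphD /= !mulrDl addrACA.
have -> : zsum N (fun k => zsum N (fun i => w i k * tile i k)) =
    zsum T (fun k => zsum T (fun i => w i k * tile i k)).
  rewrite [RHS](@zsum_widen _ N)//; first 1 last.
  - by rewrite /T /M; lia.
  - by move=> k; exact: sum0.
  apply: eq_zsum => k; rewrite [RHS](@zsum_widen _ N)//; first by rewrite /T /M; lia.
  by move=> i /wM0/andP[].
under eq_zsum => k.
  have -> : zsum T (fun i => (path_sum (hnet i k) x s)%:~R * cH i k + (path_sum (vnet i k) x s)%:~R * cV i k)
     = zsum T (fun i => w i k * (tile i k + cH i (k + 1))) - zsum T (fun i => w i (k - 1) * cH i k).
    rewrite (@eq_zsum _ _ _ (fun i => w (i %/ 2)%Z k * cH i k - w i (k - 1) * cH i k +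
       (w (i - 1) k * cV i k - w i k * cV i k))); last first.
      by move=> i; rewrite -winding_up -winding_left !rmorphB /= !mulrBl.
    rewrite zsumD !zsumB addrAC; congr (_ - _).
    rewrite {1}/T zsum_double.
    rewrite (@eq_zsum _ _ _ (fun i => w i k * (cH (2 * i) k + cH (2 * i + 1) k))); last first.
      move=> i; have -> : ((2 * i + 1) %/ 2)%Z = i by lia.
      have -> : ((2 * i) %/ 2)%Z = i by lia.
      by rewrite mulrDr.
    rewrite -(@zsum_widen _ M T); first 1 last.
    - by rewrite /T; lia.
    - by move=> i /wM0; rewrite /M; lia.
    rewrite (@eq_zsum _ T (fun i => w (i - 1) k * cV i k) (fun i => w (i - 1) k * cV (i - 1 + 1) k)); last first.
      by move=> i; rewrite subrK.
    rewrite (@zsum_shift _ T (fun i => w i k * cV (i + 1) k)); last by move=> i /wM0; rewrite /T /M; lia.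
    rewrite -zsumB -zsumD; apply: eq_zsum => i; rewrite /tile /cV /cH; ring.
  over.
rewrite zsumB.
rewrite (@eq_zsum _ T (fun k => zsum T (fun i => w i (k - 1) * cH i k))
   (fun k => zsum T (fun i => w i (k - 1) * cH i (k - 1 + 1)))); last by move=> k; rewrite subrK.
rewrite (@zsum_shift _ T (fun k => zsum T (fun i => w i k * cH i (k + 1)))); last first.
  by move=> k /sum0; rewrite /T /M; lia.
rewrite -zsumB; apply: eq_zsum => k; rewrite -zsumB; apply: eq_zsum => i; ring.
Qed.

Lemma path_sum_tile_le :
  (forall i k, winding x s i k != 0 -> `|tile i k| <= K) -> 0 <= K ->
  `|path_sum c x s| <= K * (size s)%:R.
Proof.
move=> tileK K0; have [N NP] := winding_supp.
rewrite (path_sum_tiles NP).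
have -> : (size s)%:R = ((size s)%:Z)%:~R :> F by [].
apply: (@le_trans _ _ (K * (zsum N (fun k => zsum N (fun i => `|winding x s i k|)))%:~R)); last first.
  by rewrite ler_wpM2l// ler_int winding_sum_le.
rewrite /zsum rmorph_sum /= mulr_sumr (le_trans (ler_norm_sum _ _ _))//.
apply: ler_sum => k _; rewrite rmorph_sum /= mulr_sumr (le_trans (ler_norm_sum _ _ _))//.
apply: ler_sum => i _; rewrite normrM mulrC intr_norm.
have [->|/tileK] := eqVneq (winding x s (i%:Z - N%:Z) (k%:Z - N%:Z)) 0; first by rewrite normr0 !mulr0.
by move=> h; rewrite ler_wpM2r.
Qed.

End Winding.

(** * Hyperbolic geometry of discrete orbits *)

Section HyperbolicPlane.
Variable R : realType.
Local Notation H := (hyperbolic_plane R).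
Implicit Types (p q z w : H) (r s e : R).

Definition hx z : R := (val z).1.
Definition hy z : R := (val z).2.

Lemma hy_gt0 z : 0 < hy z.
Proof. by have := valP z; rewrite inE. Qed.

Definition hpoint (x y : R) : H :=
  if pselect (0 < y) is left y0 then exist _ (x, y) (mem_set (y0 : hyperbolic_plane R (x, y)))
  else exist _ (0, 1) (mem_set (ltr01 : hyperbolic_plane R (0, 1))).

Lemma hx_point x y : 0 < y -> hx (hpoint x y) = x.
Proof. by rewrite /hpoint; case: pselect. Qed.

Lemma hy_point x y : 0 < y -> hy (hpoint x y) = y.
Proof. by rewrite /hpoint; case: pselect. Qed.

(* [cosh d - 1], where [d] is the hyperbolic distance. *)
Definition hq z w : R :=
  ((hx z - hx w) ^+ 2 + (hy z - hy w) ^+ 2) / (2 * hy z * hy w).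

Lemma hq_ge0 z w : 0 <= hq z w.
Proof.
by rewrite /hq divr_ge0 ?addr_ge0 ?sqr_ge0// !mulr_ge0// ltW// hy_gt0.
Qed.

Lemma hqxx z : hq z z = 0.
Proof. by rewrite /hq !subrr expr0n addr0 mul0r. Qed.

Lemma hqC z w : hq z w = hq w z.
Proof. by rewrite /hq; congr (_ / _); ring. Qed.

Lemma hq_leP z w r :
  hq z w <= r <-> (hx z - hx w) ^+ 2 + (hy z - hy w) ^+ 2 <= 2 * r * hy z * hy w.
Proof.
have zw : 0 < 2 * hy z * hy w by rewrite !mulr_gt0// hy_gt0.
by rewrite /hq ler_pdivrMr// [r * _]mulrC -!mulrA (mulrCA r) (mulrC r) !mulrA; split.
Qed.

Lemma hq_hy z w r : hq z w <= r -> hy w <= (2 * r + 2) * hy z.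
Proof.
move=> /hq_leP h; have y1 := hy_gt0 z; have y2 := hy_gt0 w.
rewrite -(ler_pM2r y2).
have := sqr_ge0 (hx z - hx w); have := sqr_ge0 (hy z); nra.
Qed.

(** A crude triangle inequality for [cosh d - 1]. The constants are irrelevant: it serves to see
    that bounded steps compose to a bounded one. Squares of sums are at most doubled, and [hq_hy]
    makes the heights comparable. *)
Lemma hq_trans r s z w u : hq z w <= r -> hq w u <= s ->
  hq z u <= 8 * r * s + 4 * r + 4 * s.
Proof.
move=> zw wu.
have r0 : 0 <= r by rewrite (le_trans (hq_ge0 z w)).
have s0 : 0 <= s by rewrite (le_trans (hq_ge0 w u)).
have h1 : hy w <= (2 * s + 2) * hy u by apply: hq_hy; rewrite hqC.
have h2 := hq_hy zw.
move/hq_leP in zw; move/hq_leP in wu; apply/hq_leP.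
have y1 := hy_gt0 z; have y2 := hy_gt0 w; have y3 := hy_gt0 u.
set x1 := hx z in zw *; set x2 := hx w in zw wu *; set x3 := hx u in wu *.
set a := hy z in zw h2 y1 *; set b := hy w in zw wu h1 h2 y2 *; set c := hy u in wu h1 y3 *.
have e1 : (x1 - x3) ^+ 2 <= 2 * (x1 - x2) ^+ 2 + 2 * (x2 - x3) ^+ 2.
  by rewrite -subr_ge0 (_ : _ - _ = (x1 - 2 * x2 + x3) ^+ 2) ?sqr_ge0//; ring.
have e2 : (a - c) ^+ 2 <= 2 * (a - b) ^+ 2 + 2 * (b - c) ^+ 2.
  by rewrite -subr_ge0 (_ : _ - _ = (a - 2 * b + c) ^+ 2) ?sqr_ge0//; ring.
have e3 : r * a * b <= r * a * ((2 * s + 2) * c) by rewrite ler_wpM2l ?mulr_ge0// ltW.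
have e4 : s * c * b <= s * c * ((2 * r + 2) * a) by rewrite ler_wpM2l ?mulr_ge0// ltW.
nra.
Qed.

Lemma hq_le_of (b d r : R) z w : (hx z - hx w) ^+ 2 <= b * hy z * hy w ->
  (hy z - hy w) ^+ 2 <= d * hy z * hy w -> b + d <= 2 * r -> hq z w <= r.
Proof.
move=> h1 h2 h3; apply/hq_leP.
apply: le_trans (lerD h1 h2) _; rewrite -!mulrDl ler_pM2r ?hy_gt0// ler_pM2r ?hy_gt0//.
Qed.

(** The argument [u] of the logarithm satisfies [u + u^-1 = 2 c], so it determines [c]. *)
Lemma hyperbolic_dist_inj z w z' w' :
  hyperbolic_dist z w = hyperbolic_dist z' w' -> hq z w = hq z' w'.
Proof.
have E (u v : H) : hyperbolic_dist u v = ln (1 + hq u v + Num.sqrt ((1 + hq u v) ^+ 2 - 1)).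
  by rewrite /hyperbolic_dist /hq /hx /hy; case: (val u) (val v) => [? ?] [? ?].
rewrite !E.
have arc (c : R) : 1 <= c -> 0 < c + Num.sqrt (c ^+ 2 - 1) /\
    2 * c = (c + Num.sqrt (c ^+ 2 - 1)) + (c + Num.sqrt (c ^+ 2 - 1))^-1.
  move=> c1; have c2 : 0 <= c ^+ 2 - 1 by rewrite subr_ge0 expr_ge1//; lra.
  set t := Num.sqrt _; have t0 : 0 <= t by exact: sqrtr_ge0.
  have tE : t ^+ 2 = c ^+ 2 - 1 by rewrite sqr_sqrtr.
  have u0 : 0 < c + t by lra.
  split=> //; have -> : (c + t)^-1 = c - t; last by ring.
  by apply: (mulfI (lt0r_neq0 u0)); rewrite divff ?lt0r_neq0// [RHS]mulrC -subr_sqr tE; ring.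
have [] := arc (1 + hq z w); first by rewrite lerDl hq_ge0.
have [] := arc (1 + hq z' w'); first by rewrite lerDl hq_ge0.
set u := (_ + Num.sqrt _); set u' := (_ + Num.sqrt _) => u0 uE u'0 u'E /ln_inj.
rewrite !posrE => /(_ u'0 u0) uu'; move: uE u'E; rewrite uu'; lra.
Qed.

(** In the ball all heights lie between [m] and [B], so a Euclidean grid of mesh [e1 * m] is fine
    enough: squared displacements are at most [e1 ^+ 2 * m ^+ 2], hence at most [e] times the
    product of the heights. *)
Lemma hq_bounded_cells (z : H) r e : 0 <= r -> 0 < e -> exists (T : finType) (cell : H -> T),
  forall p q, hq z p <= r -> hq z q <= r -> cell p = cell q -> hq p q <= e.
Proof.
move=> r0 e0; pose e1 := Num.min 1 e.
have e10 : 0 < e1 by rewrite lt_min ltr01.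
have e11 : e1 ^+ 2 <= e.
  by rewrite /e1 expr2; have [h|h] := leP 1 e; rewrite ?mulr1 //; nra.
have k0 : 0 < 2 * r + 2 by lra.
pose m := hy z / (2 * r + 2); have m0 : 0 < m by rewrite divr_gt0 ?hy_gt0//; lra.
pose eta := e1 * m; have eta0 : 0 < eta by rewrite mulr_gt0.
pose B := (2 * r + 2) * hy z; have B0 : 0 < B by rewrite mulr_gt0 ?hy_gt0//; lra.
have xB p : hq z p <= r -> `|hx p - hx z| <= B.
  move=> zp; have h := hq_hy zp; move/hq_leP in zp.
  rewrite -(@ler_pXn2r _ 2%N)// ?nnegrE// ?ltW// -normrX ger0_norm ?sqr_ge0//.
  have := hy_gt0 z; have := hy_gt0 p; rewrite /B; set y := hy z in zp h *; set y' := hy p in zp h * => y'0 y0.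
  have e3 : r * y * y' <= r * y * ((2 * r + 2) * y) by rewrite ler_wpM2l ?mulr_ge0// ltW.
  have := sqr_ge0 (y - y'); rewrite (_ : (hx p - hx z) ^+ 2 = (hx z - hx p) ^+ 2); last by ring.
  nra.
have ym p : hq z p <= r -> m <= hy p /\ hy p <= B.
  move=> zp; split; last exact: hq_hy.
  by rewrite /m (ler_pdivrMr _ _ k0) mulrC; apply: hq_hy; rewrite hqC.
pose M := (Num.truncn (B / eta)).+1.
have flB (t : R) : `|t| <= B -> `|Num.floor (t / eta)| <= M%:Z.
  move=> tB; have tb : `|t / eta| < M%:R.
    rewrite normrM [`|eta^-1|]gtr0_norm ?invr_gt0//.
    by apply: le_lt_trans (truncnS_gt _); rewrite ler_pM2r ?invr_gt0.
  rewrite ler_norml; apply/andP; split.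
    by rewrite floor_ge_int_tmp; move: tb; rewrite ltr_norml mulrNz => /andP[/ltW].
  rewrite -(ler_int R); apply: le_trans (floor_le _) _.
  by move: tb; rewrite ltr_norml => /andP[_ /ltW].
pose cl (t : R) : 'I_(2 * M).+1 := inord (absz (Num.floor (t / eta) + M%:Z)).
have clP t t' : `|t| <= B -> `|t'| <= B -> cl t = cl t' -> `|t - t'| <= eta.
  move=> /flB tB /flB t'B /(congr1 val); rewrite /= !inordK; try lia.
  move=> ff; have {}ff : Num.floor (t / eta) = Num.floor (t' / eta) by lia.
  have /andP[a1 a2] := floor_itv (t / eta); have /andP[b1 b2] := floor_itv (t' / eta).
  rewrite ff in a1 a2; rewrite -[eta]mul1r -ler_pdivrMr// -[X in _ / X](gtr0_norm eta0) -normf_div mulrBl ler_norml.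
  by rewrite intrD in a2 b2; lra.
exists ('I_(2 * M).+1 * 'I_(2 * M).+1)%type, (fun p => (cl (hx p - hx z), cl (hy p))) => p q zp zq [cx cy].
have [p1 p2] := ym _ zp; have [q1 q2] := ym _ zq.
have xx := clP _ _ (xB _ zp) (xB _ zq) cx.
have yy : `|hy p - hy q| <= eta.
  by apply: clP cy; rewrite gtr0_norm ?hy_gt0.
have mm : m ^+ 2 <= hy p * hy q by rewrite expr2 ler_pM// ltW.
have sq (t : R) : `|t| <= eta -> t ^+ 2 <= e * hy p * hy q.
  move=> te; have : `|t| ^+ 2 <= eta ^+ 2 by rewrite ler_pXn2r// nnegrE// ltW.
  rewrite -normrX ger0_norm ?sqr_ge0// => /le_trans; apply.
  rewrite /eta exprMn -mulrA; apply: ler_pM => //; exact: sqr_ge0.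
apply: (@hq_le_of e e) => //; [|exact: sq|lra].
by apply: sq; move: xx; rewrite opprB addrA subrK.
Qed.

End HyperbolicPlane.

Lemma finite_classes (T : choiceType) (Q : finType) (S : set T) (f : T -> Q) (r : T -> seq T) :
  (forall x y, S x -> S y -> f x = f y -> y \in r x) -> exists s : seq T, forall x, S x -> x \in s.
Proof.
move=> fr.
have /choice[g gP] : forall q, exists s : seq T, forall x, S x -> f x = q -> x \in s.
  move=> q; have [[x [Sx fx]]|h] := pselect (exists x, S x /\ f x = q).
    by exists (r x) => y Sy fy; apply: fr; rewrite ?fx.
  by exists [::] => y Sy fy; case: h; exists y.
exists (flatten [seq g q | q <- enum Q]) => x Sx; apply/flattenP; exists (g (f x)); last exact: gP.
by apply/mapP; exists (f x); rewrite ?mem_enum.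
Qed.

(** * Discreteness in the compact-open topology and finiteness of bounded parts of orbits *)

Section Topology.
Variable R : realType.
Local Notation H := (hyperbolic_plane R).
Implicit Types (p q z w : H).

Lemma nbhs_box z (d : R) : 0 < d ->
  \forall p \near nbhs z, `|hx z - hx p| < d /\ `|hy z - hy p| < d.
Proof.
move=> d0.
have : nbhs (val z) (ball (val z) d) by exact: nbhsx_ballx.
have : continuous (val : H -> R * R) by exact: initial_continuous.
move=> cv nb; have : nbhs z (val @^-1` ball (val z) d) by exact: (cv z _ nb).
by apply: filterS => p [].
Qed.

Lemma nbhs_boxP z (U : set H) : nbhs z U ->
  exists2 d : R, 0 < d & forall p, `|hx z - hx p| < d -> `|hy z - hy p| < d -> U p.
Proof.
rewrite nbhsE => -[B [[V oV VB] Bz] BU].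
have : nbhs (val z) V by apply: open_nbhs_nbhs; split => //; rewrite -VB in Bz.
rewrite -nbhs_ballE => -[d /= d0 dV]; exists d => // p xp yp.
by apply: BU; rewrite -VB; apply: dV.
Qed.

End Topology.

(** Otherwise the nontrivial maps of [S] that move the points of larger and larger balls less and
    less generate a proper filter. It converges to the identity uniformly on compact sets, which
    contradicts isolation. *)
Lemma discrete_near_id (R : realType)
    (S : set {compact-open, hyperbolic_plane R -> hyperbolic_plane R}) (z : hyperbolic_plane R) :
  discrete_maps S -> S id ->
  exists n : nat, forall f, S f ->
    (forall p, hq z p <= n%:R -> hq p (f p) <= n.+1%:R^-1) -> f = id.
Proof.
move=> /(_ id) /[apply] -[_ [V nV VS]]; apply: contrapT => Hn.
pose B (n : nat) := [set f | [/\ S f, f <> id & forall p, hq z p <= n%:R -> hq p (f p) <= n.+1%:R^-1]].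
have B0 n : B n !=set0.
  apply: contrapT => Bn; apply: Hn; exists n => f Sf fP; apply: contrapT => fid.
  by apply: Bn; exists f.
pose F := filter_from [set: nat] B.
have FF : ProperFilter F.
  apply: filter_from_proper; last by move=> n _; exact: B0.
  apply: filter_from_filter; first by exists 0%N.
  move=> i j _ _; exists (maxn i j) => // f [Sf fid fP]; split; split=> // p zp.
    apply: le_trans (fP p _) _; first by rewrite (le_trans zp)// ler_nat leq_maxl.
    by rewrite lef_pV2 ?posrE// ler_nat ltnS leq_maxl.
  apply: le_trans (fP p _) _; first by rewrite (le_trans zp)// ler_nat leq_maxr.
  by rewrite lef_pV2 ?posrE// ler_nat ltnS leq_maxr.
have Fid : {compact-open, F --> (id : hyperbolic_plane R -> hyperbolic_plane R)}.
  apply/compact_open_cvgP => K O /compact_near_coveringP cK oO KO.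
  have [n1 n1P] : exists n : nat, forall p, K p -> hq z p <= n%:R.
    have := cK nat \oo (fun n p => hq z p <= n%:R) _ _; case.
      move=> x Kx; pose N := (Num.truncn (8 * hq z x * 1 + 4 * hq z x + 4 * 1)).+1.
      have y0 := hy_gt0 x.
      exists ([set p | `|hx x - hx p| < hy x / 2 /\ `|hy x - hy p| < hy x / 2], [set n | (N <= n)%N]).
        by split; [apply: nbhs_box; rewrite divr_gt0|exists N].
      move=> [p n] [[/= xp yp] Nn] /=.
      have xp1 : hq x p <= 1.
        move: xp yp; rewrite !ltr_norml => /andP[a1 a2] /andP[b1 b2].
        apply: (@hq_le_of _ 1 1) => //; rewrite ?mul1r; nra.
      apply: le_trans (hq_trans (lexx _) xp1) _.
      by apply: le_trans (ltW (truncnS_gt _)) _; rewrite ler_nat.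
    by move=> n _ /(_ n) /= h; exists n => p; apply: h => //; rewrite /= leqnn.
  (* A Lebesgue number of [K] inside [O], from the same form of compactness. *)
  have [n2 n2P] : exists n : nat, forall p, K p -> forall q, hq p q <= n.+1%:R^-1 -> O q.
    have := cK nat \oo (fun n p => forall q, hq p q <= n.+1%:R^-1 -> O q) _ _; case.
      move=> x Kx; have y0 := hy_gt0 x.
      have [d d0 dO] : exists2 d : R, 0 < d & forall p, `|hx x - hx p| < d -> `|hy x - hy p| < d -> O p.
        by apply: nbhs_boxP; apply: open_nbhs_nbhs; split => //; apply: KO; exists x.
      (* Near [x] heights are at most [2 y], and at most [8 y] after a further step with [r <= 1],
         so a step with [hq <= r] has squared Euclidean length at most [32 r y^2]. This has to stay
         below [(d / 2)^2], whence the 128. *)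
      pose N := Num.truncn (128 * hy x ^+ 2 / d ^+ 2); pose d' := Num.min (d / 2) (hy x / 2).
      exists ([set p | `|hx x - hx p| < d' /\ `|hy x - hy p| < d'], [set n | (N <= n)%N]).
        by split; [apply: nbhs_box; rewrite /d' lt_min !divr_gt0|exists N].
      move=> [p n] [[/= xp yp] Nn] /= q pq.
      move: xp yp; rewrite /d' !lt_min => /andP[xp _] /andP[yp yp'].
      have r0 : 0 < n.+1%:R^-1 :> R by rewrite invr_gt0.
      have r1 : n.+1%:R^-1 <= 1 :> R by rewrite invf_le1// ler1n.
      have rd : n.+1%:R^-1 * (128 * hy x ^+ 2) < d ^+ 2.
        rewrite (mulrC _ (128 * _)) ltr_pdivrMr ?ltr0n// (mulrC _ n.+1%:R) -ltr_pdivrMr ?exprn_gt0//.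
        by apply: lt_le_trans (truncnS_gt _) _; rewrite ler_nat.
      have yq := hq_hy pq; move/hq_leP in pq.
      move: (n.+1%:R^-1) r0 r1 rd yq pq => r r0 r1 rd yq pq.
      have p0 := hy_gt0 p; have q0 := hy_gt0 q.
      have yp2 : hy p <= 2 * hy x by move: yp'; rewrite ltr_norml => /andP[]; lra.
      have bnd : (hx p - hx q) ^+ 2 + (hy p - hy q) ^+ 2 < (d / 2) ^+ 2.
        apply: le_lt_trans pq _.
        apply: (@le_lt_trans _ _ (r * (32 * hy x ^+ 2))); last by rewrite expr_div_n; nra.
        have yq8 : hy q <= 4 * (2 * hy x).
          by apply: le_trans yq _; apply: ler_pM => //; [lra|exact: ltW|lra].
        have pq2 : hy p * hy q <= 2 * hy x * (4 * (2 * hy x)) by apply: ler_pM => //; exact: ltW.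
        have : r * (hy p * hy q) <= r * (2 * hy x * (4 * (2 * hy x))) by rewrite ler_wpM2l// ltW.
        have -> : r * (32 * hy x ^+ 2) = 2 * (r * (2 * hy x * (4 * (2 * hy x)))) by ring.
        have -> : 2 * r * hy p * hy q = 2 * (r * (hy p * hy q)) by ring.
        by move=> h; rewrite ler_pM2l ?ltr0n.
      have sq (t : R) : t ^+ 2 < (d / 2) ^+ 2 -> `|t| < d / 2.
        move=> h; rewrite -(@ltr_pXn2r _ 2%N)// ?nnegrE ?ltW ?divr_gt0// -normrX ger0_norm//.
        exact: sqr_ge0.
      have xq : `|hx p - hx q| < d / 2 by apply: sq; have := sqr_ge0 (hy p - hy q); lra.
      have yq' : `|hy p - hy q| < d / 2 by apply: sq; have := sqr_ge0 (hx p - hx q); lra.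
      by apply: dO; [rewrite -(subrKA (hx p))|rewrite -(subrKA (hy p))];
        apply: le_lt_trans (ler_normD _ _) _; lra.
    by move=> n _ /(_ n) /= h; exists n => p; apply: h => //; rewrite /= leqnn.
  exists (maxn n1 n2) => // f [Sf fid fP] _ [p Kp <-].
  apply: (n2P _ Kp); apply: le_trans (fP p _) _.
    by rewrite (le_trans (n1P _ Kp))// ler_nat leq_maxl.
  by rewrite lef_pV2 ?posrE// ler_nat ltnS leq_maxr.
have [n _ BV] : F V by exact: Fid nV.
have [f fB] := B0 n.
have [Sf fid _] := fB.
have : (V `&` S) f by split=> //; exact: BV.
by rewrite VS.
Qed.

Section FuchsianAction.
Variables (R : realType) (G : groupType).
Local Notation H := (hyperbolic_plane R).
Variable rho : G -> H -> H.
Hypotheses (rho_isom : forall g, hyperbolic_isometry (rho g))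
  (rhoM : forall g h, rho (g * h)%g = rho g \o rho h)
  (rho_inj : injective rho) (rho_discrete : discrete_maps (range rho)).
Implicit Types (g h v : G) (p q z : H) (r : R).

Lemma rhoA g h p : rho (g * h)%g p = rho g (rho h p).
Proof. by rewrite rhoM. Qed.

Lemma rho1 : rho 1%g = id.
Proof.
apply/funext => p; have [[f fK _] _] := rho_isom 1%g.
by apply: (can_inj fK); rewrite -rhoA mulg1.
Qed.

Lemma rhoVK g p : rho g (rho g^-1%g p) = p.
Proof. by rewrite -rhoA mulgV rho1. Qed.

Lemma hq_rho g p q : hq (rho g p) (rho g q) = hq p q.
Proof. by apply: hyperbolic_dist_inj; have [_] := rho_isom g. Qed.

Lemma hq_rhoV g p q : hq (rho g^-1%g p) q = hq p (rho g q).
Proof. by rewrite -(hq_rho g) rhoVK. Qed.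

(** An Arzela-Ascoli argument by pigeonhole: label [g] by the cells that contain the images of a
    finite net of a ball. Two elements with the same label differ by an isometry that is nearly the
    identity on the ball, hence by the identity. *)
Lemma discrete_orbit z r : exists s : seq G, forall g, hq z (rho g z) <= r -> g \in s.
Proof.
have [n nP] := discrete_near_id z rho_discrete (ex_intro2 _ _ 1%g I rho1 : range rho id).
wlog r0 : r / 0 <= r.
  move=> /(_ (Num.max 0 r)); rewrite le_max lexx => /(_ isT)[s sP].
  by exists s => g gr; apply: sP; rewrite le_max gr orbT.
(* Three steps of size [e] compose, by [hq_trans], to less than [100 * e]. *)
pose e := (100 * n.+1%:R)^-1 : R.
have e0 : 0 < e by rewrite invr_gt0 mulr_gt0 ?ltr0n.
have e1 : e <= 100^-1 by rewrite /e invfM ler_piMr// invf_le1// ler1n.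
have en : 100 * e = n.+1%:R^-1 by rewrite /e invfM mulVKf.
have n0 : 0 <= n%:R :> R by [].
have [T [cell cellP]] := hq_bounded_cells z n0 e0.
pose m := 8 * r * n%:R + 4 * r + 4 * n%:R.
have m0 : 0 <= m by rewrite /m !addr_ge0// ?mulr_ge0.
have [T' [cell' cellP']] := hq_bounded_cells z m0 e0.
have /choice[pt ptP] : forall t, exists p, forall q, hq z q <= n%:R -> cell q = t ->
    hq z p <= n%:R /\ cell p = t.
  move=> t; have [[q [qz qt]]|h] := pselect (exists q, hq z q <= n%:R /\ cell q = t).
    by exists q.
  by exists z => q qz qt; case: h; exists q.
apply: (@finite_classes _ _ [set g | hq z (rho g z) <= r]
   (fun g => [ffun t => cell' (rho g (pt t))]) (fun g => [:: g])) => g h /= gr hr gh.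
rewrite mem_seq1 eq_sym; apply/eqP.
suff : rho (h^-1 * g)%g = id.
  by rewrite -rho1 => /rho_inj /(canRL (mulVKg _)); rewrite mulg1.
apply: nP; first by exists (h^-1 * g)%g.
move=> p zp; have [zq cq] := ptP _ _ zp erefl; set q := pt _ in zq cq.
have pq : hq p q <= e by exact: cellP.
have mP k : hq z (rho k z) <= r -> hq z (rho k q) <= m.
  by move=> kr; apply: hq_trans kr _; rewrite hq_rho.
have ghq : hq (rho g q) (rho h q) <= e.
  by apply: cellP'; rewrite ?mP//; have /ffunP/(_ (cell p)) := gh; rewrite !ffunE.
rewrite rhoA hqC hq_rhoV -en.
have gq : hq (rho g p) (rho g q) <= e by rewrite hq_rho.
have hq' : hq (rho h q) (rho h p) <= e by rewrite hq_rho hqC.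
apply: le_trans (hq_trans (hq_trans gq ghq) hq') _.
have ee : e * e <= 100^-1 * e by rewrite ler_pM2r.
have eee : e * e * e <= 100^-1 * e.
  rewrite ler_pM2r//; apply: le_trans ee _; rewrite ler_piMr// ?invr_ge0//.
  by apply: le_trans e1 _; rewrite invf_le1// ler1n.
lra.
Qed.

End FuchsianAction.

(** * Chains of points far from an orbit *)

Section FarChains.
Variables (R : realType) (G : groupType).
Local Notation H := (hyperbolic_plane R).
Variable act : G -> H -> H.
Hypotheses (act1 : act 1%g = id) (actM : forall g h p, act (g * h)%g p = act g (act h p))
  (hq_act : forall g p q, hq (act g p) (act g q) = hq p q)
  (act_fin : forall z r, exists s : seq G, forall g, hq z (act g z) <= r -> g \in s).
Variables (z0 : H) (eps : R).
Hypothesis eps0 : 0 < eps.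
Implicit Types (g h v : G) (p q z : H) (r : R).

Definition near_orbit r p := exists v, hq p (act v z0) <= r.

Inductive far_chain r p : H -> Prop :=
| far_chain_refl : ~ near_orbit r p -> far_chain r p p
| far_chain_step q q' : far_chain r p q -> hq q q' <= eps -> ~ near_orbit r q' -> far_chain r p q'.

Let co r s : R := 8 * r * s + 4 * r + 4 * s.

Lemma far_chain_trans r p q z : far_chain r p q -> far_chain r q z -> far_chain r p z.
Proof. by move=> pq; elim=> // z' z'' _ IH zz; apply: far_chain_step zz. Qed.

Lemma far_chain_far r p q : far_chain r p q -> ~ near_orbit r p /\ ~ near_orbit r q.
Proof. by elim=> // *; tauto. Qed.

Lemma far_chain_sym r p q : far_chain r p q -> far_chain r q p.
Proof.
elim=> [pf|q' q'' pq' IH q'q'' fq'']; first exact: far_chain_refl.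
have [_ fq'] := far_chain_far pq'.
apply: far_chain_trans IH; apply: (far_chain_step (far_chain_refl fq'')) fq'.
by rewrite hqC.
Qed.

Lemma near_orbit_act r g p : near_orbit r (act g p) <-> near_orbit r p.
Proof.
split=> [] [v vP]; last by exists (g * v)%g; rewrite actM hq_act.
by exists (g^-1 * v)%g; rewrite -(hq_act g) -actM mulVKg.
Qed.

Lemma far_chain_act r g p q : far_chain r p q -> far_chain r (act g p) (act g q).
Proof.
elim=> [pf|q' q'' pq' IH q'q'' fq'']; first by apply: far_chain_refl; rewrite near_orbit_act.
by apply: far_chain_step IH _ _; rewrite ?hq_act// near_orbit_act.
Qed.

Lemma hq_segment p q : exists n (f : nat -> H),
  [/\ f 0%N = p, f n = q & forall j, (j < n)%N -> hq (f j) (f j.+1) <= eps].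
Proof.
have p0 := hy_gt0 p; have q0 := hy_gt0 q.
pose m := Num.min (hy p) (hy q); have m0 : 0 < m by rewrite lt_min p0.
pose L := (hx q - hx p) ^+ 2 + (hy q - hy p) ^+ 2.
have L0 : 0 <= L by rewrite addr_ge0 ?sqr_ge0.
pose n := (Num.truncn (L / (eps * m ^+ 2))).+1.
have nL : L <= n%:R * (eps * m ^+ 2).
  by rewrite -ler_pdivrMr ?mulr_gt0 ?exprn_gt0// ltW// truncnS_gt.
pose t (j : nat) : R := j%:R / n%:R.
pose f j := hpoint (hx p + t j * (hx q - hx p)) (hy p + t j * (hy q - hy p)).
have ym j : (j <= n)%N -> m <= hy p + t j * (hy q - hy p).
  move=> jn; have t0 : 0 <= t j by rewrite divr_ge0.
  have t1 : t j <= 1 by rewrite ler_pdivrMr ?mul1r ?ler_nat// ltr0n.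
  have mp : m <= hy p by rewrite ge_min lexx.
  have mq : m <= hy q by rewrite ge_min lexx orbT.
  have -> : hy p + t j * (hy q - hy p) = m + ((1 - t j) * (hy p - m) + t j * (hy q - m)) by ring.
  by rewrite lerDl addr_ge0 ?mulr_ge0 ?subr_ge0.
have fE p1 p2 : hx p1 = hx p2 -> hy p1 = hy p2 -> p1 = p2.
  by rewrite /hx /hy => e1 e2; apply: val_inj; case: (val p1) (val p2) e1 e2 => ? ? [? ?] /= -> ->.
exists n, f; split.
- by apply: fE; rewrite /f ?hx_point ?hy_point /t ?mul0r ?mul0r ?addr0.
- have tn : t n = 1 by rewrite /t divff// pnatr_eq0.
  have -> : f n = hpoint (hx q) (hy q).
    by rewrite /f tn !mul1r (addrC (hx p)) (addrC (hy p)) !subrK.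
  by apply: fE; rewrite ?hx_point ?hy_point.
- move=> j jn; apply/hq_leP.
  have y1 := ym _ (ltnW jn); have y2 := ym _ jn.
  have [z1 z2] : 0 < hy p + t j * (hy q - hy p) /\ 0 < hy p + t j.+1 * (hy q - hy p).
    by split; [apply: lt_le_trans y1|apply: lt_le_trans y2].
  rewrite /f !hx_point// !hy_point//.
  have tS : t j.+1 = t j + n%:R^-1 by rewrite /t -natr1 mulrDl mul1r.
  have n1 : 1 <= n%:R :> R by rewrite ler1n.
  have n0 : 0 < n%:R :> R by rewrite ltr0n.
  have step : L * n%:R^-1 ^+ 2 <= eps * m ^+ 2.
    rewrite exprVn ler_pdivrMr ?exprn_gt0//; apply: le_trans nL _.
    by rewrite mulrC ler_wpM2l// ?expr2 ?ler_peMr ?mulr_ge0// ltW.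
  apply: (@le_trans _ _ (L * n%:R^-1 ^+ 2)); first by rewrite tS /L le_eqVlt; apply/orP; left; apply/eqP; ring.
  apply: le_trans step _; have mm : m ^+ 2 <= (hy p + t j * (hy q - hy p)) * (hy p + t j.+1 * (hy q - hy p)).
    by rewrite expr2 ler_pM// ltW.
  have : eps * m ^+ 2 <= eps * ((hy p + t j * (hy q - hy p)) * (hy p + t j.+1 * (hy q - hy p))).
    by rewrite ler_pM2l.
  set A := hy p + _ in z1 *; set B := hy p + _ in z2 *.
  have : 0 < eps * (A * B) by rewrite !mulr_gt0.
  by rewrite -!mulrA; lra.
Qed.

(** Walk from [p] straight towards [z0] and stop one step before the neighbourhood of the orbit is
    first entered, say near [act v z0]; then translate by [v^-1]. *)
Lemma far_chain_to_annulus r p : 0 <= r -> ~ near_orbit r p ->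
  exists v b, [/\ far_chain r p (act v b), ~ near_orbit r b & hq z0 b <= co eps r].
Proof.
move=> r0 pf; have [n [f [f0 fn fS]]] := hq_segment p z0.
have [j jn [jc [v vP]]] : exists2 j, (j < n)%N & far_chain r p (f j) /\ near_orbit r (f j.+1).
  have exj : exists j, `[< near_orbit r (f j) >].
    by exists n; apply/asboolP; exists 1%g; rewrite fn act1 hqxx.
  case: (ex_minnP exj) => -[|j] /asboolP nj minj; first by case: pf; rewrite -f0.
  have jn : (j < n)%N.
    by apply: minj; apply/asboolP; exists 1%g; rewrite fn act1 hqxx.
  exists j => //; split=> //.
  have : forall k, (k <= j)%N -> far_chain r p (f k).
    elim=> [|k IHk] kj; first by rewrite f0; exact: far_chain_refl.
    apply: far_chain_step (IHk (ltnW kj)) _ _; first by apply: fS; exact: ltn_trans kj jn.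
    by move=> nk; have := minj k.+1; rewrite ltnNge kj => /(_ (introT (asboolP _) nk)).
  exact.
exists v, (act v^-1%g (f j)); rewrite -actM mulgV act1; split=> //.
  by rewrite near_orbit_act; have [] := far_chain_far jc.
by rewrite -(hq_act v) -actM mulgV act1 hqC; apply: hq_trans vP; apply: fS.
Qed.

(* Translating by the group moves any far point to a fixed bounded annulus along a far chain.  That
   annulus consists of finitely many cells of diameter at most [eps], and [r2] bounds those of its
   chain components that are bounded. *)
Lemma far_chain_unbounded r1 : 0 <= r1 -> exists2 r2, 0 <= r2 &
  forall p, ~ near_orbit r2 p -> forall m, exists2 q, far_chain r1 p q & m < hq z0 q.
Proof.
move=> r10; pose a := co eps r1.
have a0 : 0 <= a by rewrite /a /co !addr_ge0 ?mulr_ge0// ltW.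
have [T [cell cellP]] := hq_bounded_cells z0 a0 eps0.
pose annulus b := ~ near_orbit r1 b /\ hq z0 b <= a.
have /choice[bd bdP] : forall t : T, exists d, 0 <= d /\ forall b, annulus b -> cell b = t ->
    (forall m, exists2 q, far_chain r1 b q & m < hq z0 q) \/
    (forall q, far_chain r1 b q -> hq z0 q <= d).
  move=> t; have [[b [[[bf bz] bt] [d bd]]]|h] := pselect (exists b, (annulus b /\ cell b = t) /\
      exists d, forall q, far_chain r1 b q -> hq z0 q <= d).
    exists (Num.max 0 d); split; first by rewrite le_max lexx.
    move=> b' [b'f b'z] b't; right=> q b'q; rewrite le_max; apply/orP; right; apply: bd.
    apply: far_chain_trans b'q; apply: (far_chain_step (far_chain_refl bf)) b'f.
    by apply: cellP => //; rewrite bt.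
  exists 0; split=> // b bA bt; left=> m; apply: contrapT => hm; apply: h; exists b; split=> //.
  exists m => q bq; rewrite leNgt; apply/negP => mq; apply: hm; exists q => //.
pose r2 := r1 + \sum_(t : T) bd t.
have bd0 t : 0 <= bd t by have [] := bdP t.
have bdr2 t : bd t <= r2.
  rewrite /r2 (bigD1 t)//= addrCA lerDl addr_ge0//.
  by apply: sumr_ge0.
have r12 : r1 <= r2 by rewrite lerDl sumr_ge0.
exists r2; first by apply: le_trans r12.
move=> p pf.
have pf1 : ~ near_orbit r1 p by move=> [v vp]; apply: pf; exists v; apply: le_trans r12.
have [v [b [pb bf bz]]] := far_chain_to_annulus r10 pf1.
have [_ /(_ b (conj bf bz) erefl)[ub|bb]] := bdP (cell b); last first.
  case: pf; exists v; rewrite hqC -(hq_act v^-1) -actM mulVg act1.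
  apply: le_trans (bdr2 (cell b)); apply: bb.
  apply: far_chain_sym; have := far_chain_act v^-1 pb.
  by rewrite -actM mulVg act1.
(* The threshold allows for the displacement of [z0] when the chain is translated back by [v]. *)
move=> m; have [q bq mq] := ub (co (hq z0 (act v^-1 z0)) m).
exists (act v q); first exact: far_chain_trans pb (far_chain_act v bq).
rewrite ltNge; apply: contraL mq => vq; rewrite -leNgt; apply: hq_trans (lexx _) _.
by rewrite -(hq_act v) -actM mulgV act1.
Qed.

End FarChains.

(** * The binary tiling in the hyperbolic metric *)

Section Tiling.
Variable R : realType.
Local Notation H := (hyperbolic_plane R).
Implicit Types (p q : H) (a b : int * int) (k l : int).

Let e2 k : R := 2%:R ^ k.

Let e2_gt0 k : 0 < e2 k. Proof. by rewrite exprz_gt0. Qed.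

Let e2S k : e2 (k + 1) = 2 * e2 k.
Proof. by rewrite /e2 expfzDr ?pnatr_eq0// mulrC. Qed.

Let ler_e2 k l : (e2 k <= e2 l) = (k <= l).
Proof. by rewrite /e2 ler_eXz2l// ltr1n. Qed.

Let ltr_e2 k l : (e2 k < e2 l) = (k < l).
Proof. by rewrite !ltNge ler_e2. Qed.

Let exp2_floor (y : R) : 0 < y -> exists k, e2 k <= y < e2 (k + 1).
Proof.
have big (z : R) : 1 <= z -> exists n : nat, e2 n <= z < e2 (n%:Z + 1).
  move=> z1; have z0 : 0 <= z by apply: le_trans z1.
  have /andP[n1 n2] := truncn_itv z0; set m := Num.truncn z in n1 n2.
  have m0 : (0 < m)%N by rewrite lt0n; apply: contraTneq z1 => m0; rewrite m0 in n2; rewrite -ltNge.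
  have /andP[h1 h2] := @trunc_log_bounds 2 m isT m0; exists (trunc_log 2 m).
  rewrite /e2 -(natz (trunc_log 2 m)) natz addrC -PoszD add1n -!exprnP -!natrX.
  rewrite (le_trans _ n1) ?ler_nat//=.
  by apply: lt_le_trans n2 _; rewrite ler_nat.
move=> y0; have [y1|y1] := leP 1 y; first by have [n nP] := big _ y1; exists n.
have [|n /andP[n1 n2]] := big y^-1; first by rewrite invf_ge1// ltW.
have eV k : e2 (- k) = (e2 k)^-1 by rewrite /e2 -invr_expz.
have n1' : y <= e2 (- n%:Z) by rewrite eV -[y]invrK lef_pV2 ?posrE ?invr_gt0.
have n2' : e2 (- n%:Z - 1) < y by rewrite -opprD eV -[y]invrK ltf_pV2 ?posrE ?invr_gt0.
have [ye|ye] := eqVneq y (e2 (- n%:Z)).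
  by exists (- n%:Z); rewrite ye lexx e2S; have := e2_gt0 (- n%:Z); lra.
by exists (- n%:Z - 1); rewrite subrK ltW//= lt_neqAle ye.
Qed.

Definition hlev p : int := xget 0 [set k | e2 k <= hy p < e2 (k + 1)].

Let hlevP p : e2 (hlev p) <= hy p < e2 (hlev p + 1).
Proof.
exact: (xgetPex 0 (exp2_floor (hy_gt0 p))).
Qed.

(** The tile containing [p] is [(hcol p, hlev p)]. The width is that of level [hlev p + 1], since a
    tile spans two edges of its bottom row. *)
Definition hcol p : int := Num.floor (hx p / e2 (hlev p + 1)).

Let floor_mul (x w : R) : 0 < w ->
  (Num.floor (x / w))%:~R * w <= x < (Num.floor (x / w) + 1)%:~R * w.
Proof.
move=> w0; have /andP[h1 h2] := floor_itv (x / w).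
by rewrite -ler_pdivlMr// h1 -ltr_pdivrMr.
Qed.

Let floor_near (x x' w : R) : 0 < w -> `|x - x'| <= w ->
  `|Num.floor (x / w) - Num.floor (x' / w)| <= 1.
Proof.
move=> w0; have /andP[a1 a2] := floor_mul x w0; have /andP[b1 b2] := floor_mul x' w0.
set i := Num.floor _ in a1 a2 *; set j := Num.floor _ in b1 b2 *.
rewrite ler_norml => /andP[c1 c2].
have h (m n : int) : m%:~R * w < n%:~R * w -> m < n by rewrite ltr_pM2r// ltr_int.
have : i < j + 2 by apply: h; rewrite !intrD !mulrDl in a2 b2 *; lra.
have : j < i + 2 by apply: h; rewrite !intrD !mulrDl in a2 b2 *; lra.
lia.
Qed.

Let hlev_eq p k : e2 k <= hy p < e2 (k + 1) -> hlev p = k.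
Proof.
move=> /andP[k1 k2]; have /andP[h1 h2] := hlevP p.
have := lt_le_trans k2 (lexx _); have : hlev p < k + 1 by rewrite -ltr_e2; apply: le_lt_trans k2.
have : k < hlev p + 1 by rewrite -ltr_e2; apply: le_lt_trans h2.
by move=> ? ? _; lia.
Qed.

Definition gpt a : H := hpoint (a.1%:~R * e2 a.2) (e2 a.2).

Lemma hx_gpt a : hx (gpt a) = a.1%:~R * e2 a.2. Proof. exact: hx_point. Qed.
Lemma hy_gpt a : hy (gpt a) = e2 a.2. Proof. exact: hy_point. Qed.

Definition gnode p : int * int := (Num.floor (hx p / e2 (hlev p)), hlev p).

Let hq_le_dist p q (r d e : R) : 0 <= r ->
  `|hx p - hx q| <= d -> `|hy p - hy q| <= e -> d ^+ 2 + e ^+ 2 <= 2 * r * hy p * hy q ->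
  hq p q <= r.
Proof.
move=> r0 xd ye h; apply/hq_leP; apply: le_trans h.
have sq (t u : R) : `|t| <= u -> t ^+ 2 <= u ^+ 2.
  move=> tu; rewrite -[t ^+ 2]ger0_norm ?sqr_ge0// normrX ler_pXn2r// nnegrE.
  exact: le_trans tu.
by rewrite lerD ?sq.
Qed.

Lemma gnode_near p : hq p (gpt (gnode p)) <= 1.
Proof.
have /andP[y1 y2] := hlevP p; have /andP[x1 x2] := floor_mul (hx p) (e2_gt0 (hlev p)).
rewrite e2S in y2; have w0 := e2_gt0 (hlev p).
apply: (@hq_le_dist _ _ _ (e2 (hlev p)) (e2 (hlev p))); rewrite ?hx_gpt ?hy_gpt //=.
- by rewrite intrD mulrDl mul1r in x2; rewrite ler_norml; apply/andP; split; lra.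
- by rewrite ler_norml; apply/andP; split; lra.
- have : e2 (hlev p) * e2 (hlev p) <= hy p * e2 (hlev p) by rewrite ler_pM2r.
  by rewrite expr2 mulr1 -mulrA; lra.
Qed.

Let tile_top p (i : int) : i = hcol p \/ i = hcol p + 1 -> hq p (gpt (i, hlev p + 1)) <= 2.
Proof.
have /andP[y1 y2] := hlevP p; have /andP[x1 x2] := floor_mul (hx p) (e2_gt0 (hlev p + 1)).
have w0 := e2_gt0 (hlev p + 1); have w1 := e2S (hlev p).
rewrite intrD mulrDl mul1r -/(hcol p) in x1 x2.
move=> iE; apply: (@hq_le_dist _ _ _ (e2 (hlev p + 1)) (e2 (hlev p + 1))); rewrite ?hx_gpt ?hy_gpt//=.
- by rewrite ler_norml; case: iE => ->; rewrite ?intrD ?mulrDl ?mul1r; apply/andP; split; lra.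
- by rewrite ler_norml; have := hy_gt0 p; move=> ?; apply/andP; split; lra.
- have : e2 (hlev p + 1) * e2 (hlev p + 1) <= (2 * hy p) * e2 (hlev p + 1) by rewrite ler_pM2r//; lra.
  by rewrite expr2; lra.
Qed.

Lemma gadj_near a b : gadj a b -> hq (gpt a) (gpt b) <= 1.
Proof.
have hN c d : hstep c d -> hq (gpt c) (gpt d) <= 1.
  case: c d => [c1 c2] [d1 d2] /andP[/= /eqP -> /eqP ->].
  have w0 := e2_gt0 c2.
  apply: (@hq_le_dist _ _ _ (e2 c2) 0); rewrite ?hx_gpt ?hy_gpt//=.
  - by rewrite intrD mulrDl mul1r opprD addNKr normrN gtr0_norm.
  - by rewrite subrr normr0.
  - have : 0 < e2 c2 * e2 c2 by rewrite mulr_gt0.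
    by rewrite !expr2; lra.
have vN c d : vstep c d -> hq (gpt c) (gpt d) <= 1.
  case: c d => [c1 c2] [d1 d2] /andP[/= /eqP -> /eqP ->].
  have w0 := e2_gt0 c2.
  apply: (@hq_le_dist _ _ _ 0 (e2 c2)); rewrite ?hx_gpt ?hy_gpt//= e2S.
  - by rewrite intrM (mulrC 2%:~R) -mulrA subrr normr0.
  - by rewrite ler_norml; lra.
  - have : 0 < e2 c2 * e2 c2 by rewrite mulr_gt0.
    by rewrite !expr2; lra.
case/or4P; [exact: hN| |exact: vN|]; rewrite hqC; [exact: hN|exact: vN].
Qed.

Definition tile_nodes (i k : int) : seq (int * int) :=
  [:: (2 * (i + 1), k); (i + 1, k + 1); (2 * i, k); (i, k + 1); (2 * i + 1, k)].

Definition tile_corner (i k : int) : H := gpt (2 * i, k).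

Lemma hlev_tile_corner i k : hlev (tile_corner i k) = k.
Proof. by apply: hlev_eq; rewrite hy_gpt /= lexx ltr_e2 ltrDl. Qed.

Lemma hcol_tile_corner i k : hcol (tile_corner i k) = i.
Proof.
rewrite /hcol hlev_tile_corner hx_gpt /= e2S intrM -mulrA mulrCA mulfK.
  by rewrite intrKfloor.
by rewrite mulf_neq0 ?pnatr_eq0// gt_eqF.
Qed.

Lemma tile_nodes_near i k a : a \in tile_nodes i k -> hq (tile_corner i k) (gpt a) <= 2.
Proof.
have w0 := e2_gt0 k; have ww : 0 < e2 k * e2 k by rewrite mulr_gt0.
have H0 (a1 : int) : a1 = 2 * (i + 1) \/ a1 = 2 * i + 1 \/ a1 = 2 * i ->
    hq (tile_corner i k) (gpt (a1, k)) <= 2.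
  move=> aE; apply: (@hq_le_dist _ _ _ (2 * e2 k) 0); rewrite ?hx_gpt ?hy_gpt//=.
  - by case: aE => [->|[->|->]]; rewrite ?mulrDr ?intrD ?mulrDl ler_norml; lra.
  - by rewrite subrr normr0.
  - by rewrite exprMn !expr2; lra.
have H1 (a1 : int) : a1 = i + 1 \/ a1 = i -> hq (tile_corner i k) (gpt (a1, k + 1)) <= 2.
  move=> aE; apply: (@hq_le_dist _ _ _ (2 * e2 k) (e2 k)); rewrite ?hx_gpt ?hy_gpt//= ?e2S.
  - by case: aE => ->; rewrite ?intrM ?intrD ?mulrDl ler_norml; lra.
  - by rewrite ler_norml; lra.
  - by rewrite exprMn !expr2; lra.
by rewrite !inE => /or4P[/eqP->|/eqP->|/eqP->|/orP[/eqP->|/eqP->]];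
  [apply: H0; left|apply: H1; left|apply: H0; right; right|apply: H1; right|apply: H0; right; left].
Qed.

Definition winding_at x s p := winding x s (hcol p) (hlev p).

(** So small a step changes the level by at most one and, after passing to the common level, the
    column by at most one. Each edge crossed has as an endpoint a top corner of the tile of [p] or
    of [q]. Such a corner is within 2 of that point by [tile_top], so it is not on the loop. *)
Lemma winding_at_step x s p q : path gadj x s -> last x s = x -> hq p q <= 100^-1 ->
  (forall a, a \in x :: s -> 2 < hq p (gpt a) /\ 2 < hq q (gpt a)) ->
  winding_at x s p = winding_at x s q.
Proof.
move=> xs sx; wlog pq : p q / hy p <= hy q.
  move=> W; have [|/ltW qp] := leP (hy p) (hy q); first exact: W.
  by rewrite hqC => h sf; apply/esym/W => // a /sf[].
move=> /hq_leP h far; have p0 := hy_gt0 p; have q0 := hy_gt0 q.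
have farp a : a \in x :: s -> ~ hq p (gpt a) <= 2 by move=> /far[+ _]; rewrite ltNge => /negP.
have farq a : a \in x :: s -> ~ hq q (gpt a) <= 2 by move=> /far[_]; rewrite ltNge => /negP.
have qp : hy q < 3 / 2 * hy p.
  rewrite ltNge; apply/negP => qp.
  have : 0 <= (hx p - hx q) ^+ 2 by exact: sqr_ge0.
  nra.
have xx : `|hx p - hx q| <= hy q / 4.
  have q4 : 0 <= hy q / 4 by rewrite divr_ge0 ?ltW.
  rewrite -(@ler_pXn2r _ 2%N) ?nnegrE// -normrX ger0_norm ?sqr_ge0//.
  have : 0 <= (hy p - hy q) ^+ 2 by exact: sqr_ge0.
  rewrite !expr2 in h *; have : hy p * hy q <= hy q * hy q by rewrite ler_pM2r.
  nra.
have /andP[p1 p2] := hlevP p; have /andP[q1 q2] := hlevP q.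
have kk : hlev p <= hlev q.
  by rewrite -ltzD1 -ltr_e2; apply: le_lt_trans q2; apply: le_trans pq.
have kk' : hlev q <= hlev p + 1.
  rewrite -ltzD1 -ltr_e2; apply: le_lt_trans q1 _; apply: lt_trans qp _.
  by rewrite [e2 (_ + 1)]e2S; lra.
have left k i : winding x s i k = winding x s (i + 1) k \/ (i + 1, k + 1) \in x :: s.
  have [|h'] := boolP ((i + 1, k + 1) \in x :: s); [by right|left].
  by rewrite -(winding_left_eq xs h') addrK.
rewrite /winding_at; have [kE|kN] := eqVneq (hlev q) (hlev p).
  have : `|hcol p - hcol q| <= 1.
    rewrite /hcol kE; apply: floor_near => //; apply: le_trans xx _.
    by rewrite -kE; lra.
  move=> ij; have [e|[e|e]] : hcol p = hcol q \/ hcol q = hcol p + 1 \/ hcol p = hcol q + 1.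
    by move: ij; clear; lia.
  - by rewrite e kE.
  - have [|/farp[]] := left (hlev p) (hcol p); first by rewrite e kE.
    by apply: tile_top; right.
  - have [|/farq[]] := left (hlev q) (hcol q); first by rewrite e kE.
    by apply: tile_top; right.
have {kN kk kk'} kE : hlev q = hlev p + 1 by move/eqP: kN kk kk'; clear; lia.
have /(winding_up_eq xs sx) <- : (hcol p, hlev p + 1) \notin x :: s.
  by apply/negP => /farp[]; apply: tile_top; left.
rewrite -kE.
have iE : (hcol p %/ 2)%Z = Num.floor (hx p / e2 (hlev q + 1)).
  apply/esym/floor_def; have /andP[x1 x2] := floor_mul (hx p) (e2_gt0 (hlev p + 1)).
  rewrite -/(hcol p) in x1 x2; have w0 := e2_gt0 (hlev q + 1).
  rewrite ler_pdivlMr// ltr_pdivrMr// [e2 (hlev q + 1)]e2S kE !mulrA.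
  set w := e2 (hlev p + 1) in x1 x2 *; have w1 : 0 < w by exact: e2_gt0.
  have d1 : (hcol p %/ 2)%Z * 2 <= hcol p by clear; lia.
  have d2 : hcol p + 1 <= ((hcol p %/ 2)%Z + 1) * 2 by clear; lia.
  rewrite -(ler_int R) intrM in d1; rewrite -(ler_int R) intrM in d2.
  apply/andP; split; first by apply: le_trans x1; rewrite ler_pM2r.
  by apply: lt_le_trans x2 _; rewrite ler_pM2r.
have : `|(hcol p %/ 2)%Z - hcol q| <= 1.
  rewrite iE /hcol; apply: floor_near => //; apply: le_trans xx _.
  by lra.
move=> ij; have [e|[e|e]] : (hcol p %/ 2)%Z = hcol q \/ hcol q = (hcol p %/ 2)%Z + 1 \/ (hcol p %/ 2)%Z = hcol q + 1.
  by move: ij; clear; lia.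
- by rewrite e.
- have [|] := left (hlev q) (hcol p %/ 2)%Z; first by rewrite e.
  by rewrite -e => /farq[]; apply: tile_top; left.
- have [|/farq[]] := left (hlev q) (hcol q); first by rewrite e.
  by apply: tile_top; right.
Qed.

Lemma winding_at_supp x s z : path gadj x s -> last x s = x ->
  exists m : R, forall p, winding_at x s p != 0 -> hq z p <= m.
Proof.
move=> xs sx; have [N NP] := winding_supp xs sx.
pose w := e2 (N%:Z + 1); have w0 : 0 < w by exact: e2_gt0.
pose v := e2 (- N%:Z); have v0 : 0 < v by exact: e2_gt0.
pose B := `|hx z| + N.+1%:R * w; pose D := hy z + w.
have z0 := hy_gt0 z.
have B0 : 0 <= B by rewrite addr_ge0// mulr_ge0// ltW.
pose m := (B ^+ 2 + D ^+ 2) / (2 * hy z * v).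
have m0 : 0 <= m by rewrite divr_ge0 ?addr_ge0 ?sqr_ge0// !mulr_ge0// ltW.
exists m => p /NP /andP[/andP[i1 i2] /andP[k1 k2]].
have /andP[y1 y2] := hlevP p; have /andP[x1 x2] := floor_mul (hx p) (e2_gt0 (hlev p + 1)).
rewrite -/(hcol p) in x1 x2.
have ew : e2 (hlev p + 1) <= w by rewrite ler_e2; move: k2; clear; lia.
have yv : v <= hy p by apply: le_trans y1; rewrite ler_e2; move: k1; clear; lia.
have xB : `|hx p| <= N.+1%:R * w.
  have e0 := e2_gt0 (hlev p + 1).
  have b1 : (hcol p + 1)%:~R * e2 (hlev p + 1) <= N.+1%:R * w.
    apply: (@le_trans _ _ (N.+1%:R * e2 (hlev p + 1))); last by rewrite ler_pM2l ?ltr0n.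
    have NE : N.+1%:R = (N.+1%:Z)%:~R :> R by [].
    by rewrite NE ler_pM2r// ler_int; move: i2; clear; lia.
  have b2 : - (N.+1%:R * w) <= (hcol p)%:~R * e2 (hlev p + 1).
    apply: (@le_trans _ _ (- (N.+1%:R * e2 (hlev p + 1)))); first by rewrite lerN2 ler_pM2l ?ltr0n.
    have NE : - N.+1%:R = (- N.+1%:Z)%:~R :> R by rewrite mulrNz.
    by rewrite -mulNr NE ler_pM2r// ler_int; move: i1; clear; lia.
  rewrite ler_norml; apply/andP; split; lra.
apply: (@hq_le_dist _ _ _ B D) => //.
- by apply: le_trans (ler_normB _ _) _; rewrite /B lerD2l.
- rewrite /D ler_norml; have := lt_le_trans y2 ew; have := hy_gt0 p; move=> *; apply/andP; split; lra.
- have -> : 2 * m * hy z * hy p = m * (2 * hy z * hy p) by ring.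
  rewrite {1}(_ : B ^+ 2 + D ^+ 2 = m * (2 * hy z * v)); last first.
    by rewrite /m divfK// !mulf_neq0 ?pnatr_eq0// gt_eqF.
  by rewrite ler_wpM2l// ler_wpM2l// mulr_ge0// ltW.
Qed.

Definition greach (L : nat) a b := exists t, [/\ path gadj a t, last a t = b & (size t <= L)%N].

Lemma greach_trans L M a b c : greach L a b -> greach M b c -> greach (L + M) a c.
Proof.
move=> [t [at_ tb tL]] [u [bu uc uM]]; exists (t ++ u).
by rewrite cat_path last_cat tb at_ bu size_cat leq_add.
Qed.

Lemma greachW L M a b : (L <= M)%N -> greach L a b -> greach M a b.
Proof. by move=> LM [t [at_ tb tL]]; exists t; split=> //; apply: leq_trans LM. Qed.

Lemma gadj_sym a b : gadj a b = gadj b a.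
Proof. by rewrite /gadj orbCA; congr (_ || (_ || _)); rewrite orbC. Qed.

Lemma greach_sym L a b : greach L a b -> greach L b a.
Proof.
move=> [t [at_ tb tL]]; apply: greachW tL _; elim: t a at_ tb => [|c t IH] a /=.
  by move=> _ ->; exists [::].
move=> /andP[ac ct] tb; rewrite -addn1; apply: greach_trans (IH _ ct tb) _.
by exists [:: a]; rewrite /= gadj_sym ac.
Qed.

Let greach_hor n i k : greach n (i, k) (i + n%:Z, k).
Proof.
elim: n => [|n IH]; first by exists [::]; rewrite addr0.
rewrite -addn1; apply: greach_trans IH _; exists [:: (i + n.+1%:Z, k)].
split=> //=; last by rewrite addn1.
by rewrite andbT; apply/orP; left; rewrite /hstep /= eqxx andbT; clear; lia.
Qed.

(** Each ascent rounds the abscissa by at most one edge of the current level. As the edges double in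
    length, the errors form a geometric series bounded by one edge of the top level. *)
Let greach_up (m : nat) a : exists b, [/\ greach (2 * m) a b, b.2 = a.2 + m%:Z &
  `|b.1%:~R * e2 b.2 - a.1%:~R * e2 a.2| <= e2 b.2].
Proof.
elim: m => [|m [[b1 b2] [ab /= b2E bx]]].
  by exists a; split; [exists [::]|rewrite addr0|rewrite subrr normr0 ltW].
exists ((b1 %/ 2)%Z, b2 + 1); split => /=; first last.
- rewrite e2S mulrA; have d1 : (b1 %/ 2)%Z * 2 <= b1 by clear; lia.
  have d2 : b1 - 1 <= (b1 %/ 2)%Z * 2 by clear; lia.
  rewrite -(ler_int R) intrM -(ler_pM2r (e2_gt0 b2)) in d1.
  rewrite -(ler_int R) intrM -(ler_pM2r (e2_gt0 b2)) intrB mulrBl mul1r in d2.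
  by move: bx; rewrite !ler_norml => /andP[h1 h2]; apply/andP; split; lra.
- by rewrite b2E; clear; lia.
rewrite mulnS addnC; apply: greach_trans ab _.
have vP : gadj (2 * (b1 %/ 2)%Z, b2) ((b1 %/ 2)%Z, b2 + 1).
  by rewrite /gadj /vstep /= !eqxx !orbT.
have [bE|bN] := eqVneq b1 (2 * (b1 %/ 2)%Z).
  by exists [:: ((b1 %/ 2)%Z, b2 + 1)]; rewrite /= andbT {1}bE.
exists [:: (2 * (b1 %/ 2)%Z, b2); ((b1 %/ 2)%Z, b2 + 1)]; rewrite /= vP !andbT; split=> //.
by rewrite /gadj /hstep /= eqxx !andbT (_ : b1 == _ + 1) ?orbT//; move/eqP: bN; clear; lia.
Qed.

(** Climb from the lower node to the level of the other one, then walk horizontally; [hq <= r]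
    bounds both the difference of levels and the horizontal distance at the upper level. *)
Lemma greach_near r : 0 <= r -> exists L, forall a b, hq (gpt a) (gpt b) <= r -> greach L a b.
Proof.
move=> r0; pose l := Num.truncn (2 * r + 2); pose n := Num.truncn (2 * r + 2).
have l1 : 2 * r + 2 <= e2 l.+1%:Z.
  apply: le_trans (ltW (truncnS_gt _)) _; rewrite /e2 -exprnP -natrX ler_nat -/l.
  by apply: ltnW; exact: ltn_expl.
exists (2 * l.+1 + n.+1)%N => a b; wlog ab : a b / a.2 <= b.2.
  move=> W; have [|/ltW ba] := leP a.2 b.2; first exact: W.
  by rewrite hqC => /(W _ _ ba)/greach_sym.
move=> h; have w0 := e2_gt0 b.2; have w1 := e2_gt0 a.2.
have ba : b.2 <= a.2 + l.+1%:Z.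
  rewrite -ler_e2 {2}/e2 expfzDr ?pnatr_eq0// -/(e2 a.2) -/(e2 l.+1).
  have := hq_hy h; rewrite !hy_gpt => /le_trans; apply.
  by rewrite mulrC ler_pM2l.
have [[c1 c2] [ac /= cE cx]] := greach_up (absz (b.2 - a.2)) a.
have {}cE : c2 = b.2 by rewrite cE; move: ab; clear; lia.
rewrite {}cE in ac cx.
have xx : `|a.1%:~R * e2 a.2 - b.1%:~R * e2 b.2| <= (2 * r + 1) * e2 b.2.
  rewrite -(@ler_pXn2r _ 2%N) ?nnegrE ?mulr_ge0//; [|lra|exact: ltW].
  rewrite -normrX ger0_norm ?sqr_ge0//; move/hq_leP: h; rewrite !hx_gpt !hy_gpt.
  have : e2 a.2 * e2 b.2 <= e2 b.2 * e2 b.2 by rewrite ler_pM2r ?ler_e2.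
  set X := _ ^+ 2; set Y := _ ^+ 2; have : 0 <= Y by exact: sqr_ge0.
  set u := e2 a.2 in w1 *; set v := e2 b.2 in w0 *; move=> Y0 uv.
  have : r * (u * v) <= r * (v * v) by rewrite ler_wpM2l.
  have : 0 <= r * r * (v * v) by rewrite !mulr_ge0// ltW.
  have : 0 <= r * (v * v) by rewrite !mulr_ge0// ltW.
  have : 0 <= v * v by rewrite !mulr_ge0// ltW.
  by rewrite exprMn !expr2; lra.
have cb : `|c1 - b.1| <= n.+1%:Z.
  rewrite -(ler_int R) -(ler_pM2r w0) intr_norm.
  have -> : `|(c1 - b.1)%:~R| * e2 b.2 = `|(c1%:~R * e2 b.2 - a.1%:~R * e2 a.2) + (a.1%:~R * e2 a.2 - b.1%:~R * e2 b.2)| :> R.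
    by rewrite subrKA -[X in _ * X](gtr0_norm w0) -normrM intrB mulrBl.
  apply: le_trans (ler_normD _ _) _; apply: le_trans (lerD cx xx) _.
  have : (2 * r + 2) * e2 b.2 <= n.+1%:R * e2 b.2 by rewrite ler_pM2r// ltW// truncnS_gt.
  by rewrite -[n.+1%:~R]/(n.+1%:R); lra.
apply: greach_trans (greachW _ ac) _; first by move: ab ba; clear; lia.
have hor (m1 m2 : int) k : m1 <= m2 -> m2 - m1 <= n.+1%:Z -> greach n.+1 (m1, k) (m2, k).
  move=> m12 mn; apply: (@greachW (absz (m2 - m1))); first by move: m12 mn; clear; lia.
  by have := greach_hor (absz (m2 - m1)) m1 k; rewrite (_ : m1 + _ = m2)//; move: m12; clear; lia.
rewrite [b]surjective_pairing /=; have [m12|m21] := leP c1 b.1; first by apply: hor => //; move: m12 cb; clear; lia.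
by apply: greach_sym; apply: hor; move: m21 cb; clear; lia.
Qed.

End Tiling.

(** * The linear filling inequality *)

Lemma path_sum_map (T U : Type) (V : zmodType) (f : T -> U) (c : U -> U -> V) x s :
  path_sum c (f x) (map f s) = path_sum (fun a b => c (f a) (f b)) x s.
Proof. by elim: s x => [|y s IH] x //=; rewrite IH. Qed.

(** Coning the path off at [g]: each edge spans with [g] one triangle, of defect at most 1. *)
Lemma path_sum_cone (T : eqType) (F : numDomainType) (c : T -> T -> F) (g x : T) s :
  (forall a b, a \in x :: s -> b \in x :: s -> `|c g a + c a b - c g b| <= 1) ->
  `|path_sum c x s - (c g (last x s) - c g x)| <= (size s)%:R.
Proof.
elim: s x => [|y s IH] x cP /=; first by rewrite subrr subr0 normr0.
have -> : c x y + path_sum c y s - (c g (last y s) - c g x) =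
   (c g x + c x y - c g y) + (path_sum c y s - (c g (last y s) - c g y)) by ring.
rewrite -nat1r; apply: le_trans (ler_normD _ _) _; apply: lerD.
  by apply: cP; rewrite !inE eqxx ?orbT.
by apply: IH => a b aS bS; apply: cP; rewrite inE ?aS ?bS orbT.
Qed.

Section OrbitFilling.
Variables (R : realType) (G : groupType).
Local Notation H := (hyperbolic_plane R).
Variable act : G -> H -> H.
Hypotheses (act1 : act 1%g = id) (actM : forall g h p, act (g * h)%g p = act g (act h p))
  (hq_act : forall g p q, hq (act g p) (act g q) = hq p q)
  (act_fin : forall z r, exists s : seq G, forall g, hq z (act g z) <= r -> g \in s).

Let co (r s : R) := 8 * r * s + 4 * r + 4 * s.

Let co_ge0 r s : 0 <= r -> 0 <= s -> 0 <= co r s.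
Proof. by move=> r0 s0; rewrite /co !addr_ge0 ?mulr_ge0. Qed.

Let itc (n : nat) : R := iter n (co 1) 0.

Let itc_ge0 n : 0 <= itc n.
Proof. by elim: n => //= n IH; exact: co_ge0. Qed.

Let itcS n : itc n <= itc n.+1.
Proof. by have := itc_ge0 n; rewrite /itc /= /co; lra. Qed.

Let itc_mono n m : (n <= m)%N -> itc n <= itc m.
Proof.
elim: m => [|m IH]; first by rewrite leqn0 => /eqP->.
by rewrite leq_eqVlt => /orP[/eqP->//|/IH h]; apply: le_trans h _.
Qed.

Let gpath_near a t b : path gadj a t -> b \in a :: t -> hq (gpt R a) (gpt R b) <= itc (size t).
Proof.
elim: t a => [|c t IH] a /=.
  by move=> _; rewrite inE => /eqP->; rewrite hqxx.
move=> /andP[ac ct]; rewrite inE => /orP[/eqP->|bt].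
  by rewrite hqxx (itc_ge0 (size t).+1).
by apply: hq_trans (gadj_near _ ac) _; exact: IH.
Qed.

Let z0 : H := hpoint 0 1.
Let node g := gnode (act g z0).

(* The loop of orbit points is replaced by a loop of nodes, and [c] by its values at orbit points near
   the nodes.  By Stokes the sum is a combination of boundary integrals of tiles, with coefficients of
   total size at most linear in the length.  A tile far from the orbit is joined to infinity by tiles
   that the loop does not meet, so that its coefficient vanishes; the others are triangulated by orbit
   points in a bounded number of steps. *)
Lemma orbit_filling (S : seq G) : exists (T : seq G) (C : R), 0 <= C /\
  forall c : G -> G -> R,
    (forall g h k, (g^-1 * h)%g \in T -> (h^-1 * k)%g \in T -> (g^-1 * k)%g \in T ->
       `|c g h + c h k - c g k| <= 1) ->
  forall x s, path (fun g h => (g^-1 * h)%g \in S) x s -> last x s = x ->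
    `|path_sum c x s| <= C * (size s)%:R.
Proof.
have [rS rS0 rSP] : exists2 rS, 0 <= rS & forall s, s \in S -> hq z0 (act s z0) <= rS.
  elim: S => [|s S [r r0 rP]]; first by exists 0.
  exists (r + hq z0 (act s z0)); first by rewrite addr_ge0 ?hq_ge0.
  move=> s'; rewrite inE => /orP[/eqP->|/rP h]; first by rewrite lerDr.
  by apply: le_trans h _; rewrite lerDl hq_ge0.
have stepS g h : (g^-1 * h)%g \in S -> hq (act g z0) (act h z0) <= rS.
  by move=> /rSP; rewrite -(hq_act g) -actM mulVKg.
(* The radii: [ra] bounds the distance of the nodes of two orbit points that differ by a step in
   [S]; the loop of nodes stays within [r2] of the orbit; a point outside [r3] is not within 2 of
   the loop; beyond [r4] chains that avoid [r3] escape to infinity; nodes of the loop, and of tiles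
   whose corner is within [r4], are within [r5] of the orbit; [r6] bounds the distances of the orbit
   points assigned to the nodes of one such tile, and [D0] the radius of the cones. *)
pose ra := co (co 1 rS) 1.
have ra0 : 0 <= ra by rewrite !co_ge0.
have node_near g : hq (act g z0) (gpt R (node g)) <= 1 by exact: gnode_near.
have [L LP] := greach_near ra0.
have node_step g h : (g^-1 * h)%g \in S -> greach L (node g) (node h).
  move=> /stepS gh; apply: LP.
  by apply: hq_trans (hq_trans _ gh) (node_near h); rewrite hqC.
pose r2 := co (itc L) 1; have r20 : 0 <= r2 by rewrite co_ge0.
pose r3 := co 2 r2; have r30 : 0 <= r3 by rewrite co_ge0.
have e0 : 0 < 100^-1 :> R by rewrite invr_gt0 ltr0n.
have [r4 r40 r4P] := far_chain_unbounded act1 actM hq_act z0 e0 r30.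
pose r5 := r2 + co 2 r4; have r50 : 0 <= r5 by rewrite addr_ge0// co_ge0.
have r25 : r2 <= r5 by rewrite lerDl co_ge0.
have r45 : co 2 r4 <= r5 by rewrite lerDr.
have /choice[nu nuP] : forall a, exists v, near_orbit act z0 r5 (gpt R a) -> hq (gpt R a) (act v z0) <= r5.
  move=> a; have [[v vP]|h] := pselect (near_orbit act z0 r5 (gpt R a)); first by exists v.
  by exists 1%g => /h.
pose D0 := co r2 r5 + rS; have D00 : 0 <= D0 by rewrite addr_ge0// co_ge0.
pose r6 := co (co (co r5 2) 2) r5; have r60 : 0 <= r6 by rewrite !co_ge0.
pose rT := co D0 D0 + r6.
have [T TP] := act_fin z0 rT.
have close g h r : r <= rT -> hq (act g z0) (act h z0) <= r -> (g^-1 * h)%g \in T.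
  by move=> rr gh; apply: TP; rewrite -(hq_act g) -actM mulVKg; apply: le_trans rr.
have D0T : co D0 D0 <= rT by rewrite lerDl.
have r6T : r6 <= rT by rewrite lerDr co_ge0.
(* Per step of the loop: 1 for making the cochain antisymmetric, [L.+1] for triangles between the
   step and its path of at most [L] nodes, and 3 triangles per tile times at most [L] edges of the
   node loop. *)
exists T, (1 + (L.+1%:R + 3 * L%:R)); split; first by rewrite !addr_ge0 ?mulr_ge0.
move=> c0 c0P x s xs sx.
(* Stokes needs an antisymmetric cochain. Degenerate triangles show that [c0] is antisymmetric up to
   a bounded error, so this average stays within 1 of it. *)
pose c g h := (c0 g h - c0 h g) / 2.
have cN g h : c g h = - c h g by rewrite /c; lra.
have cP r g h k : r <= rT -> hq (act g z0) (act h z0) <= r -> hq (act h z0) (act k z0) <= r ->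
    hq (act g z0) (act k z0) <= r -> `|c g h + c h k - c g k| <= 1.
  move=> rr gh hk gk; have gh' := gh; have hk' := hk; have gk' := gk.
  rewrite hqC in gh'; rewrite hqC in hk'; rewrite hqC in gk'.
  have := c0P g h k (close _ _ _ rr gh) (close _ _ _ rr hk) (close _ _ _ rr gk).
  have := c0P k h g (close _ _ _ rr hk') (close _ _ _ rr gh') (close _ _ _ rr gk').
  by rewrite /c !ler_norml => /andP[? ?] /andP[? ?]; apply/andP; split; lra.
have c0c g h : (g^-1 * h)%g \in S -> `|c0 g h - c g h| <= 1.
  move=> /stepS gh; have gh' := gh; rewrite hqC in gh'.
  have rSD : rS <= co D0 D0.
    by apply: (@le_trans _ _ D0); [rewrite lerDr co_ge0|rewrite /co; have := mulr_ge0 D00 D00; lra].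
  have rr : rS <= rT by apply: le_trans D0T.
  have gg : hq (act g z0) (act g z0) <= rS by rewrite hqxx.
  have := c0P g h g (close _ _ _ rr gh) (close _ _ _ rr gh') (close _ _ _ rr gg).
  have := c0P g g g (close _ _ _ rr gg) (close _ _ _ rr gg) (close _ _ _ rr gg).
  by rewrite /c !ler_norml => /andP[? ?] /andP[? ?]; apply/andP; split; lra.
pose cg a b := c (nu a) (nu b).
have [t [xt tl tL tnear tsum]] : exists t, [/\ path gadj (node x) t, last (node x) t = node (last x s),
    (size t <= L * size s)%N,
    forall a, a \in node x :: t -> near_orbit act z0 r2 (gpt R a) &
    `|path_sum c x s - (c x (nu (node x)) + path_sum cg (node x) t - c (last x s) (nu (node (last x s))))|
      <= L.+1%:R * (size s)%:R].
  have nodeN g : near_orbit act z0 r2 (gpt R (node g)).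
    by exists g; rewrite hqC; apply: le_trans (node_near g) _; rewrite /r2 /co; have := itc_ge0 L; lra.
  elim: s x xs {sx} => [|y s IH] x /=.
    move=> _; exists [::]; split; rewrite ?muln0 ?mulr0 //=.
      by move=> a; rewrite inE => /eqP->.
    by rewrite addr0 subrr subr0 normr0.
  move=> /andP[xy ys]; have [t [yt tl tL tn ts]] := IH _ ys.
  have [u [xu ul uL]] := node_step _ _ xy.
  have un a : a \in node x :: u -> hq (gpt R a) (act x z0) <= r2.
    move=> au; apply: hq_trans; last by rewrite hqC; exact: node_near.
    by rewrite hqC; apply: le_trans (gpath_near xu au) _; exact: itc_mono.
  exists (u ++ t); split.
  - by rewrite cat_path xu ul.
  - by rewrite last_cat ul.
  - by rewrite size_cat mulnS leq_add.
  - move=> a; rewrite -cat_cons mem_cat => /orP[/un h|at_]; first by exists x.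
    by apply: tn; rewrite inE at_ orbT.
  have xnu a : a \in node x :: u -> hq (act x z0) (act (nu a) z0) <= co r2 r5.
    move=> /un ax; apply: hq_trans; first by rewrite hqC; exact: ax.
    by apply: nuP; exists x; apply: le_trans r25.
  have coD : co r2 r5 <= D0 by rewrite lerDl.
  have DD : D0 <= co D0 D0 by rewrite /co; have := mulr_ge0 D00 D00; lra.
  have tri g h : hq (act x z0) (act g z0) <= D0 -> hq (act x z0) (act h z0) <= D0 ->
      `|c x g + c g h - c x h| <= 1.
    move=> xg xh; apply: (cP (co D0 D0)) => //; [exact: le_trans DD|  |exact: le_trans DD].
    by apply: hq_trans xh; rewrite hqC.
  have := @path_sum_cone _ _ c x (nu (node x)) (map nu u).
  rewrite path_sum_map last_map ul size_map => cone.
  have {}cone := cone _; have {cone} : `|path_sum cg (node x) u - (c x (nu (node y)) - c x (nu (node x)))| <= (size u)%:R.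
    apply: cone => a b; rewrite -map_cons => /mapP[a' au ->] /mapP[b' bu ->].
    by apply: tri; apply: le_trans coD; exact: xnu.
  have : `|c x y + c y (nu (node y)) - c x (nu (node y))| <= 1.
    apply: tri; first by apply: le_trans (stepS _ _ xy) _; rewrite lerDr co_ge0.
    by apply: le_trans coD; apply: xnu; rewrite -ul mem_last.
  have : (size u)%:R <= L%:R :> R by rewrite ler_nat.
  move: ts; rewrite path_sum_cat ul -[(size s).+1%:R]nat1r mulrDr mulr1 -[L.+1%:R]nat1r.
  set e := (1 + L%:R) * _; set X := path_sum c y s; set Y := path_sum cg _ t; set Z := path_sum cg _ u.
  set A := c x _; set B := c y _; set D := c (last y s) _; set E := c x _; set K := c x _.
  by rewrite !ler_norml => /andP[? ?] ? /andP[? ?] /andP[? ?]; apply/andP; split; lra.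
rewrite sx in tl tsum.
have cgN a b : cg a b = - cg b a by exact: cN.
have tile3 i k : winding (node x) t i k != 0 -> `|tile cg i k| <= 3.
  move=> wN; pose p := tile_corner R i k.
  have pn : near_orbit act z0 r4 p.
    apply: contrapT => pf.
    have [m mP] := winding_at_supp z0 xt tl.
    have [q pq mq] := r4P _ pf m.
    have : winding_at (node x) t p = winding_at (node x) t q.
      elim: pq => // q1 q2 pq1 -> q12 q2f; have [_ q1f] := far_chain_far pq1.
      apply: winding_at_step => // a /tnear [v vP].
      by split; rewrite ltNge; apply/negP => h; [apply: q1f|apply: q2f]; exists v; apply: hq_trans vP.
    rewrite {1}/winding_at hcol_tile_corner hlev_tile_corner => wE.
    by move: mq; rewrite ltNge mP// -wE.
  have nnu a : a \in tile_nodes i k -> hq (gpt R a) (act (nu a) z0) <= r5.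
    move=> /(tile_nodes_near R) pa; apply: nuP; have [v vP] := pn; exists v.
    by apply: le_trans r45; apply: hq_trans vP; rewrite hqC.
  have cl a b : a \in tile_nodes i k -> b \in tile_nodes i k -> hq (act (nu a) z0) (act (nu b) z0) <= r6.
    move=> aT bT; apply: hq_trans (nnu _ bT); apply: hq_trans (tile_nodes_near R bT).
    by apply: hq_trans; rewrite hqC; [exact: nnu|exact: (tile_nodes_near R)].
  have tri a b d : a \in tile_nodes i k -> b \in tile_nodes i k -> d \in tile_nodes i k ->
      `|cg a b + cg b d - cg a d| <= 1.
    by move=> aT bT dT; apply: (cP r6) => //; exact: cl.
  (* A tile is a pentagon, cut into three triangles with apex [a0]. *)
  rewrite /tile; set a0 := (2 * i, k); set a1 := (2 * i + 1, k); set a2 := (2 * (i + 1), k).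
  set a3 := (i + 1, k + 1); set a4 := (i, k + 1).
  have -> : (2 * i + 1 + 1, k) = a2 by rewrite /a2; congr (_, _); ring.
  have t1 : `|cg a0 a1 + cg a1 a2 - cg a0 a2| <= 1 by apply: tri; rewrite !inE eqxx ?orbT.
  have t2 : `|cg a0 a2 + cg a2 a3 - cg a0 a3| <= 1 by apply: tri; rewrite !inE eqxx ?orbT.
  have t3 : `|cg a0 a3 + cg a3 a4 - cg a0 a4| <= 1 by apply: tri; rewrite !inE eqxx ?orbT.
  move: t1 t2 t3; rewrite (cgN a3 a4) !ler_norml => /andP[? ?] /andP[? ?] /andP[? ?].
  by apply/andP; split; lra.
have := path_sum_tile_le xt tl cgN tile3 (ler0n _ 3).
have : `|path_sum c0 x s - path_sum c x s| <= 1 * (size s)%:R.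
  rewrite -path_sumB; exact: (ler_norm_path_sum xs).
have : 3 * (size t)%:R <= 3 * (L%:R * (size s)%:R) :> R by rewrite ler_pM2l ?ltr0n// -natrM ler_nat.
move: tsum; rewrite (addrC (c x _)) addrK !ler_norml => /andP[? ?] ? /andP[? ?] /andP[? ?].
by apply/andP; split; lra.
Qed.

End OrbitFilling.

Lemma fuchsian_filling (R : realType) (G : groupType) (S : seq G) : fuchsian R G ->
  exists (T : seq G) (C : R), 0 <= C /\
  forall c : G -> G -> R,
    (forall g h k, (g^-1 * h)%g \in T -> (h^-1 * k)%g \in T -> (g^-1 * k)%g \in T ->
       `|c g h + c h k - c g k| <= 1) ->
  forall x s, path (fun g h => (g^-1 * h)%g \in S) x s -> last x s = x ->
    `|path_sum c x s| <= C * (size s)%:R.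
Proof.
move=> [_ [rho [rho_isom rhoM rho_inj rho_discrete]]].
apply: (@orbit_filling R G rho).
- exact: rho1.
- exact: rhoA.
- exact: hq_rho.
- exact: discrete_orbit.
Qed.
(** * Invariant cones in a finitely generated abelian group *)

Section FiniteRank.
Variables (A : zmodType) (s : nat -> A).

Let span (m : nat) (a : A) := exists c : nat -> int, a = \sum_(j < m) s j *~ c j.

Let span0 m : span m 0.
Proof. by exists (fun=> 0); rewrite big1. Qed.

Let spanD m a b : span m a -> span m b -> span m (a + b).
Proof.
move=> [c ->] [d ->]; exists (fun j => c j + d j).
by rewrite -big_split; apply: eq_bigr => j _; rewrite mulrzDr.
Qed.

Let spanN m a : span m a -> span m (- a).
Proof.
move=> [c ->]; exists (fun j => - c j).
by rewrite -sumrN; apply: eq_bigr => j _; rewrite mulrNz.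
Qed.

Let spanMn m a n : span m a -> span m (a *+ n).
Proof. by move=> am; elim: n => [|n IH]; rewrite ?mulr0n ?mulrS; [exact: span0|exact: spanD]. Qed.

Let spanMz m a (n : int) : span m a -> span m (a *~ n).
Proof. by case: n => n am; [exact: spanMn|apply/spanN/spanMn]. Qed.

Let spanS m a : span m.+1 a <-> exists b c, span m b /\ a = b + s m *~ c.
Proof.
split=> [[c ->]|[b [c [[d ->] ->]]]].
  by exists (\sum_(j < m) s j *~ c j), (c m); split; [exists c|rewrite big_ord_recr].
exists (fun j => if j == m then c else d j); rewrite big_ord_recr /= eqxx; congr (_ + _).
by apply: eq_bigr => j _; rewrite ifF//; apply/negbTE; rewrite neq_ltn ltn_ord.
Qed.

(** Induction on the number of generators. If a positive multiple [s m *+ M] is in the span of the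
    earlier ones, multiplication by [M] pulls the functionals back and loses only the finitely many
    remainders modulo [M]. Otherwise the coefficient of [s m] is well defined and is a new
    functional. The functions are additive only on the span; outside it they take arbitrary
    values. *)
Lemma bounded_functionals m : exists fs : seq (A -> int),
  (forall f, f \in fs -> forall a b, span m a -> span m b -> f (a + b) = f a + f b) /\
  (forall n : nat, exists l : seq A, forall a, span m a ->
     (forall f, f \in fs -> `|f a| <= n%:Z) -> a \in l).
Proof.
elim: m => [|m [fs [fsD fsB]]].
  exists [::]; split=> // n; exists [:: 0] => a [c ->] _.
  by rewrite big_ord0 mem_seq1.
have fsMn f a n : f \in fs -> span m a -> f (a *+ n) = f a *+ n.
  move=> fF am; elim: n => [|n IH]; last by rewrite !mulrS fsD ?IH//; exact: spanMn.
  by apply: (addrI (f 0)); rewrite -fsD// !addr0.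
have [[M [M0 sM]]|ind] := pselect (exists M, (0 < M)%N /\ span m (s m *+ M)).
  have MS a : span m.+1 a -> span m (a *+ M).
    move=> /spanS[b [c [bm ->]]]; rewrite mulrnDl; apply: spanD; first exact: spanMn.
    by rewrite pmulrn -mulrzA mulrC mulrzA -pmulrn; apply: spanMz.
  exists [seq (fun a => f (a *+ M)) | f <- fs]; split.
    by move=> _ /mapP[f fF ->] a b /MS aM /MS bM; rewrite mulrnDl fsD.
  move=> n.
  pose K := (\sum_(f <- fs) \sum_(r < M) absz (f ((s m *+ r) *+ M)))%N.
  have KP f (r : 'I_M) : f \in fs -> (absz (f ((s m *+ r) *+ M)) <= K)%N.
    move=> fF; rewrite /K (big_rem f)//= (bigD1 r)//=.
    by rewrite -addnA leq_addr.
  have [l lP] := fsB (n + K)%N.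
  exists [seq b + s m *+ r | b <- l, r <- iota 0 M] => a /spanS[b [c [bm aE]]] aB.
  pose r := absz (c %% M%:Z)%Z; pose b' := b + (s m *+ M) *~ (c %/ M%:Z)%Z.
  have rM : (r < M)%N by rewrite /r; move: M0; clear; lia.
  have aE' : a = b' + s m *+ r.
    rewrite aE /b' -addrA; congr (_ + _); rewrite [s m *+ r]pmulrn [s m *+ M]pmulrn -mulrzA -mulrzDr.
    by congr (_ *~ _); rewrite /r; move: M0; clear; lia.
  have b'm : span m b' by apply: spanD => //; exact: spanMz.
  apply/allpairsP; exists (b', r); rewrite /= mem_iota /= add0n; split=> //.
  apply: lP => // f fF; have := aB (fun a => f (a *+ M)) (map_f _ fF).
  have -> : f (a *+ M) = f b' * M%:Z + f (s m *+ r *+ M).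
    rewrite aE' mulrnDl fsD//; first by congr (_ + _); rewrite fsMn// pmulrn mulrzz.
      exact: spanMn.
    by apply: MS; apply/spanS; exists 0, r; rewrite add0r -pmulrn; split.
  have := KP f (Ordinal rM) fF => /=.
  move: (f _) (f _) M0 => u w; clear=> M0 wK uw.
  have : `|u| <= `|u * M%:Z| by rewrite normrM ler_peMr//; move: M0; clear; lia.
  by move: wK uw; move: (u * M%:Z) => t; clear; lia.
have /choice[dec decP] : forall a, exists bc : A * int, span m.+1 a -> span m bc.1 /\ a = bc.1 + s m *~ bc.2.
  move=> a; have [/spanS[b [c bc]]|h] := pselect (span m.+1 a); first by exists (b, c).
  by exists (0, 0) => /h.
have decU a b c : span m b -> a = b + s m *~ c -> (dec a).1 = b /\ (dec a).2 = c.
  move=> bm aE; have [|d1 d2] := decP a; first by apply/spanS; exists b, c.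
  suff dc : (dec a).2 = c by split=> //; move: d2; rewrite dc aE => /addIr.
  apply: contrapT => dc; apply: ind; exists (absz ((dec a).2 - c)); split.
    by move: dc; clear; lia.
  have sE : s m *~ ((dec a).2 - c) = b - (dec a).1.
    rewrite mulrzBr; apply/eqP; by rewrite subr_eq addrAC -aE eq_sym subr_eq addrC -d2.
  have : span m (s m *~ ((dec a).2 - c)) by rewrite sE; apply: spanD => //; exact: spanN.
  rewrite [s m *+ _]pmulrn; case: (lerP 0 ((dec a).2 - c)) => h; first by rewrite gez0_abs.
  by move=> /spanN; rewrite -mulrNz ltz0_abs.
exists ((fun a => (dec a).2) :: [seq (fun a => f (dec a).1) | f <- fs]); split.
  have decD a b : span m.+1 a -> span m.+1 b ->
      (dec (a + b)).1 = (dec a).1 + (dec b).1 /\ (dec (a + b)).2 = (dec a).2 + (dec b).2.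
    move=> /decP[a1 a2] /decP[b1 b2]; apply: decU; first exact: spanD.
    by rewrite mulrzDr addrACA -a2 -b2.
  move=> f; rewrite inE => /orP[/eqP->|/mapP[g gF ->]] a b am bm; have [d1 d2] := decD _ _ am bm.
    exact: d2.
  by rewrite d1 fsD//; [have [] := decP _ am|have [] := decP _ bm].
move=> n; have [l lP] := fsB n.
exists [seq b + s m *~ (c%:Z - n%:Z) | b <- l, c <- iota 0 (n + n).+1] => a am aB.
have [b1 aE] := decP _ am.
have := aB (fun a => (dec a).2); rewrite mem_head => /(_ isT) cn.
apply/allpairsP; exists ((dec a).1, absz ((dec a).2 + n%:Z)); split; [|rewrite mem_iota|].
- by apply: lP => // f fF; apply: (aB (fun a => f (dec a).1)); rewrite inE map_f ?orbT.
- by move: cn => /=; clear; lia.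
- by rewrite /= {1}aE; congr (_ + _ *~ _); move: cn; clear; lia.
Qed.

End FiniteRank.

(** A label in a finite type, faithful for integers between [-n] and [n]; it turns bounded integer
    data into states of automata and pigeonholes. *)
Definition clip (n : nat) (z : int) : 'I_(n + n).+1 := inord (absz (z + n%:Z)).

Lemma clip_inj (n : nat) (y z : int) : `|y| <= n%:Z -> `|z| <= n%:Z -> clip n y = clip n z -> y = z.
Proof.
move=> yn zn /(congr1 val); rewrite /= !inordK; move: yn zn; clear; lia.
Qed.

Section InvariantFunctionals.
Variables (A : zmodType) (E : groupType) (act : E -> A -> A).
Hypotheses (actD : forall e, {morph act e : a b / a + b})
  (act1 : act 1%g = id) (actM : forall e f a, act (e * f)%g a = act e (act f a))
  (act_fin : exists es : seq E, forall e, exists2 f, f \in es & act e = act f)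
  (fgA : finitely_generated_zmod A).

(* The zero functional is included because its minimal cost is the word length. *)
Lemma invariant_functionals : exists Phi : seq (A -> int),
  [/\ uniq Phi, (fun=> 0) \in Phi, forall f, f \in Phi -> {morph f : a b / a + b},
      forall f e, f \in Phi -> f \o act e \in Phi &
      forall n : nat, exists l : seq A, forall a, (forall f, f \in Phi -> `|f a| <= n%:Z) -> a \in l].
Proof.
have [es esP] := act_fin; have [m [s sP]] := fgA.
have sA a : exists c : nat -> int, a = \sum_(j < m) (nth 0 s j) *~ c j.
  have [c ->] := sP a; exists (fun j => if insub j is Some i then c i else 0).
  by apply: eq_bigr => j _; rewrite valK.
have [fs [fsD fsB]] := bounded_functionals (nth 0 s) m.
(* Finitely many [e] represent all automorphisms that occur, so composing with them closes the
   family under the action. *)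
pose Phi := undup ((fun=> 0) :: [seq f \o act e | f <- fs, e <- es]); exists Phi.
have PhiP f : f \in Phi -> f = (fun=> 0) \/ exists g e, [/\ g \in fs, e \in es & f = g \o act e].
  rewrite mem_undup inE => /orP[/eqP->|/allpairsP[[g e] /= [gF eS ->]]]; first by left.
  by right; exists g, e.
split.
- exact: undup_uniq.
- by rewrite mem_undup mem_head.
- move=> f /PhiP[->|[g [e [gF _ ->]]]] a b /=; first by rewrite addr0.
  by rewrite actD (fsD g).
- move=> f e /PhiP[->|[g [e' [gF _ ->]]]]; first by rewrite mem_undup inE; apply/orP; left; apply/eqP.
  have [e'' e''S aE] := esP (e' * e)%g.
  have -> : (g \o act e') \o act e = g \o act e''.
    by apply/funext => a /=; rewrite -aE actM.
  by rewrite mem_undup inE; apply/orP; right; apply/allpairsP; exists (g, e'').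
- move=> n; have [l lP] := fsB n; exists l => a aP; apply: lP => // f fF.
  have [e eS eE] := esP 1%g.
  have -> : f a = (f \o act e) a by rewrite /= -eE act1.
  by apply: aP; rewrite mem_undup inE; apply/orP; right; apply/allpairsP; exists (f, e).
Qed.

Lemma invariant_generators : exists B : seq A,
  (forall e b, b \in B -> act e b \in B) /\
  (forall P : set A, (forall a b, P a -> P b -> P (a - b)) -> (exists a, P a) ->
     (forall b, b \in B -> P b) -> forall a, P a).
Proof.
have [es esP] := act_fin; have [m [s sP]] := fgA.
exists [seq act e b | e <- es, b <- s]; split.
  move=> e _ /allpairsP[[e' b] /= [eS bS ->]]; have [f fS fE] := esP (e * e')%g.
  by rewrite -actM fE; apply/allpairsP; exists (f, b).
move=> P PB [a0 Pa0] Ps a.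
have P0 : P 0 by rewrite -(subrr a0); exact: PB.
have PN b : P b -> P (- b) by rewrite -sub0r; exact: PB.
have PD b c : P b -> P c -> P (b + c) by move=> Pb /PN; rewrite -{2}[c]opprK; exact: PB.
have Pn b (n : nat) : P b -> P (b *+ n) by move=> Pb; elim: n => // n IH; rewrite mulrS; exact: PD.
have [c ->] := sP a; elim/big_ind: _ => // i _.
have Psi : P s`_i.
  have [e eS eE] := esP 1%g; apply: Ps; apply/allpairsP; exists (e, s`_i); split=> //=.
    by rewrite mem_nth// size_tuple.
  by rewrite -eE act1.
by case: (c i) => k; [exact: Pn|apply/PN/Pn].
Qed.

End InvariantFunctionals.

(** Induction on the number of coordinates not yet known to be constant on [P]. A point that is not
    above a fixed [p0] has some coordinate [i] with a value below [p0 i], so it lies in one of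
    finitely many slices with one more constant coordinate. *)
Lemma dickson (I : finType) (P : set {ffun I -> nat}) : exists l : seq {ffun I -> nat},
  (forall p, p \in l -> P p) /\ forall p, P p -> exists2 m, m \in l & forall i, (m i <= p i)%N.
Proof.
suff : forall n (F : {set I}), (#|~: F| <= n)%N -> forall P : set {ffun I -> nat},
    (forall p q i, P p -> P q -> i \in F -> p i = q i) ->
    exists l : seq {ffun I -> nat}, (forall p, p \in l -> P p) /\
      forall p, P p -> exists2 m, m \in l & forall i, (m i <= p i)%N.
  by move=> /(_ #|~: (finset.set0 : {set I})| finset.set0 (leqnn _) P); apply => p q i _ _; rewrite inE.
elim=> [|n IH] F Fn {}P PF; have [[p0 Pp0]|P0] := pselect (exists p, P p);
  try by exists [::]; split=> // p Pp; case: P0; exists p.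
  exists [:: p0]; split=> [p|p Pp]; first by rewrite mem_seq1 => /eqP->.
  exists p0; rewrite ?mem_head// => i; rewrite (PF p0 p i)//.
  by move: Fn; rewrite leqn0 cards_eq0 => /eqP/finset.setP/(_ i); rewrite !inE => /negbFE.
pose Q (i : I) (k : nat) : set {ffun I -> nat} := [set p | P p /\ p i = k].
have /choice[g gP] : forall ik : I * nat, exists l : seq {ffun I -> nat}, ik.1 \notin F ->
    (forall p, p \in l -> Q ik.1 ik.2 p) /\
      forall p, Q ik.1 ik.2 p -> exists2 m, m \in l & forall i, (m i <= p i)%N.
  move=> [i k] /=; have [iF|iF] := boolP (i \in F); first by exists [::].
  have [||l lP] := IH (i |: F)%SET _ (Q i k).
  - rewrite -ltnS; apply: leq_trans Fn; apply: proper_card.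
    rewrite properE; apply/andP; split; first by apply/fintype.subsetP => j; rewrite !inE negb_or => /andP[].
    by apply/fintype.subsetPn; exists i; rewrite !inE ?iF ?eqxx.
  - move=> p q j [Pp pk] [Pq qk]; rewrite !inE => /orP[/eqP->|jF]; first by rewrite pk qk.
    exact: PF.
  - by exists l.
exists (p0 :: flatten [seq flatten [seq g (i, k) | k <- iota 0 (p0 i)] | i <- enum (~: F)%SET]); split.
  move=> p; rewrite inE => /orP[/eqP->//|/flattenP[_ /mapP[i iF ->] /flattenP[_ /mapP[k _ ->]] pg]].
  have iF' : i \notin F by move: iF; rewrite mem_enum inE.
  by have [/(_ p pg)[]] := gP (i, k) iF'.
move=> p Pp; have [le|] := pselect (forall i, (p0 i <= p i)%N); first by exists p0; rewrite ?mem_head.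
move=> /existsNP[i /negP]; rewrite -ltnNge => pi.
have iF : i \notin F by apply/negP => /(PF p p0 i Pp Pp0) e; rewrite e ltnn in pi.
have [_ /(_ p (conj Pp erefl))[m mg mp]] := gP (i, p i) iF.
exists m => //; rewrite inE; apply/orP; right; apply/flattenP.
exists (flatten [seq g (i, k) | k <- iota 0 (p0 i)]); first by apply: map_f; rewrite mem_enum inE.
by apply/flattenP; exists (g (i, p i)) => //; apply: map_f; rewrite mem_iota.
Qed.

Lemma perm_mask_negb (T : eqType) (m : bitseq) (s : seq T) : size m = size s ->
  perm_eq (mask m s ++ mask (map negb m) s) s.
Proof.
elim: s m => [|x s IH] [|b m] //= [sz]; case: b => /=; first by rewrite perm_cons IH.
by rewrite -cat1s perm_catCA /= perm_cons IH.
Qed.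

Lemma pairwise_mem (T : eqType) (r : rel T) (s : seq T) x y : pairwise r s ->
  x \in s -> y \in s -> [\/ x = y, r x y | r y x].
Proof.
elim: s => //= z s IH /andP[/allP zs /IH{}IH]; rewrite !inE.
move=> /orP[/eqP->|xs] /orP[/eqP->|ys]; [exact: Or31|apply: Or32|apply: Or33|exact: IH]; exact: zs.
Qed.

Lemma count_take_sorted (T : eqType) (P : pred T) (s : seq T) t :
  pairwise (fun x y => P y ==> P x) s -> count P (take t s) = minn t (count P s).
Proof.
elim: s t => [|x s IH] [|t] //=; rewrite ?min0n ?minn0//.
move=> /andP[/allP xs /IH ->]; have [Px|Px] := boolP (P x); first by rewrite !add1n minnSS.
have -> : count P s = 0%N.
  apply/eqP; rewrite -leqn0 leqNgt -has_count; apply/hasPn => y /xs.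
  by rewrite (negbTE Px) implybF.
by rewrite !minn0.
Qed.

Lemma big_count_mem (T : eqType) (V : nmodType) (D s : seq T) (F : T -> V) : uniq D ->
  {subset s <= D} -> \sum_(x <- s) F x = \sum_(x <- D) F x *+ count_mem x s.
Proof.
move=> uD; elim: s => [|y s IH] sD.
  by rewrite big_nil big1// => x _; rewrite mulr0n.
rewrite big_cons IH; last by move=> x xs; apply: sD; rewrite inE xs orbT.
rewrite (bigD1_seq y) ?sD ?mem_head//= [in RHS](bigD1_seq y) ?sD ?mem_head//=.
rewrite eqxx mulrS addrA; congr (_ + _); apply: eq_bigr => x xy.
by rewrite eq_sym (negbTE xy).
Qed.

(** * The hyperplane arrangement of the functionals: cells, centers and chains *)

Section InvariantCones.
Variables (A : zmodType) (E : groupType) (act : E -> A -> A).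
Hypotheses (actD : forall e, {morph act e : a b / a + b})
  (act1 : act 1%g = id) (actM : forall e f a, act (e * f)%g a = act e (act f a))
  (act_fin : exists es : seq E, forall e, exists2 f, f \in es & act e = act f).
Variable Phi : seq (A -> int).
Hypotheses (PhiU : uniq Phi) (PhiD : forall f, f \in Phi -> {morph f : a b / a + b})
  (Phi_act : forall f e, f \in Phi -> f \o act e \in Phi)
  (Phi_fin : forall n : nat, exists l : seq A, forall a,
     (forall f, f \in Phi -> `|f a| <= n%:Z) -> a \in l).
Implicit Types (f g : A -> int) (a b x y : A) (e : E) (v : seq A).

Lemma Phi_zero f : f \in Phi -> f 0 = 0.
Proof. by move=> fP; apply: (addrI (f 0)); rewrite -(PhiD fP) !addr0. Qed.

Lemma Phi_opp f a : f \in Phi -> f (- a) = - f a.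
Proof. by move=> fP; apply: (addrI (f a)); rewrite -(PhiD fP) !subrr Phi_zero. Qed.

Lemma Phi_sub f a b : f \in Phi -> f (a - b) = f a - f b.
Proof. by move=> fP; rewrite (PhiD fP) Phi_opp. Qed.

Lemma Phi_sum f I (r : seq I) (P : pred I) F : f \in Phi ->
  f (\sum_(i <- r | P i) F i) = \sum_(i <- r | P i) f (F i).
Proof. by move=> fP; rewrite (big_morph _ (PhiD fP) (Phi_zero fP)). Qed.

Lemma Phi_muln f a n : f \in Phi -> f (a *+ n) = f a *+ n.
Proof. by move=> fP; elim: n => [|n IH]; rewrite ?mulr0n ?Phi_zero// !mulrS (PhiD fP) IH. Qed.

Lemma act_inj e : injective (act e).
Proof. by apply: (can_inj (g := act e^-1%g)) => a; rewrite -actM mulVg act1. Qed.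

Lemma Phi_perm e : perm_eq [seq f \o act e | f <- Phi] Phi.
Proof.
have U : uniq [seq f \o act e | f <- Phi].
  rewrite map_inj_uniq// => f g fg; apply/funext => a.
  by have := congr1 (@^~ (act e^-1%g a)) fg; rewrite /= -actM mulgV act1.
have sub : {subset [seq f \o act e | f <- Phi] <= Phi}.
  by move=> _ /mapP[f fP ->]; exact: Phi_act.
by apply: uniq_perm => //; apply: (uniq_min_size U sub _).2; rewrite size_map.
Qed.

(** A positive semidefinite form, invariant under the action because [Phi] is permuted; its radical
    is the common kernel of [Phi], which is finite. *)
Definition pairing a b : int := \sum_(f <- Phi) f a * f b.

(** Two elements with equal pairings against the generators have a difference orthogonal to all of
    [A], in particular to itself. This makes a sum of squares vanish, so every functional kills the
    difference. *)
Lemma pairing_fin (B : seq A) :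
  (forall P : set A, (forall a b, P a -> P b -> P (a - b)) -> (exists a, P a) ->
     (forall b, b \in B -> P b) -> forall a, P a) ->
  forall n : nat, exists l : seq A, forall a,
    (forall b, b \in B -> `|pairing a b| <= n%:Z) -> a \in l.
Proof.
move=> Bgen n; have [l0 l0P] := Phi_fin 0.
apply: (@finite_classes _ _ [set a | forall b, b \in B -> `|pairing a b| <= n%:Z]
   (fun a => [ffun i : 'I_(size B) => clip n (pairing a (nth 0 B i))])
   (fun a => [seq a + k | k <- l0])) => a a' /= aB a'B aa'.
have pE b : b \in B -> pairing (a' - a) b = 0.
  move=> bB; have iB : (index b B < size B)%N by rewrite index_mem.
  have /ffunP/(_ (Ordinal iB)) := aa'; rewrite !ffunE /= nth_index//.
  move=> /(clip_inj (aB _ bB) (a'B _ bB)) ab.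
  have -> : pairing (a' - a) b = pairing a' b - pairing a b.
    by rewrite /pairing -sumrB; apply: eq_big_seq => f fP; rewrite Phi_sub// mulrBl.
  by rewrite ab subrr.
have {}pE b : pairing (a' - a) b = 0.
  apply: (Bgen [set b | pairing (a' - a) b = 0]) => [b1 b2 /= h1 h2||]; last exact: pE.
    rewrite /pairing (eq_big_seq (fun f => f (a' - a) * f b1 - f (a' - a) * f b2)).
      by rewrite sumrB -!/(pairing _ _) h1 h2 subrr.
    by move=> f fP; rewrite [f (b1 - b2)]Phi_sub// mulrBr.
  by exists 0; rewrite /= /pairing big_seq big1// => f fP; rewrite Phi_zero ?mulr0.
apply/mapP; exists (a' - a); last by rewrite addrC subrK.
apply: l0P => f fP; have /eqP := pE (a' - a); rewrite /pairing.
rewrite psumr_eq0; last by move=> g _; rewrite -expr2 sqr_ge0.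
by move=> /allP/(_ f fP); rewrite /= mulf_eq0 orbb => /eqP->.
Qed.

Definition sim x y := all (fun f => sgz (f x) == sgz (f y)) Phi.
(* [face x y]: [y] lies in the closure of the cell of [x] in the arrangement of the hyperplanes
   [f = 0], where [f] runs over [Phi]. *)
Definition face x y := all (fun f => (f y == 0) || (sgz (f y) == sgz (f x))) Phi.

Lemma simP x y : reflect (forall f, f \in Phi -> sgz (f x) = sgz (f y)) (sim x y).
Proof. by apply: (iffP allP) => h f /h /eqP. Qed.

Lemma faceP x y : reflect (forall f, f \in Phi -> f y = 0 \/ sgz (f y) = sgz (f x)) (face x y).
Proof.
apply: (iffP allP) => h f /h; first by case/orP => /eqP; [left|right].
by case=> /eqP ->; rewrite ?orbT.
Qed.

Lemma sim_sym x y : sim x y = sim y x.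
Proof. by apply/simP/simP => h f /h. Qed.
Lemma sim_trans : transitive sim.
Proof. by move=> y x z /simP xy /simP yz; apply/simP => f fP; rewrite xy// yz. Qed.

Lemma sim_act e x y : sim (act e x) (act e y) = sim x y.
Proof.
apply/simP/simP => h f fP; last exact: (h (f \o act e) (Phi_act e fP)).
by have := h _ (Phi_act e^-1%g fP); rewrite /= -!actM !mulVg !act1.
Qed.

Lemma face_act e x y : face (act e x) (act e y) = face x y.
Proof.
apply/faceP/faceP => h f fP; last exact: (h (f \o act e) (Phi_act e fP)).
by have := h _ (Phi_act e^-1%g fP); rewrite /= -!actM !mulVg !act1.
Qed.

Lemma face_refl x : face x x. Proof. by apply/faceP => f _; right. Qed.

Lemma face_simr x y z : face x y -> sim y z -> face x z.
Proof.
move=> /faceP xy /simP yz; apply/faceP => f fP; have [fy|fy] := xy f fP.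
  by left; apply/eqP; rewrite -sgz_eq0 -yz// fy sgz0.
by right; rewrite -yz.
Qed.

Lemma face_siml x y z : sim x z -> face x y -> face z y.
Proof.
move=> /simP xz /faceP xy; apply/faceP => f fP; have [fy|fy] := xy f fP; first by left.
by right; rewrite fy xz.
Qed.

Lemma face_trans : transitive face.
Proof.
move=> y x z /faceP xy /faceP yz; apply/faceP => f fP.
have [fz|fz] := yz f fP; first by left.
have [fy|fy] := xy f fP; last by right; rewrite fz fy.
by left; apply/eqP; rewrite -sgz_eq0 fz fy sgz0.
Qed.

Lemma sgz_sum_same (I : eqType) (r : seq I) (F : I -> int) (k : int) i0 : i0 \in r -> F i0 != 0 ->
  sgz (F i0) = k -> (forall i, i \in r -> F i = 0 \/ sgz (F i) = k) -> sgz (\sum_(i <- r) F i) = k.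
Proof.
have pos (G : I -> int) : i0 \in r -> 0 < G i0 -> (forall i, i \in r -> 0 <= G i) -> 0 < \sum_(i <- r) G i.
  move=> ir Gi G0; rewrite (big_rem i0)//= ltr_wpDr// big_seq sumr_ge0// => i /mem_rem; exact: G0.
move=> ir; case: (ltrgtP (F i0) 0) => // F0 _ <- Fk.
  have : 0 < \sum_(i <- r) - F i.
    apply: pos => //; first by rewrite oppr_gt0.
    by move=> i /Fk[->|]; rewrite ?oppr0// (ltr0_sgz F0) oppr_ge0; case: sgzP => // /ltW.
  by rewrite sumrN oppr_gt0 => /ltr0_sgz ->; rewrite ltr0_sgz.
have : 0 < \sum_(i <- r) F i.
  by apply: pos => // i /Fk[->//|]; rewrite (gtr0_sgz F0); case: sgzP => // /ltW.
by move=> /gtr0_sgz ->; rewrite gtr0_sgz.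
Qed.

Lemma act0 e : act e 0 = 0.
Proof. by apply: (addrI (act e 0)); rewrite -actD !addr0. Qed.

Lemma act_sum e I (r : seq I) (P : pred I) F :
  act e (\sum_(i <- r | P i) F i) = \sum_(i <- r | P i) act e (F i).
Proof. by rewrite (big_morph _ (actD e) (act0 e)). Qed.

Lemma invariant_cells : exists U : seq A,
  [/\ uniq U, forall e u, u \in U -> act e u \in U & forall a, exists2 u, u \in U & sim u a].
Proof.
have [es esP] := act_fin.
pose enc a := [ffun i : 'I_(size Phi) => inord (absz (sgz (nth (fun=> 0) Phi i a) + 1)) : 'I_3].
have encP a b : enc a = enc b -> sim a b.
  move=> ab; apply/simP => f fP; have iP : (index f Phi < size Phi)%N by rewrite index_mem.
  have /ffunP/(_ (Ordinal iP)) := ab; rewrite !ffunE /= nth_index// => /(congr1 val) /=.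
  by move: (f a) (f b) => u w; case: (sgzP u); case: (sgzP w); rewrite /= ?inordK.
have /choice[g gP] : forall q, exists u, forall a, enc a = q -> sim u a.
  move=> q; have [[u uq]|h] := pselect (exists u, enc u = q).
    by exists u => a aq; apply: encP; rewrite uq.
  by exists 0 => a aq; case: h; exists a.
exists (undup [seq act e (g q) | e <- es, q <- enum {ffun 'I_(size Phi) -> 'I_3}]); split.
- exact: undup_uniq.
- move=> e u; rewrite !mem_undup => /allpairsP[[e' q] /= [e'S qS ->]].
  have [e'' e''S eE] := esP (e * e')%g.
  by apply/allpairsP; exists (e'', q); rewrite -actM eE.
- move=> a; have [e eS eE] := esP 1%g; exists (g (enc a)); last exact: gP.
  rewrite mem_undup; apply/allpairsP; exists (e, enc a); rewrite /= mem_enum -eE act1; split=> //.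
Qed.

(* [c] selects an interior lattice point of each cell, equivariantly. *)
Lemma invariant_centers : exists (C : seq A) (c : A -> A),
  [/\ forall x, x \in C -> c x = x /\ ~~ sim x 0, forall a b, sim a b -> c a = c b,
      forall a, sim (c a) a, forall a, ~~ sim a 0 -> c a \in C &
      forall e a, c (act e a) = act e (c a)].
Proof.
have [U [Uu Ua Us]] := invariant_cells.
(* Adding all representatives in a cell, instead of choosing one, makes the point equivariant; the
   sum stays in the cell because nothing cancels. *)
pose c a := \sum_(u <- U | sim u a) u.
have cs a : sim (c a) a.
  apply/simP => f fP; rewrite /c Phi_sum// -big_filter.
  have mU u : u \in [seq u <- U | sim u a] -> sgz (f u) = sgz (f a).
    by rewrite mem_filter => /andP[/simP/(_ f fP)].
  have [fa|fa] := eqVneq (f a) 0.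
    rewrite fa big_seq big1// => u /mU; rewrite fa sgz0 => /eqP.
    by rewrite sgz_eq0 => /eqP.
  have [u uU ua] := Us a; have uF : u \in [seq u <- U | sim u a] by rewrite mem_filter ua.
  apply: (sgz_sum_same uF); [|exact: mU|by move=> v /mU; right].
  by rewrite -sgz_eq0 mU// sgz_eq0.
have cE a b : sim a b -> c a = c b.
  by move=> ab; apply: eq_bigl => u; apply/idP/idP => /sim_trans; apply => //; rewrite sim_sym.
exists (undup [seq c u | u <- U & ~~ sim u 0]), c; split=> //.
- move=> x; rewrite mem_undup => /mapP[u]; rewrite mem_filter => /andP[u0 uU ->].
  split; first exact: cE.
  by apply: contra u0 => h; rewrite sim_sym; apply: sim_trans (cs u); rewrite sim_sym.
- move=> a a0; have [u uU ua] := Us a; rewrite mem_undup; apply/mapP; exists u.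
    by rewrite mem_filter uU andbT; apply: contra a0 => h; apply: sim_trans h; rewrite sim_sym.
  by apply: cE; rewrite sim_sym.
- move=> e a; rewrite /c act_sum.
  have Up : perm_eq [seq act e u | u <- U] U.
    have uniqU : uniq [seq act e u | u <- U] by rewrite map_inj_uniq//; exact: act_inj.
    have sub : {subset [seq act e u | u <- U] <= U} by move=> _ /mapP[u uU ->]; exact: Ua.
    by apply: uniq_perm => //; apply: (uniq_min_size uniqU sub _).2; rewrite size_map.
  by rewrite -(perm_big _ Up) big_map; apply: eq_bigl => u; rewrite sim_act.
Qed.

Variables (C : seq A) (c : A -> A).
Hypotheses (C_c : forall x, x \in C -> c x = x /\ ~~ sim x 0)
  (c_sim : forall a b, sim a b -> c a = c b) (sim_c : forall a, sim (c a) a)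
  (c_C : forall a, ~~ sim a 0 -> c a \in C) (c_act : forall e a, c (act e a) = act e (c a)).

Definition chain v := all (mem C) v && pairwise face v.

Lemma C_act e x : x \in C -> act e x \in C.
Proof.
move=> /C_c[cx x0]; rewrite -cx -c_act; apply: c_C.
by rewrite -(act0 e) sim_act.
Qed.

Lemma chain_act e v : chain v -> chain (map (act e) v).
Proof.
move=> /andP[/allP vC vf]; apply/andP; split.
  by rewrite all_map; apply/allP => x /vC; exact: C_act.
by rewrite pairwise_map; apply: sub_pairwise vf => x y /=; rewrite face_act.
Qed.

Lemma C_sim_eq x y : x \in C -> y \in C -> sim x y -> x = y.
Proof.
move=> /C_c[<- _] /C_c[<- _] xy; apply: c_sim; apply: sim_trans (sim_c _).
by apply: sim_trans xy => //; rewrite // sim_sym.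
Qed.

(** It stands in for the dimension of a cell: it drops strictly on passing to a proper face, by
    [face_rank_sim]. *)
Definition rank a := count (fun f => f a != 0) Phi.

Lemma face_rank x y : face x y -> (rank y <= rank x)%N.
Proof.
move=> /faceP xy; rewrite /rank -!size_filter; apply: uniq_leq_size; first exact: filter_uniq.
move=> f; rewrite !mem_filter => /andP[fy fP]; rewrite fP andbT.
by have [/eqP|fx] := xy f fP; [rewrite (negbTE fy)|rewrite -sgz_eq0 -fx sgz_eq0].
Qed.

Lemma face_rank_sim x y : face x y -> (rank x <= rank y)%N -> sim x y.
Proof.
move=> /faceP xy; rewrite /rank -!size_filter => sz; apply/simP => f fP.
have U : uniq [seq f <- Phi | f y != 0] by exact: filter_uniq.
have sub : {subset [seq f <- Phi | f y != 0] <= [seq f <- Phi | f x != 0]}.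
  move=> g; rewrite !mem_filter => /andP[gy gP]; rewrite gP andbT.
  by have [/eqP|gx] := xy g gP; [rewrite (negbTE gy)|rewrite -sgz_eq0 -gx sgz_eq0].
have [_ mE] := uniq_min_size U sub sz.
have := mE f; rewrite !mem_filter fP !andbT => fE.
have [fy|->//] := xy f fP; move: fE; rewrite fy eqxx /=.
by move=> /esym/negbFE/eqP ->.
Qed.

Lemma min_ratio (T : eqType) (r : seq T) (u w : T -> nat) : r != [::] ->
  (forall i, i \in r -> (0 < w i)%N) ->
  exists2 i0, i0 \in r & forall i, i \in r -> (u i0 * w i <= u i * w i0)%N.
Proof.
elim: r => // j r IH _ w0.
have [->|/IH] := eqVneq r [::].
  by exists j; rewrite ?mem_head// => i; rewrite mem_seq1 => /eqP->.
move=> [i|i0 i0r i0P]; first by move=> ir; apply: w0; rewrite inE ir orbT.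
have wi0 : (0 < w i0)%N by apply: w0; rewrite inE i0r orbT.
have [yi|iy] := leqP (u j * w i0) (u i0 * w j); last first.
  exists i0; first by rewrite inE i0r orbT.
  by move=> i; rewrite inE => /orP[/eqP->|/i0P//]; exact: ltnW.
exists j; first exact: mem_head.
move=> i; rewrite inE => /orP[/eqP->//|/i0P ii0].
rewrite -(leq_pmul2r wi0) mulnAC; apply: leq_trans (leq_mul yi (leqnn _)) _.
by rewrite mulnAC [(u i * _ * _)%N]mulnAC leq_mul2r ii0 orbT.
Qed.

(** Move from [a] in the direction opposite to the center [c a] until a first functional [f0]
    vanishes, the one of least ratio between its values at [a] and at [c a]. The point reached is in
    a proper face, where induction applies; the factors [absz (f0 (c a))] clear denominators and
    accumulate in [M]. *)
Lemma cone_decomposition n a : (rank a <= n)%N -> exists (M : nat) (l : seq (nat * A)),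
  [/\ (0 < M)%N, forall p, p \in l -> p.2 \in C /\ face a p.2, pairwise face (map snd l),
      (size l <= n)%N & forall f, f \in Phi -> f a *+ M = \sum_(p <- l) f p.2 *+ p.1].
Proof.
elim: n a => [|n IH] a an.
  exists 1%N, [::]; split=> // f fP; rewrite big_nil mulr1n.
  move: an; rewrite leqn0 => /eqP/eqP; rewrite -leqn0 leqNgt -has_count => /hasPn/(_ f fP).
  by rewrite negbK => /eqP.
have [a0|a0] := boolP (sim a 0).
  exists 1%N, [::]; split=> // f fP; rewrite big_nil mulr1n.
  by move/simP: a0 => /(_ f fP); rewrite Phi_zero// sgz0 => /eqP; rewrite sgz_eq0 => /eqP.
pose r := [seq f <- Phi | f a != 0].
have caS := sim_c a.
have caN f : f \in Phi -> (f (c a) == 0) = (f a == 0).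
  by move=> fP; rewrite -[f (c a) == 0]sgz_eq0 -[f a == 0]sgz_eq0; move/simP: caS => ->.
have [f0 f0r f0P] : exists2 f0, f0 \in r & forall f, f \in r ->
    (absz (f0 a) * absz (f (c a)) <= absz (f a) * absz (f0 (c a)))%N.
  apply: (@min_ratio _ r (fun f => absz (f a)) (fun f => absz (f (c a)))).
    apply: contra a0 => /eqP r0; apply/simP => f fP; rewrite Phi_zero//.
    have : f \notin r by rewrite r0.
    by rewrite mem_filter fP andbT negbK => /eqP->.
  by move=> f; rewrite mem_filter absz_gt0 => /andP[fa fP]; rewrite caN.
move: (f0r); rewrite mem_filter => /andP[f0a f0Phi].
have f0c : f0 (c a) != 0 by rewrite caN.
pose a' := a *+ absz (f0 (c a)) - c a *+ absz (f0 a).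
have fa' f : f \in Phi -> f a' = f a *+ absz (f0 (c a)) - f (c a) *+ absz (f0 a).
  by move=> fP; rewrite Phi_sub// !Phi_muln.
have aa' : face a a'.
  apply/faceP => f fP; rewrite fa'//; have [fa|fa] := eqVneq (f a) 0.
    by left; rewrite fa; move/eqP: fa; rewrite -caN// => /eqP->; rewrite !mul0rn subrr.
  have fr : f \in r by rewrite mem_filter fa.
  have := f0P _ fr; have /simP/(_ f fP) := caS.
  rewrite !pmulrn !mulrzz; move: fa (caN _ fP); clear.
  move: (f a) (f (c a)) (absz (f0 a)) (absz (f0 (c a))) => u w p q u0.
  case: (sgzP w); case: (sgzP u) => //; move: u0; clear.
  - by move=> /eqP u0 /u0.
  - move=> _ u0 w0 _ _ h; have : 0 <= u * q%:Z - w * p%:Z.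
      by move: h u0 w0; rewrite -lez_nat !PoszM; case: u => // u; case: w => // w; lia.
    by rewrite le_eqVlt => /orP[/eqP<-|/gtr0_sgz ->]; [left|right].
  - move=> _ u0 w0 _ _ h; have : u * q%:Z - w * p%:Z <= 0.
      move: h; rewrite -lez_nat !PoszM !ltz0_abs//; lia.
    by rewrite le_eqVlt => /orP[/eqP->|/ltr0_sgz ->]; [left|right].
have a'n : (rank a' <= n)%N.
  rewrite leqNgt; apply/negP => a'n.
  have /simP/(_ f0 f0Phi) := face_rank_sim aa' (leq_trans an a'n).
  have -> : f0 a' = 0.
    rewrite fa'// !pmulrn !mulrzz; have /simP/(_ f0 f0Phi) := caS.
    move: f0a f0c; clear; move: (f0 a) (f0 (c a)) => u w.
    by case: (sgzP w); case: (sgzP u) => //; case: u => //; case: w => // *; rewrite ?NegzE /=; lia.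
  by rewrite sgz0 => /eqP; rewrite sgz_eq0 (negbTE f0a).
have [M [l [M0 lC lp ln lE]]] := IH _ a'n.
exists (M * absz (f0 (c a)))%N, (((M * absz (f0 a))%N, c a) :: l); split.
- by rewrite muln_gt0 M0 absz_gt0.
- move=> p; rewrite inE => /orP[/eqP->/=|/lC[pC pf]]; last by split=> //; exact: face_trans pf.
  by split; [exact: c_C|apply: face_simr (face_refl a) _; rewrite sim_sym].
- rewrite /= lp andbT all_map; apply/allP => p /lC[_ pf] /=.
  by apply: (face_siml (x := a)); [rewrite sim_sym|exact: face_trans pf].
- exact: ln.
- move=> f fP; rewrite big_cons /= -lE// fa'// mulnC mulrnA mulrnBl addrC.
  by rewrite -!mulrnA (mulnC M) (mulnC (absz (f0 a))) subrK.
Qed.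

Lemma chain_flatten (l : seq (nat * A)) : (forall p, p \in l -> p.2 \in C) ->
  pairwise face (map snd l) -> chain (flatten [seq nseq p.1 p.2 | p <- l]).
Proof.
elim: l => [|[k x] l IH] lC //= /andP[xl ll].
have /andP[vC vf] := IH (fun p pl => lC p (mem_behead (s := _ :: _) pl)) ll.
have xC : x \in C by exact: (lC (k, x) (mem_head _ _)).
rewrite /chain all_cat pairwise_cat vC vf andbT; apply/and3P; split.
- by apply/allP => y; rewrite mem_nseq => /andP[_ /eqP->].
- apply/allrelP => y z; rewrite mem_nseq => /andP[_ /eqP->] /flattenP[_ /mapP[[k' x'] pl ->]].
  rewrite mem_nseq => /andP[_ /eqP->].
  by move/allP: xl => /(_ x'); apply; apply/mapP; exists (k', x').
- elim: k {xl lC} => //= k; rewrite !andbT => ->; rewrite andbT; apply/allP => y.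
  rewrite mem_nseq => /andP[_ /eqP->]; exact: face_refl.
Qed.

(** Dividing the multiplicities of [cone_decomposition] by [M] and rounding down changes each
    functional boundedly, since a chain has at most [size Phi] distinct letters. *)
Lemma chain_decomposition : exists Rem : seq A, forall a, exists v r,
  [/\ chain v, r \in Rem & a = \sum_(x <- v) x + r].
Proof.
pose K := (\sum_(x <- C) \sum_(f <- Phi) absz (f x))%N.
have KP x f : x \in C -> f \in Phi -> (absz (f x) <= K)%N.
  by move=> xC fP; rewrite /K (big_rem x)//= (big_rem f)//= -addnA leq_addr.
have [Rem RemP] := Phi_fin (size Phi * K)%N; exists Rem => a.
have [M [l [M0 lC lp ln lE]]] := cone_decomposition (count_size (fun f => f a != 0) Phi : (rank a <= _)%N).
pose q (p : nat * A) := ((p.1 %/ M)%N, p.2).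
pose v := flatten [seq nseq p.1 p.2 | p <- map q l].
have vS : \sum_(x <- v) x = \sum_(p <- l) p.2 *+ (p.1 %/ M).
  rewrite /v big_flatten /= !big_map; apply: eq_bigr => p _.
  by rewrite big_nseq iter_addr_0.
exists v, (a - \sum_(x <- v) x); split; last by rewrite addrC subrK.
  apply: chain_flatten; first by move=> p /mapP[p' /lC[h _] ->].
  by rewrite -map_comp (eq_map (g := snd)).
apply: RemP => f fP; rewrite Phi_sub// vS Phi_sum//.
set D := f a - _; have DE : D *+ M = \sum_(p <- l) f p.2 *+ (p.1 %% M).
  rewrite /D mulrnBl lE// -sumrMnl -sumrB; apply: eq_bigr => p _.
  by rewrite Phi_muln// -mulrnA [X in _ *+ X - _](divn_eq p.1 M) mulrnDr addrC addKr.
have : `|D *+ M| <= (size l * K)%N%:Z *+ M.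
  rewrite DE; apply: le_trans (ler_norm_sum _ _ _) _.
  rewrite -sum1_size big_distrl /= rmorph_sum /= -sumrMnl.
  rewrite !big_seq; apply: ler_sum => p pl; rewrite normrMn mul1n.
  have h1 : `|f p.2| <= K%:Z by rewrite -abszE lez_nat; apply: KP => //; have [] := lC _ pl.
  apply: le_trans (_ : `|f p.2| *+ M <= _); last by rewrite lerMn2r h1 orbT.
  by apply: ler_wpMn2l => //; rewrite ltnW// ltn_mod.
rewrite normrMn ler_pMn2r// => /le_trans; apply.
by rewrite lez_nat leq_mul2r ln orbT.
Qed.

(** On the later letters each functional is zero or has the sign that it has on [x], so nothing
    cancels. *)
Lemma sim_chain_sum x v : chain (x :: v) -> sim (\sum_(y <- x :: v) y) x.
Proof.
move=> /andP[_ /= /andP[/allP xv _]]; apply/simP => f fP; rewrite Phi_sum//.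
have vx y : y \in x :: v -> f y = 0 \/ sgz (f y) = sgz (f x).
  by rewrite inE => /orP[/eqP->|/xv/faceP/(_ f fP)//]; right.
have [fx|fx] := eqVneq (f x) 0; last by apply: (sgz_sum_same (mem_head x v)).
rewrite big_seq big1 ?fx// => y /vx[//|].
by rewrite fx sgz0 => /eqP; rewrite sgz_eq0 => /eqP.
Qed.

(** The cell of the sum is the cell of the first letter, so the functionals of the sum determine
    that letter; remove it and repeat. *)
Lemma chain_sum_inj v v' : chain v -> chain v' ->
  (forall f, f \in Phi -> f (\sum_(x <- v) x) = f (\sum_(x <- v') x)) -> v = v'.
Proof.
have nil x w : chain (x :: w) -> ~ (forall f, f \in Phi -> f (\sum_(x <- x :: w) x) = 0).
  move=> xw h; have /andP[/andP[/C_c[_ /negP x0] _] _] := xw; apply: x0.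
  rewrite sim_sym; apply: sim_trans (sim_chain_sum xw).
  by apply/simP => f fP; rewrite h// Phi_zero.
elim: v v' => [|x v IH] [|x' v'] // xv xv' h.
- by case: (nil _ _ xv') => f fP; rewrite -h// big_nil Phi_zero.
- by case: (nil _ _ xv) => f fP; rewrite h// big_nil Phi_zero.
have xx : x = x'.
  have /andP[/andP[xC _] _] := xv; have /andP[/andP[x'C _] _] := xv'.
  apply: C_sim_eq => //; apply: sim_trans (sim_chain_sum xv').
  rewrite sim_sym; apply: sim_trans (sim_chain_sum xv).
  by apply/simP => f fP; rewrite h.
rewrite -xx in xv' h *; congr (_ :: _); apply: IH.
- by move: xv => /andP[/= /andP[_ vC] /andP[_ vf]]; rewrite /chain vC.
- by move: xv' => /andP[/= /andP[_ vC] /andP[_ vf]]; rewrite /chain vC.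
- by move=> f fP; have := h f fP; rewrite !big_cons !(PhiD fP) => /addrI.
Qed.

Let small n v v' := forall f, f \in Phi -> `|f (\sum_(x <- v) x - \sum_(x <- v') x)| <= n%:Z.

Let small_sym n v v' : small n v v' -> small n v' v.
Proof. by move=> h f fP; rewrite -opprB Phi_opp// normrN; exact: h. Qed.

Lemma chain_subseq v w : subseq w v -> chain v -> chain w.
Proof.
move=> wv /andP[/allP vC vf]; rewrite /chain (subseq_pairwise wv vf) andbT.
by apply/allP => x /(mem_subseq wv)/vC.
Qed.

(* The counts of the letters in pairs of chains with a given difference of sums form a set whose
   minimal elements determine all its values of [count v - count v'], by [chain_sum_inj]. *)
Lemma chain_counts n : exists B : nat, forall v v', chain v -> chain v' -> small n v v' ->
  forall x, (count_mem x v <= count_mem x v' + B)%N.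
Proof.
pose enc v v' := [ffun i : 'I_(size Phi) =>
  clip n (nth (fun=> 0) Phi i (\sum_(x <- v) x - \sum_(x <- v') x))].
pose cnt v v' := [ffun bi : bool * 'I_(size C) => count_mem (nth 0 C bi.2) (if bi.1 then v else v')].
pose P d : set {ffun bool * 'I_(size C) -> nat} :=
  [set p | exists v v', [/\ chain v, chain v', small n v v', enc v v' = d & p = cnt v v']].
have /choice[Bd BdP] : forall d, exists B : nat, forall v v', chain v -> chain v' -> small n v v' ->
    enc v v' = d -> forall x, x \in C -> (count_mem x v <= count_mem x v' + B)%N.
  move=> d; have [l [lP lm]] := dickson (P d).
  exists (\sum_(m <- l) \sum_bi m bi)%N => v v' vc vc' vv vd x xC.
  have [|m ml mle] := lm (cnt v v'); first by exists v, v'.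
  have [w [w' [wc wc' ww wd mE]]] := lP _ ml.
  have iC : (index x C < size C)%N by rewrite index_mem.
  have mB : (count_mem x w <= \sum_(m <- l) \sum_bi m bi)%N.
    rewrite (big_rem m)//= (bigD1 (true, Ordinal iC))//= {1}mE ffunE /= nth_index//.
    by rewrite -addnA leq_addr.
  have cle (b : bool) (z : A) : (count_mem z (if b then w else w') <= count_mem z (if b then v else v'))%N.
    have [zC|zC] := boolP (z \in C).
      have jC : (index z C < size C)%N by rewrite index_mem.
      by have := mle (b, Ordinal jC); rewrite mE !ffunE /= nth_index.
    have -> : count_mem z (if b then w else w') = 0%N; last by [].
    apply/count_memPn; case: b; apply: contra zC => zw.
      by move: wc => /andP[/allP/(_ _ zw)].
    by move: wc' => /andP[/allP/(_ _ zw)].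
  have split u z : chain z -> (forall y, (count_mem y u <= count_mem y z)%N) ->
      exists2 t, chain t & perm_eq (u ++ t) z.
    move=> zc /count_subseqP[s /subseqP[k ks ->] us]; exists (mask (map negb k) z).
      by apply: chain_subseq zc; apply: mask_subseq.
    by apply: perm_trans (perm_mask_negb ks); rewrite perm_cat2r.
  (* What remains of [v] and [v'] after removing the minimal pair are chains whose sums have equal
     functionals, hence one and the same chain. The counts in [v] and [v'] thus differ exactly as
     those in [w] and [w']. *)
  have [t tc tv] := split w v vc (cle true); have [t' tc' tv'] := split w' v' vc' (cle false).
  have tt' : t = t'.
    apply: chain_sum_inj => // f fP.
    have : f (\sum_(x <- v) x - \sum_(x <- v') x) = f (\sum_(x <- w) x - \sum_(x <- w') x).
      have jP : (index f Phi < size Phi)%N by rewrite index_mem.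
      have : enc v v' = enc w w' by rewrite vd wd.
      move=> /ffunP/(_ (Ordinal jP)); rewrite !ffunE /= nth_index//.
      by move=> /clip_inj; apply; [exact: vv|exact: ww].
    rewrite -(perm_big _ tv) -(perm_big _ tv') !big_cat /= !Phi_sub// !(PhiD fP).
    move: (f (\sum_(x <- w) x)) (f (\sum_(x <- w') x)) (f (\sum_(x <- t) x)) (f (\sum_(x <- t') x)).
    by clear; lia.
  have := permP tv (pred1 x); have := permP tv' (pred1 x); rewrite !count_cat tt' => <- <-.
  by move: mB; clear; lia.
exists (\sum_d Bd d)%N => v v' vc vc' vv x.
have [xC|xC] := boolP (x \in C); last first.
  have -> : count_mem x v = 0%N; last by [].
  apply/count_memPn; apply: contra xC => xv.
  by move: vc => /andP[/allP/(_ _ xv)].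
apply: leq_trans (BdP _ _ _ vc vc' vv erefl x xC) _.
by rewrite leq_add2l (bigD1 (enc v v'))//= leq_addr.
Qed.

(** Ranks do not increase along a chain, and letters of equal rank are equal. The multiplicity of
    [x] in the prefix of length [t] is therefore given by [t] and the numbers of letters of rank at
    least, and above, that of [x]. These numbers are nearly equal for both chains by
    [chain_counts]. *)
Lemma chain_prefix n : exists n' : nat, forall v v', chain v -> chain v' -> small n v v' ->
  forall t, small n' (take t v) (take t v').
Proof.
have [B BP] := chain_counts n.
pose D := undup C; pose Bm := (size D * B)%N.
have chD v : chain v -> {subset v <= D}.
  by move=> /andP[/allP vC _] x /vC; rewrite mem_undup.
have cntP (P : pred A) v v' : chain v -> chain v' -> small n v v' ->
    (count P v <= count P v' + Bm)%N.
  move=> vc vc' vv.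
  have cE w : chain w -> count P w = (\sum_(x <- D) P x * count_mem x w)%N.
    move=> wc; rewrite -sum1_count big_mkcond /=.
    rewrite (@big_count_mem _ nat D _ _ (undup_uniq _) (chD _ wc)); apply: eq_bigr => x _.
    by case: (P x); rewrite ?mul0n ?mul0rn// mul1n -mulr_natr mul1r natn.
  rewrite !cE// /Bm -sum1_size big_distrl /= -big_split /=; apply: leq_sum => x _.
  by case: (P x); rewrite ?mul0n ?mul1n//; exact: BP.
pose K := (\sum_(x <- D) \sum_(f <- Phi) absz (f x))%N.
pose B' := (Bm + Bm + B)%N.
have rankP v t r : chain v -> count (fun y => (r <= rank y)%N) (take t v) =
    minn t (count (fun y => (r <= rank y)%N) v).
  move=> /andP[_ vf]; apply: count_take_sorted; apply: sub_pairwise vf => x y /face_rank xy.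
  by apply/implyP => /leq_trans; apply.
have eqP v t x : chain v -> x \in v -> count_mem x (take t v) =
    (minn t (count (fun y => (rank x <= rank y)%N) v) - minn t (count (fun y => (rank x < rank y)%N) v))%N.
  move=> vc xv; rewrite -!rankP//.
  have -> : count (fun y => (rank x <= rank y)%N) (take t v) =
      (count (fun y => rank y == rank x) (take t v) + count (fun y => (rank x < rank y)%N) (take t v))%N.
    rewrite -count_predUI [X in (_ + X)%N](_ : _ = 0%N) ?addn0.
      by apply: eq_count => y /=; rewrite leq_eqVlt eq_sym.
    by apply/eqP; rewrite -leqn0 leqNgt -has_count; apply/hasPn => y _ /=; case: ltngtP.
  rewrite addnK; apply: eq_in_count => y /mem_take yv /=; apply/eqP/eqP => [->//|xy].
  have /andP[/allP vC vf] := vc; have yC := vC _ yv; have xC := vC _ xv.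
  have [//|h|h] := pairwise_mem vf yv xv.
    by apply: C_sim_eq => //; apply: face_rank_sim; rewrite ?xy.
  by apply: C_sim_eq => //; rewrite sim_sym; apply: face_rank_sim; rewrite ?xy.
have cnt v v' t x : chain v -> chain v' -> small n v v' ->
    (count_mem x (take t v) <= count_mem x (take t v') + B')%N.
  move=> vc vc' vv; have [xv|xv] := boolP (x \in v); last first.
    have -> : count_mem x (take t v) = 0%N; last by [].
    by apply/count_memPn; apply: contra xv => /mem_take.
  have [xv'|xv'] := boolP (x \in v'); last first.
    have h : (count_mem x (take t v) <= count_mem x v)%N.
      by rewrite -{2}(cat_take_drop t v) count_cat leq_addr.
    apply: leq_trans h _; apply: leq_trans (BP _ _ vc vc' vv x) _.
    by have /count_memPn -> := xv'; rewrite /B'; clear; lia.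
  rewrite !eqP//.
  have := cntP (fun y => (rank x <= rank y)%N) _ _ vc vc' vv.
  have := cntP (fun y => (rank x < rank y)%N) _ _ vc' vc (small_sym vv).
  have : (count (fun y => (rank x < rank y)%N) v' <= count (fun y => (rank x <= rank y)%N) v')%N.
    by apply: sub_count => y /ltnW.
  move: (count _ v) (count _ v) (count _ v') (count _ v') => a b c' d; rewrite /B'.
  by clear; lia.
exists (K * B')%N => v v' vc vc' vv t f fP.
have tD w : chain w -> {subset take t w <= D} by move=> wc x /mem_take; exact: chD.
rewrite Phi_sub// !Phi_sum// !(big_count_mem _ (undup_uniq _) (tD _ _))// -sumrB.
apply: le_trans (ler_norm_sum _ _ _) _; rewrite /K PoszM.
rewrite (big_morph _ PoszD (erefl _)) mulr_suml; rewrite !big_seq; apply: ler_sum => x xD.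
rewrite !pmulrn !mulrzz -mulrBr normrM; apply: ler_pM => //.
  by rewrite -abszE lez_nat (big_rem f)//= leq_addr.
have := cnt _ _ t x vc vc' vv; have := cnt _ _ t x vc' vc (small_sym vv).
by move: (count_mem x _) (count_mem x _) => a b; clear; lia.
Qed.

End InvariantCones.

(** * Quasi-geodesics of Fuchsian groups *)

Lemma word_length (G : groupType) : finitely_generated G -> exists len : G -> nat,
  [/\ len 1%g = 0%N, forall g h, (len (g * h)%g <= len g + len h)%N, forall g, len g^-1%g = len g,
      forall n : nat, exists l : seq G, forall g, (len g <= n)%N -> g \in l &
      forall g, exists s, [/\ all (fun x => len x <= 1)%N s, (\prod_(x <- s) x)%g = g & size s = len g]].
Proof.
move=> [S0 genS]; pose S := S0 ++ [seq g^-1%g | g <- S0].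
have SV g : g \in S -> (g^-1)%g \in S.
  rewrite !mem_cat => /orP[gS|/mapP[h hS ->]]; last by rewrite invgK hS.
  by rewrite map_f ?orbT.
pose W g n := exists u : seq G, [/\ all (mem S) u, (\prod_(x <- u) x)%g = g & size u = n].
have WM g h n m : W g n -> W h m -> W (g * h)%g (n + m)%N.
  move=> [u [uS <- <-]] [v [vS <- <-]]; exists (u ++ v).
  by rewrite all_cat uS vS big_cat size_cat.
have WV g n : W g n -> W g^-1%g n.
  move=> [u [uS <- <-]]; exists (rev [seq x^-1%g | x <- u]); split.
  - rewrite all_rev all_map; apply/allP => x /(allP uS); exact: SV.
  - elim: {uS} u => [|x u IH]; first by rewrite !big_nil invg1.
    by rewrite /= rev_cons -cats1 big_cat IH big_seq1 big_cons invgM.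
  - by rewrite size_rev size_map.
have W1 : W 1%g 0%N by exists [::]; rewrite big_nil.
have Wex g : exists n, `[< W g n >].
  suff WT : [set g | exists n, W g n] = setT.
    have [n Wn] : [set g | exists n, W g n] g by rewrite WT.
    by exists n; apply/asboolP.
  apply: genS.
    split=> [|g' h' [n gn] [m hm]]; first by exists 0%N.
    by exists (n + m)%N; apply: WM => //; exact: WV.
  move=> x xS; exists 1%N, [:: x]; rewrite big_seq1; split=> //=.
  by rewrite andbT mem_cat xS.
pose len g := ex_minn (Wex g); exists len.
have lenW g : W g (len g) by rewrite /len; case: ex_minnP => n /asboolP.
have len_le g n : W g n -> (len g <= n)%N.
  by move=> gn; rewrite /len; case: ex_minnP => m _; apply; exact/asboolP.
split.
- by apply/eqP; rewrite -leqn0 len_le.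
- by move=> g h; apply: len_le; exact: WM.
- by move=> g; apply/eqP; rewrite eqn_leq; apply/andP; split; [|rewrite -{1}(invgK g)]; apply/len_le/WV.
- elim=> [|n [l lP]].
    exists [:: 1%g] => g; rewrite leqn0 => /eqP g0; have [u [_ ug]] := lenW g.
    by rewrite g0 => /size0nil u0; rewrite -ug u0 big_nil mem_head.
  exists (l ++ [seq (x * y)%g | x <- S, y <- l]) => g gn; rewrite mem_cat.
  have [[|x u] [uS ug sz]] := lenW g.
    by rewrite lP // -sz.
  apply/orP; right; apply/allpairsP; exists (x, (\prod_(z <- u) z)%g); move/andP: uS => [xS uS]; split=> //=.
    apply: lP; apply: leq_trans (_ : size u <= n)%N; first by apply: len_le; exists u.
    by rewrite -ltnS; apply: leq_trans gn; rewrite -sz.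
  by rewrite -ug big_cons.
- move=> g; have [u [uS ug sz]] := lenW g; exists u; split=> //; apply/allP => x /(allP uS) xS.
  by apply: (len_le x 1%N); exists [:: x]; split; rewrite ?big_seq1 //= andbT.
Qed.

Section PathOfFunction.
Variables (T : Type) (f : nat -> T).

Definition trace n := mkseq (fun i => f i.+1) n.

Lemma size_trace n : size (trace n) = n. Proof. exact: size_mkseq. Qed.

Lemma last_trace n : last (f 0%N) (trace n) = f n.
Proof. by case: n => // n; rewrite /trace mkseqS last_rcons. Qed.

Lemma path_trace (r : rel T) n : (forall i, (i < n)%N -> r (f i) (f i.+1)) -> path r (f 0%N) (trace n).
Proof.
elim: n => // n IH h; rewrite /trace mkseqS rcons_path -/(trace n) IH ?last_trace ?h//.
by move=> i /ltnW; exact: h.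
Qed.

Lemma path_sum_trace (V : zmodType) (c : T -> T -> V) n :
  path_sum c (f 0%N) (trace n) = \sum_(0 <= i < n) c (f i) (f i.+1).
Proof.
elim: n => [|n IH]; first by rewrite big_geq.
by rewrite /trace mkseqS -cats1 path_sum_cat -/(trace n) IH last_trace big_nat_recr//= addr0.
Qed.

End PathOfFunction.

Lemma path_sum_rev (T : Type) (F : numDomainType) (r : rel T) (c : T -> T -> F) (K : F) x s :
  path r x s -> (forall a b, r a b -> `|c a b + c b a| <= K) ->
  `|path_sum c x s + path_sum c (last x s) (rev (belast x s))| <= K * (size s)%:R.
Proof.
move=> + cK; elim: s x => [|y s IH] x /=; first by rewrite addr0 normr0 mulr0.
move=> /andP[xy /IH{}IH]; rewrite rev_cons -cats1 path_sum_cat /= addr0.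
have -> : last (last y s) (rev (belast y s)) = y.
  by case: s {IH} => //= z s; rewrite rev_cons last_rcons.
have -> : c x y + path_sum c y s + (path_sum c (last y s) (rev (belast y s)) + c y x) =
  (c x y + c y x) + (path_sum c y s + path_sum c (last y s) (rev (belast y s))) by ring.
by rewrite -nat1r mulrDr mulr1 (le_trans (ler_normD _ _))// lerD// cK.
Qed.

(** The arithmetic of the contour in [geodesic_near_quasigeodesic]: sides of lengths [L], [n2],
    [n3], [n4] with integrals [u1], [u2], 0, [u4]. Filling bounds the total by about
    [kap * lam.+1 * L], while [u1] grows like [2 * k0 * L], and [k0] exceeds [kap * lam.+1]. *)
Lemma contour_bound (kap lam mu n2 n3 n4 L : nat) (u1 u2 u4 : int) : let k0 := (kap * lam.+1).+1 in
  `|u1 + (u2 + u4)| <= (kap * (L + (n2 + (n3 + n4))))%N%:Z -> (2 * k0 * L)%N%:Z <= u1 ->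
  - (2 * k0 * k0)%N%:Z <= u2 -> - (2 * k0 * k0)%N%:Z <= u4 ->
  (n3 <= lam * (L + k0 + k0) + mu)%N -> (n2 <= k0)%N -> (n4 <= k0)%N ->
  (L <= 4 * k0 * k0 + 2 * kap * k0 * lam.+1 + kap * mu)%N.
Proof.
move=> k0 H b1 b2 b4 n3L n2k n4k.
have {}H : (2 * k0 * L)%N%:Z - (2 * k0 * k0)%N%:Z - (2 * k0 * k0)%N%:Z <= (kap * (L + (n2 + (n3 + n4))))%N%:Z.
  move: H b1 b2 b4; clear; move: (2 * _ * _)%N (2 * _ * _)%N (kap * _)%N; lia.
have h1 : (kap * (L + (n2 + (n3 + n4))) <= kap * (L + (k0 + ((lam * (L + k0 + k0) + mu) + k0))))%N.
  by rewrite leq_mul2l; apply/orP; right; move: n3L n2k n4k; clear; lia.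
have h2 : (kap * (L + (k0 + ((lam * (L + k0 + k0) + mu) + k0))) =
   kap * lam.+1 * L + 2 * kap * k0 * lam.+1 + kap * mu)%N by rewrite mulnS; ring.
have h3 : (L <= k0 * L)%N by rewrite /k0 mulSn leq_addr.
have h4 : (2 * k0 * L = k0 * L + (kap * lam.+1 * L + L))%N by rewrite /k0; ring.
have h5 : (4 * k0 * k0 = 2 * k0 * k0 + 2 * k0 * k0)%N by ring.
rewrite h2 in h1; rewrite h4 in H; rewrite h5.
move: H h1 h3; clear.
move: (kap * lam.+1 * L)%N (k0 * L)%N (2 * k0 * k0)%N (2 * kap * k0 * lam.+1)%N (kap * mu)%N (kap * _)%N.
by lia.
Qed.

Section WordMetric.
Variables (G : groupType) (len : G -> nat).
Hypotheses (len1 : len 1%g = 0%N) (lenM : forall g h, (len (g * h)%g <= len g + len h)%N)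
  (lenV : forall g, len g^-1%g = len g)
  (len_word : forall g, exists s,
     [/\ all (fun x => len x <= 1)%N s, (\prod_(x <- s) x)%g = g & size s = len g]).

Definition wdist g h := len (g^-1 * h)%g.
Local Notation d := wdist.
Local Notation near := (fun g h => d g h <= 1)%N.

Lemma wdistxx g : d g g = 0%N. Proof. by rewrite /d mulVg. Qed.

Lemma wdistC g h : d g h = d h g.
Proof. by rewrite /d -lenV invgM invgK. Qed.

Lemma wdist_triangle h g k : (d g k <= d g h + d h k)%N.
Proof. by apply: leq_trans (lenM _ _); rewrite mulgA mulgK. Qed.

Lemma wdistM x g h : d (x * g)%g (x * h)%g = d g h.
Proof. by rewrite /d invgM -mulgA mulKg. Qed.

Lemma wdist_path (f : nat -> G) n : (forall i, (i < n)%N -> d (f i) (f i.+1) <= 1)%N ->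
  forall i j, (i <= j <= n)%N -> (d (f i) (f j) <= j - i)%N.
Proof.
move=> fn i j /andP[ij jn]; elim: j ij jn => [|j IH]; first by rewrite leqn0 => /eqP ->; rewrite wdistxx.
rewrite leq_eqVlt => /orP[/eqP<-|ij] jn; first by rewrite wdistxx.
apply: leq_trans (wdist_triangle (f j) _ _) _; rewrite subSn// -(addn1 (j - i)); apply: leq_add; last exact: fn.
exact: IH ij (ltnW jn).
Qed.

Definition geodesic (f : nat -> G) n :=
  (forall i, (i < n)%N -> d (f i) (f i.+1) <= 1)%N /\ (n <= d (f 0%N) (f n))%N.

Lemma geodesicP f n : geodesic f n -> forall i j, (i <= j <= n)%N -> d (f i) (f j) = (j - i)%N.
Proof.
move=> [fn n_le] i j ijn; apply/eqP; rewrite eqn_leq (wdist_path fn)//=.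
have := wdist_triangle (f i) (f 0%N) (f n); have := wdist_triangle (f j) (f i) (f n).
have := wdist_path fn (i := 0) (j := i); have := wdist_path fn (i := j) (j := n).
by move: n_le ijn; clear; lia.
Qed.

Lemma geodesic_exists g h : exists f, [/\ geodesic f (d g h), f 0%N = g & f (d g h) = h].
Proof.
have [s [sP sgh sz]] := len_word (g^-1 * h)%g.
exists (fun i => (g * \prod_(x <- take i s) x)%g); rewrite take0 big_nil mulg1 /d -sz take_size sgh.
rewrite mulVKg; split=> //; split=> [i il|]; last by rewrite take0 big_nil mulg1 take_size sgh mulVKg /d sz.
rewrite wdistM (take_nth 1%g)// -cats1 big_cat big_seq1 /d mulKg.
by apply: (allP sP); exact: mem_nth.
Qed.

Lemma geodesic_through x g y : (d x g + d g y = d x y)%N ->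
  exists f, [/\ geodesic f (d x y), f 0%N = x, f (d x g) = g & f (d x y) = y].
Proof.
have [f [[fn _] f0 fd]] := geodesic_exists x g; have [f' [[fn' _] f'0 fd']] := geodesic_exists g y.
move=> dE; pose F i := if (i <= d x g)%N then f i else f' (i - d x g)%N; exists F.
have F0 : F 0%N = x by rewrite /F leq0n.
have Fn : F (d x y) = y.
  rewrite /F; case: leqP => [h|_]; last by rewrite -dE addKn fd'.
  have e : d g y = 0%N by move: h dE; clear; lia.
  have -> : d x y = d x g by rewrite -dE e addn0.
  by rewrite fd -f'0 -[in RHS]fd' e.
split=> //; last by rewrite /F leqnn.
split; last by rewrite F0 Fn.
move=> i iy; rewrite /F; case: (ltngtP i (d x g)) => ig.
- exact: fn.
- rewrite subSn ?(ltnW ig)//; apply: fn'.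
  by rewrite -dE in iy; move: ig iy; clear; lia.
- by rewrite ig subSnn fd -f'0; apply: fn'; rewrite -dE ig in iy; move: iy; clear; lia.
Qed.

Variables (R : realType) (M C : nat).
Hypotheses (M_gt0 : (0 < M)%N) (filling : forall c : G -> G -> R,
    (forall g h k, (d g h <= M)%N -> (d h k <= M)%N -> (d g k <= M)%N ->
       `|c g h + c h k - c g k| <= 1) ->
    forall x s, path near x s -> last x s = x -> `|path_sum c x s| <= C%:R * (size s)%:R).

Definition defect_le (D : nat) (c : G -> G -> int) := forall g h k,
  (d g h <= M)%N -> (d h k <= M)%N -> (d g k <= M)%N -> `|c g h + c h k - c g k| <= D%:Z.

Lemma filling_int D c : defect_le D c -> forall x s, path near x s -> last x s = x ->
  `|path_sum c x s| <= (C * D.+1 * size s)%N%:Z.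
Proof.
move=> cD x s xs sx; have D0 : 0 < D.+1%:R :> R by rewrite ltr0n.
(* The cochain is normalized by [D.+1], which is nonzero also for [D = 0]. *)
have := filling (c := fun g h => (c g h)%:~R / D.+1%:R) _ xs sx.
have -> : path_sum (fun g h => (c g h)%:~R / D.+1%:R) x s = (path_sum c x s)%:~R / D.+1%:R :> R.
  by rewrite (raddf_path_sum (h := fun z : int => z%:~R / D.+1%:R : R)) ?mul0r// => u v; rewrite rmorphD mulrDl.
rewrite normrM normfV (ger0_norm (ltW D0)) ler_pdivrMr//.
move=> H; have {}H : `|(path_sum c x s)%:~R| <= C%:R * (size s)%:R * D.+1%:R :> R.
  apply: H => g h k gh hk gk; rewrite -mulrDl -mulrBl normrM normfV (ger0_norm (ltW D0)) ler_pdivrMr// mul1r.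
  rewrite -rmorphD -rmorphB /= -intr_norm -[D.+1%:R]/(D.+1%:~R) ler_int.
  by apply: le_trans (cD _ _ _ gh hk gk) _; rewrite lez_nat.
move: H; rewrite -intr_norm -!natrM -[(_ * _)%:R]/((C * size s * D.+1)%N%:~R) ler_int => /le_trans; apply.
by rewrite lez_nat mulnAC.
Qed.

Lemma defect_antisym D c : defect_le D c -> forall g h, (d g h <= 1)%N -> `|c g h + c h g| <= (D + D)%N%:Z.
Proof.
move=> cD g h gh; have gM : (d g h <= M)%N by exact: leq_trans M_gt0.
have := cD g h g gM; rewrite wdistC wdistxx => /(_ gM (leq0n _)).
have := cD g g g; rewrite wdistxx => /(_ (leq0n _) (leq0n _) (leq0n _)).
by move: (c g h) (c h g) (c g g); clear; lia.
Qed.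

(** Close [s] up by the reverse of [s']. Reversing an edge costs at most [D + D], which the two
    extra units in [C.+2] absorb. *)
Lemma path_sum_compare D c : defect_le D c -> forall x s s', path near x s -> path near x s' ->
  last x s = last x s' ->
  `|path_sum c x s - path_sum c x s'| <= (C.+2 * D.+1 * (size s + size s'))%N%:Z.
Proof.
move=> cD x s s' xs xs' ss; pose t := rev (belast x s').
have xt : path near (last x s') t.
  by rewrite rev_path; apply: sub_path xs' => g h; rewrite wdistC.
have tx : last (last x s') t = x.
  by rewrite /t; case: (s') => //= z ?; rewrite rev_cons last_rcons.
have := filling_int cD (_ : path near x (s ++ t)); rewrite cat_path last_cat xs ss xt tx => /(_ isT erefl).
rewrite path_sum_cat size_cat size_rev size_belast ss.
have := path_sum_rev xs' (defect_antisym cD).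
rewrite -/t natz -PoszM !mulnDr; have : (C.+2 * D.+1 = C * D.+1 + (D + D).+2)%N by clear; lia.
move=> ->; rewrite !mulnDl; move: (C * D.+1 * _)%N (C * D.+1 * _)%N => p q.
move: (path_sum _ _ _) (path_sum _ _ _) (path_sum _ _ _) (size s) (size s'); clear.
by move=> u v w a b; nia.
Qed.

(** This is twice the trapezoidal form of [F dpsi]. Its coboundary is a difference of products of
    increments, a discrete [dF] wedge [dpsi], so it is bounded although [F] is not. *)
Lemma mul_diff_defect D (F psi : G -> int) : (forall g h, (d g h <= M)%N -> `|F g - F h| <= D%:Z) ->
  (forall g h, (d g h <= M)%N -> `|psi g - psi h| <= D%:Z) ->
  defect_le (2 * D * D) (fun g h => (F g + F h) * (psi h - psi g)).
Proof.
move=> FD pD g h k gh hk gk.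
have -> : (F g + F h) * (psi h - psi g) + (F h + F k) * (psi k - psi h) - (F g + F k) * (psi k - psi g) =
   (F g - F k) * (psi h - psi k) - (F h - F k) * (psi g - psi k) by ring.
apply: le_trans (ler_normB _ _) _; rewrite !normrM -mulnA mul2n -addnn PoszD.
by apply: lerD; rewrite PoszM; apply: ler_pM => //; auto.
Qed.

(* The contour integral of [F * psi'], with [F] the distance to the quasi-geodesic and [psi] the
   distance to its endpoint, is at least the length of an excursion times its height, while by the
   filling inequality it is linear in the length of the contour. *)
Lemma geodesic_near_quasigeodesic (lam mu : nat) : exists k : nat, forall (f p : nat -> G) n m,
  geodesic f n -> (forall i, (i < m)%N -> d (p i) (p i.+1) <= 1)%N ->
  (forall i j, (i <= j <= m)%N -> (j - i <= lam * d (p i) (p j) + mu)%N) ->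
  (d (f 0%N) (p 0%N) <= 1)%N -> (d (f n) (p m) <= 1)%N ->
  forall t, (t <= n)%N -> exists2 i, (i <= m)%N & (d (f t) (p i) <= k)%N.
Proof.
(* [kap] is the filling constant for the cochain [c] below: [F] and [psi] vary by at most [M] over a
   distance [M]. *)
pose kap := (C * (2 * M * M).+1)%N; pose k0 := (kap * lam.+1).+1.
exists (k0 + (4 * k0 * k0 + 2 * kap * k0 * lam.+1 + kap * mu))%N => f p n m fg pm pq fp0 fpn t tn.
pose near_p g := [arg min_(i < ord0 : 'I_m.+1) d g (p i)].
pose F g := d g (p (near_p g)).
have Fle g i : (i <= m)%N -> (F g <= d g (p i))%N.
  move=> im; rewrite /F /near_p; case: arg_minnP => // j _ /(_ (Ordinal (im : (i < m.+1)%N)) isT).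
  exact.
have FL g h : (F g <= d g h + F h)%N.
  by apply: leq_trans (Fle g (near_p h) _) (wdist_triangle _ _ _); rewrite -ltnS ltn_ord.
have [small|big] := leqP (F (f t)) k0.
  by exists (near_p (f t)); [rewrite -ltnS ltn_ord|apply: leq_trans small _; exact: leq_addr].
pose low i := (F (f i) <= k0)%N.
have low0 : low 0%N by apply: leq_trans (Fle _ 0%N (leq0n _)) _; apply: leq_trans fp0 _.
have lown : low n by apply: leq_trans (Fle _ m (leqnn _)) _; apply: leq_trans fpn _.
(* The excursion around [t]: [a] is the last time before [t], and [b] the first after it, at which
   the geodesic is within [k0] of [p]. *)
have [a [al at_ amax]] : exists a, [/\ low a, (a < t)%N & forall i, (a < i <= t)%N -> ~~ low i].
  have ex : exists i, (i <= t)%N && low i by exists 0%N.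
  have ub i : (i <= t)%N && low i -> (i <= t)%N by move=> /andP[].
  case: (ex_maxnP ex ub) => a /andP[aT al] amax; exists a; split=> //.
    by rewrite ltn_neqAle aT andbT; apply: contraTneq al => ->; rewrite /low -ltnNge.
  by move=> i /andP[ai it]; apply/negP => il; have := amax i; rewrite it il leqNgt ai => /(_ isT).
have [b [bl tb bn bmin]] : exists b, [/\ low b, (t < b)%N, (b <= n)%N & forall i, (t <= i < b)%N -> ~~ low i].
  have ex : exists i, (t <= i)%N && low i by exists n; rewrite tn.
  case: (ex_minnP ex) => b /andP[tb bl] bmin; exists b; split=> //.
  - by rewrite ltn_neqAle tb andbT; apply: contraTneq bl => <-; rewrite /low -ltnNge.
  - by apply: bmin; rewrite tn.
  - by move=> i /andP[ti ib]; apply/negP => il; have := bmin i; rewrite ti il leqNgt ib => /(_ isT).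
have fd := geodesicP fg.
have high i : (a <= i <= b)%N -> (k0 <= F (f i))%N.
  move=> /andP[ai ib].
  have mid j : (a < j < b)%N -> (k0 < F (f j))%N.
    move=> /andP[aj jb]; rewrite ltnNge; case: (leqP j t) => jt; first by apply: amax; rewrite aj.
    by apply: bmin; rewrite jb ltnW.
  have [ia|ia] := eqVneq i a.
    have := mid a.+1; rewrite ltnSn (leq_ltn_trans at_ tb) ia => /(_ isT).
    have := FL (f a.+1) (f a); rewrite wdistC fd; last by rewrite leqnSn (leq_trans at_ tn).
    by clear; lia.
  have [ib'|ib'] := eqVneq i b.
    have b0 : b = b.-1.+1 by rewrite prednK// (leq_trans _ tb).
    rewrite ib'; have := mid b.-1; have := FL (f b.-1) (f b); rewrite fd; last by rewrite leq_pred.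
    by move: b0 at_ tb; clear; lia.
  by apply: ltnW; apply: mid; move: ai ib ia ib'; clear; lia.
pose psi g := d (f a) g.
have psiL g h : (psi h <= psi g + d g h)%N by exact: wdist_triangle.
pose c g h := ((F g)%:Z + (F h)%:Z) * ((psi h)%:Z - (psi g)%:Z).
have cD : defect_le (2 * M * M) c.
  apply: mul_diff_defect => g h gh.
    by have := FL g h; have := FL h g; rewrite (wdistC h g); move: gh; clear; lia.
  by have := psiL g h; have := psiL h g; rewrite (wdistC h g); move: gh; clear; lia.
pose L := (b - a)%N; pose f1 i := f (a + i)%N.
have ab : (a < b)%N by exact: ltn_trans tb.
have f1L : f1 L = f b by rewrite /f1 subnKC// ltnW.
pose sa := nat_of_ord (near_p (f a)); pose sb := nat_of_ord (near_p (f b)).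
have sam : (sa <= m)%N by rewrite -ltnS ltn_ord.
have sbm : (sb <= m)%N by rewrite -ltnS ltn_ord.
have [f2 [f2g f20 f2e]] := geodesic_exists (f b) (p sb).
have [f4 [f4g f40 f4e]] := geodesic_exists (p sa) (f a).
have [f3 [n3 [f30 f3e f3n f3s f3F]]] : exists (f3 : nat -> G) (n3 : nat),
    [/\ f3 0%N = p sb, f3 n3 = p sa, (n3 <= lam * d (p sa) (p sb) + mu)%N,
      (forall i, (i < n3)%N -> d (f3 i) (f3 i.+1) <= 1)%N & forall i, (i <= n3)%N -> F (f3 i) = 0%N].
  have F0 i : (i <= m)%N -> F (p i) = 0%N.
    by move=> im; apply/eqP; rewrite -leqn0; have := Fle (p i) i im; rewrite wdistxx.
  have [sab|sba] := leqP sa sb.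
    exists (fun i => p (sb - i)%N), (sb - sa)%N; split.
    - by rewrite subn0.
    - by rewrite subKn.
    - by apply: pq; rewrite sab.
    - move=> i ii; rewrite wdistC; have -> : (sb - i = (sb - i.+1).+1)%N by move: ii; clear; lia.
      by apply: pm; move: ii sbm; clear; lia.
    - by move=> i ii; apply: F0; move: sbm; clear; lia.
  exists (fun i => p (sb + i)%N), (sa - sb)%N; split.
  - by rewrite addn0.
  - by rewrite subnKC// ltnW.
  - by rewrite wdistC; apply: pq; rewrite (ltnW sba).
  - by move=> i ii; rewrite addnS; apply: pm; move: ii sam; clear; lia.
  - by move=> i ii; apply: F0; move: ii sam sba; clear; lia.
pose n2 := d (f b) (p sb); pose n4 := d (p sa) (f a).
have n2k : (n2 <= k0)%N by exact: bl.
have n4k : (n4 <= k0)%N by rewrite /n4 wdistC; exact: al.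
have f1s i : (i < L)%N -> (d (f1 i) (f1 i.+1) <= 1)%N.
  by move=> iL; rewrite /f1 addnS; apply: fg.1; move: iL bn; rewrite /L; clear; lia.
(* The contour runs along the excursion, down to [p], back along [p], and up again. On the first
   side [psi] grows by exactly 1 per step and [F >= k0]; on the third [F] vanishes; the other two
   are shorter than or equal to [k0] and have [F <= k0]. *)
pose s := trace f1 L ++ trace f2 n2 ++ trace f3 n3 ++ trace f4 n4.
have xs : path near (f1 0%N) s.
  rewrite !cat_path path_trace//= last_trace f1L -f20 path_trace/=; last exact: f2g.1.
  rewrite last_trace f2e -f30 path_trace//= last_trace f3e -f40 path_trace//; exact: f4g.1.
have f1a : f1 0%N = f a by rewrite /f1 addn0.
have sx : last (f1 0%N) s = f1 0%N.
  by rewrite !last_cat last_trace f1L -f20 last_trace f2e -f30 last_trace f3e -f40 last_trace f4e f1a.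
have := filling_int cD xs sx.
rewrite !path_sum_cat last_trace f1L -f20 last_trace f2e -f30 last_trace f3e -f40 !path_sum_trace.
rewrite !size_cat !size_trace -/kap.
have b1 : (2 * k0 * L)%N%:Z <= \sum_(0 <= i < L) c (f1 i) (f1 i.+1).
  have -> : (2 * k0 * L)%N%:Z = \sum_(0 <= i < L) (2 * k0)%N%:Z.
    by rewrite sumr_const_nat subn0 pmulrn mulrzz PoszM.
  rewrite !big_nat; apply: ler_sum => i /andP[_ iL]; rewrite /c /psi.
  have -> : d (f a) (f1 i) = i.
    by rewrite /f1 fd ?addKn//; move: iL bn; rewrite /L; clear; lia.
  have -> : d (f a) (f1 i.+1) = i.+1.
    by rewrite /f1 fd ?addKn//; move: iL bn; rewrite /L; clear; lia.
  have := high (a + i)%N; have := high (a + i.+1)%N; rewrite -/(f1 i) -/(f1 i.+1).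
  move: (F _) (F _); move: iL ab; rewrite /L; clear; move: k0 => k0; nia.
have bnd (h : nat -> G) l : (l <= k0)%N -> (forall i, (i < l)%N -> d (h i) (h i.+1) <= 1)%N ->
    (forall i, (i <= l)%N -> F (h i) <= k0)%N ->
    `|\sum_(0 <= i < l) c (h i) (h i.+1)| <= (2 * k0 * k0)%N%:Z.
  move=> lk hs hF; apply: le_trans (ler_norm_sum _ _ _) _.
  apply: (@le_trans _ _ (\sum_(0 <= i < l) (2 * k0)%N%:Z)); last first.
    by rewrite sumr_const_nat subn0 pmulrn mulrzz -PoszM lez_nat leq_mul2l lk orbT.
  rewrite !big_nat; apply: ler_sum => i /andP[_ il]; rewrite normrM.
  have := hF i (ltnW il); have := hF _ il; have := hs i il.
  have := psiL (h i) (h i.+1); have := psiL (h i.+1) (h i); rewrite (wdistC (h i.+1)).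
  move: (F _) (F _) (psi _) (psi _) (d _ _) => x y z w e; clear; move: k0 => k0 h1 h2 h3 h4 h5.
  have h6 : `|w%:Z - z%:Z| <= 1 by move: h1 h2 h3; clear; lia.
  by rewrite -[(2 * k0)%N%:Z]mulr1; apply: ler_pM => //; move: h4 h5 h6; clear; lia.
have b2 : `|\sum_(0 <= i < n2) c (f2 i) (f2 i.+1)| <= (2 * k0 * k0)%N%:Z.
  apply: bnd => //; first exact: f2g.1.
  move=> i il; apply: leq_trans (Fle _ sb sbm) _; apply: leq_trans n2k.
  by rewrite -f2e (geodesicP f2g) ?leq_subr// il leqnn.
have b4 : `|\sum_(0 <= i < n4) c (f4 i) (f4 i.+1)| <= (2 * k0 * k0)%N%:Z.
  apply: bnd => //; first exact: f4g.1.
  move=> i il; apply: leq_trans (Fle _ sa sam) _; apply: leq_trans n4k.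
  by rewrite -f40 wdistC (geodesicP f4g) ?subn0.
have -> : \sum_(0 <= i < n3) c (f3 i) (f3 i.+1) = 0.
  by rewrite big_nat big1// => i /andP[_ il]; rewrite /c !f3F ?mul0r// ltnW.
have n3L : (n3 <= lam * (L + k0 + k0) + mu)%N.
  apply: leq_trans f3n _; rewrite leq_add2r leq_mul2l; apply/orP; right.
  have := wdist_triangle (f a) (p sa) (p sb); have := wdist_triangle (f b) (f a) (p sb).
  rewrite fd; last by rewrite (ltnW ab).
  by move: n2k n4k; rewrite /n2 /n4 /L; clear; lia.
have LL : (L <= 4 * k0 * k0 + 2 * kap * k0 * lam.+1 + kap * mu ->
  exists2 i, (i <= m)%N & (d (f t) (p i) <= k0 + (4 * k0 * k0 + 2 * kap * k0 * lam.+1 + kap * mu))%N)%N.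
  move=> LL; exists (near_p (f t)); first by rewrite -ltnS ltn_ord.
  apply: leq_trans (FL _ (f a)) _; rewrite addnC; apply: leq_add; first exact: al.
  apply: leq_trans LL; rewrite wdistC fd; first by rewrite /L leq_sub2r// ltnW.
  by rewrite tn ltnW.
move=> H; apply: LL.
have {b2}b2 : - (2 * k0 * k0)%N%:Z <= \sum_(0 <= i < n2) c (f2 i) (f2 i.+1).
  by move: b2; rewrite ler_norml => /andP[].
have {b4}b4 : - (2 * k0 * k0)%N%:Z <= \sum_(0 <= i < n4) c (f4 i) (f4 i.+1).
  by move: b4; rewrite ler_norml => /andP[].
by move: H b1 b2 b4 n3L n2k n4k; rewrite add0r; exact: contour_bound.
Qed.

End WordMetric.

Local Notation "\gprod u" := (\prod_(x <- u) x)%g (at level 10, u at level 9).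

(** * Central paths in the extension *)

Lemma nat_bound (T : eqType) (s : seq T) (f : T -> nat) :
  exists D : nat, forall x, x \in s -> (f x <= D)%N.
Proof. by exists (\sum_(x <- s) f x)%N => x xs; rewrite (big_rem x)//= leq_addr. Qed.

Lemma minimizer (T : Type) (f : T -> nat) (x0 : T) : exists x, forall y, (f x <= f y)%N.
Proof.
have ex : exists n, `[< exists x, f x = n >] by exists (f x0); apply/asboolP; exists x0.
case: (ex_minnP ex) => n /asboolP[x fx] nmin; exists x => y; rewrite fx.
by apply: nmin; apply/asboolP; exists y.
Qed.

Section Extension.
Variables (A : zmodType) (E G : groupType) (iota : A -> E) (pi : {multiplicative E -> G}).
Hypothesis ext : group_extension iota pi.
Implicit Types (a b : A) (e : E) (g h : G).

Lemma iotaD a b : iota (a + b) = (iota a * iota b)%g.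
Proof. by case: ext => + _ _ _; exact. Qed.

Lemma iota0 : iota 0 = 1%g.
Proof. by apply: (mulgI (iota 0)); rewrite -iotaD addr0 mulg1. Qed.

Lemma iotaN a : iota (- a) = (iota a)^-1%g.
Proof. by apply: (mulgI (iota a)); rewrite -iotaD subrr iota0 mulgV. Qed.

Lemma iota_inj : injective iota. Proof. by case: ext. Qed.

Lemma ext_proj1 : pi 1%g = 1%g.
Proof. by apply: (mulgI (pi 1%g)); rewrite -gmulfM !mulg1. Qed.

Lemma ext_projV e : pi e^-1%g = (pi e)^-1%g.
Proof. by apply: (mulgI (pi e)); rewrite -gmulfM !mulgV ext_proj1. Qed.

Lemma ext_proj_prod (u : seq E) : pi (\gprod u) = \gprod [seq pi e | e <- u].
Proof. by elim: u => [|e u IH]; rewrite ?big_nil ?ext_proj1//= !big_cons gmulfM IH. Qed.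

Lemma ext_proj_iota a : pi (iota a) = 1%g.
Proof.
by case: ext => _ _ /(congr1 (@^~ (iota a))) /= <- _; exists a.
Qed.

Definition iota_inv e : A := xget 0 [set a | iota a = e].

Lemma iota_invK e : pi e = 1%g -> iota (iota_inv e) = e.
Proof.
move=> e1; apply: (@xgetPex _ 0 [set a | iota a = e]).
have [_ _ /(congr1 (@^~ e)) /= h _] := ext.
have [a _ <-] : range iota e by rewrite /= h.
by exists a.
Qed.

Lemma iotaK a : iota_inv (iota a) = a.
Proof. by apply: iota_inj; rewrite iota_invK// ext_proj_iota. Qed.

Lemma iota_invM e f : pi e = 1%g -> pi f = 1%g -> iota_inv (e * f)%g = iota_inv e + iota_inv f.
Proof. by move=> e1 f1; apply: iota_inj; rewrite iotaD !iota_invK// gmulfM e1 f1 mulg1. Qed.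

Definition section_of g : E := if g == 1%g then 1%g else xget 1%g [set e | pi e = g].
Local Notation sigma := section_of.

Lemma section1 : sigma 1%g = 1%g. Proof. by rewrite /section_of eqxx. Qed.

Lemma sectionK g : pi (sigma g) = g.
Proof.
rewrite /section_of; case: eqP => [->|_]; first exact: ext_proj1.
apply: (@xgetPex _ 1%g [set e | pi e = g]).
have [_ _ _ h] := ext; have [e _ <-] : range pi g by rewrite h.
by exists e.
Qed.

Definition ext_act e a : A := iota_inv (e * iota a * e^-1)%g.
Local Notation act := ext_act.

Lemma iota_act e a : iota (act e a) = (e * iota a * e^-1)%g.
Proof. by rewrite iota_invK// !gmulfM ext_proj_iota mulg1 ext_projV mulgV. Qed.

Lemma iotaJ e a : (iota a * e = e * iota (act e^-1%g a))%g.
Proof. by rewrite iota_act invgK !mulgA mulgV mul1g. Qed.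

Lemma ext_actD e : {morph act e : a b / a + b}.
Proof. by move=> a b; apply: iota_inj; rewrite !(iotaD, iota_act) !mulgA mulgVK. Qed.

Lemma ext_act1 : act 1%g = id.
Proof. by apply/funext => a; apply: iota_inj; rewrite iota_act mul1g invg1 mulg1. Qed.

Lemma ext_actM e f a : act (e * f)%g a = act e (act f a).
Proof. by apply: iota_inj; rewrite !iota_act invgM !mulgA. Qed.

Lemma ext_act_iota b a : act (iota b) a = a.
Proof. by apply: iota_inj; rewrite iota_act -iotaD -iotaN -iotaD addrC addKr. Qed.

Lemma ext_act_proj e f : pi e = pi f -> act e = act f.
Proof.
move=> ef; have k : pi (e^-1 * f)%g = 1%g by rewrite gmulfM ext_projV ef mulVg.
apply/funext => a; rewrite -[f](mulVKg e) ext_actM -(iota_invK k) ext_act_iota //.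
Qed.

Lemma ext_act_fin : virtually_central iota pi ->
  exists es : seq E, forall e, exists2 f, f \in es & act e = act f.
Proof.
move=> /finite_seqP[s sE]; exists [seq xget 1%g [set e | act e = al] | al <- s] => e.
exists (xget 1%g [set f | act f = act e]).
  apply: map_f; have : [set` s] (act e); last by [].
  rewrite -sE; exists (pi e) => f a fe; rewrite -(ext_act_proj fe); exact: iota_act.
by symmetry; apply: (@xgetPex _ 1%g [set f | act f = act e]); exists e.
Qed.

Definition word_lift (u : seq G) : E := (\prod_(x <- u) sigma x)%g.

Lemma word_lift_cat u v : word_lift (u ++ v) = (word_lift u * word_lift v)%g.
Proof. exact: big_cat. Qed.

Lemma word_liftK u : pi (word_lift u) = \gprod u.
Proof.
rewrite /word_lift; elim: u => [|x u IH]; first by rewrite !big_nil ext_proj1.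
by rewrite !big_cons gmulfM IH sectionK.
Qed.

(** A cochain on pairs of vertices: the element of [A] by which following the lifted edge from
    [sigma g] misses [sigma h]. *)
Definition cocycle g h : A := iota_inv (sigma g * sigma (g^-1 * h) * (sigma h)^-1)%g.

Lemma iota_cocycle g h : iota (cocycle g h) = (sigma g * sigma (g^-1 * h) * (sigma h)^-1)%g.
Proof. by rewrite iota_invK// !gmulfM ext_projV !sectionK mulVKg mulgV. Qed.

Definition section_defect x y : A := iota_inv (sigma x * sigma y * (sigma (x * y))^-1)%g.

(** Up to the action, the coboundary depends only on the two steps. Since [Phi] is finite and
    invariant, its functionals are bounded on short triangles, so the filling inequality applies. *)
Lemma cocycle_defect g h k :
  cocycle g h + cocycle h k - cocycle g k = act (sigma g) (section_defect (g^-1 * h) (h^-1 * k)).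
Proof.
apply: iota_inj; rewrite iota_act /section_defect iota_invK; last first.
  by rewrite !gmulfM ext_projV !sectionK mulgV.
by rewrite !iotaD iotaN !iota_cocycle !invgM !invgK !mulgA mulgK mulgVK mulgVK.
Qed.

Lemma word_lift_cocycle g u : (sigma g * word_lift u =
  iota (path_sum cocycle g (scanl *%g g u)) * sigma (g * \gprod u))%g.
Proof.
elim: u g => [|x u IH] g /=; first by rewrite /word_lift !big_nil iota0 !mulg1 mul1g.
rewrite iotaD big_cons [(g * (x * _))%g]mulgA -[RHS]mulgA -IH [word_lift _]big_cons !mulgA.
by rewrite iota_cocycle mulgVK mulKg.
Qed.

Variable len : G -> nat.
Hypotheses (len1 : len 1%g = 0%N) (lenM : forall g h, (len (g * h)%g <= len g + len h)%N)
  (lenV : forall g, len g^-1%g = len g)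
  (len_fin : forall n : nat, exists l : seq G, forall g, (len g <= n)%N -> g \in l)
  (len_word : forall g, exists s,
     [/\ all (fun x => len x <= 1)%N s, (\prod_(x <- s) x)%g = g & size s = len g]).
Local Notation d := (wdist len).
Local Notation near := (fun g h => d g h <= 1)%N.
Local Notation letters := (all (fun x => len x <= 1)%N).

Lemma path_scanl g u : letters u -> path near g (scanl *%g g u).
Proof. by elim: u g => //= x u IH g /andP[x1 /IH ->]; rewrite /wdist mulKg x1. Qed.

Lemma last_scanl g u : last g (scanl *%g g u) = (g * \gprod u)%g.
Proof. by elim: u g => [|x u IH] g /=; rewrite ?big_nil ?mulg1// IH big_cons mulgA. Qed.

Lemma len_gprod u : letters u -> (len (\gprod u) <= size u)%N.
Proof.
elim: u => [|x u IH] /=; first by rewrite big_nil len1.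
by move=> /andP[x1 /IH u1]; rewrite big_cons; apply: leq_trans (lenM _ _) (leq_add x1 u1).
Qed.

Variables (R : realType) (M C : nat).
Hypotheses (M_gt0 : (0 < M)%N) (filling : forall c : G -> G -> R,
    (forall g h k, (d g h <= M)%N -> (d h k <= M)%N -> (d g k <= M)%N ->
       `|c g h + c h k - c g k| <= 1) ->
    forall x s, path near x s -> last x s = x -> `|path_sum c x s| <= C%:R * (size s)%:R).
Variables (Phi : seq (A -> int)) (BB : seq A).
Hypotheses (PhiD : forall f, f \in Phi -> {morph f : a b / a + b})
  (Phi0 : (fun=> 0) \in Phi) (Phi_act : forall f e, f \in Phi -> f \o act e \in Phi)
  (PhiP : forall e, perm_eq [seq f \o act e | f <- Phi] Phi)
  (BB_act : forall e b, b \in BB -> act e b \in BB)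
  (BB_fin : forall n : nat, exists l : seq A, forall a,
    (forall b, b \in BB -> `|pairing Phi a b| <= n%:Z) -> a \in l).
Implicit Types (phi : A -> int) (u v : seq G).

Let Phi_0 phi : phi \in Phi -> phi 0 = 0. Proof. exact: (Phi_zero PhiD). Qed.
Let Phi_N phi a : phi \in Phi -> phi (- a) = - phi a. Proof. exact: (Phi_opp PhiD). Qed.

(** Both lifts are an element of [A] times the same [sigma (\gprod u)], and that element is the sum
    of the cocycle along the path of the word. Moving it past the section twists [phi] into another
    member [psi] of [Phi]. *)
Lemma word_lift_compare : exists C1 : nat, forall phi u u', phi \in Phi ->
  letters u -> letters u' -> \gprod u = \gprod u' ->
  `|phi (iota_inv ((word_lift u')^-1 * word_lift u)%g)| <= (C1 * (size u + size u'))%N%:Z.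
Proof.
have [l lP] := len_fin M.
have [D DP] := nat_bound [seq (phi, xy) | phi <- Phi, xy <- [seq (x, y) | x <- l, y <- l]]
  (fun p => absz (p.1 (section_defect p.2.1 p.2.2))).
have cD phi : phi \in Phi -> defect_le len M D (fun g h => phi (cocycle g h)).
  move=> fP g h k gh hk gk; rewrite -Phi_N// -!(PhiD fP) cocycle_defect.
  rewrite -abszE lez_nat; apply: (DP (phi \o act (sigma g), (g^-1 * h, h^-1 * k))%g).
  apply/allpairsP; exists (phi \o act (sigma g), (g^-1 * h, h^-1 * k))%g; split=> //=; first exact: Phi_act.
  apply/allpairsP; exists (g^-1 * h, h^-1 * k)%g; split=> //=; exact: lP.
exists (C.+2 * D.+1)%N => phi u u' fP ul ul' uu'.
pose a w := path_sum cocycle 1%g (scanl *%g 1%g w).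
have wE w : word_lift w = (iota (a w) * sigma (\gprod w))%g.
  by rewrite -[LHS]mul1g -section1 word_lift_cocycle mul1g.
set g := sigma (\gprod u); pose psi := phi \o act g^-1%g.
have psiP : psi \in Phi by exact: Phi_act.
have -> : iota_inv ((word_lift u')^-1 * word_lift u)%g = act g^-1%g (a u - a u').
  rewrite !wE -uu' -/g invgM !mulgA -iotaN -[(g^-1 * _ * _)%g]mulgA -iotaD addrC.
  by rewrite -{2}[g]invgK -iota_act iotaK.
have psiS w : psi (a w) = path_sum (fun g h => psi (cocycle g h)) 1%g (scanl *%g 1%g w).
  by rewrite /a (raddf_path_sum (h := psi) _ _ _ (PhiD psiP) (Phi_0 psiP)).
have -> : phi (act g^-1%g (a u - a u')) = psi (a u) - psi (a u').
  by rewrite -[LHS]/(psi _) (PhiD psiP) Phi_N.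
rewrite !psiS -(size_scanl *%g 1%g u) -(size_scanl *%g 1%g u').
apply: (path_sum_compare len1 lenV M_gt0 filling (cD _ psiP)).
- exact: path_scanl.
- exact: path_scanl.
- by rewrite !last_scanl uu'.
Qed.

(** * Costs of words and their minima *)

Variable C1 : nat.
Hypothesis compare : forall phi u u', phi \in Phi ->
  letters u -> letters u' -> \gprod u = \gprod u' ->
  `|phi (iota_inv ((word_lift u')^-1 * word_lift u)%g)| <= (C1 * (size u + size u'))%N%:Z.

(* [C1.+1 > C1] keeps the cost bounded below, and makes the words of minimal cost quasi-geodesic. *)
Definition cost phi u e : int := phi (iota_inv ((word_lift u)^-1 * e)%g) + (C1.+1 * size u)%N%:Z.
Definition represents u e := letters u && (\gprod u == pi e).

Lemma represents_kernel u e : represents u e -> pi ((word_lift u)^-1 * e)%g = 1%g.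
Proof. by move=> /andP[_ /eqP ue]; rewrite gmulfM ext_projV word_liftK ue mulVg. Qed.

Lemma represented e : exists2 u, represents u e & size u = len (pi e).
Proof. by have [u [ul ue sz]] := len_word (pi e); exists u; rewrite // /represents ul ue eqxx. Qed.

Lemma cost_diff phi u u' e : phi \in Phi -> represents u e -> represents u' e ->
  cost phi u' e - cost phi u e = phi (iota_inv ((word_lift u')^-1 * word_lift u)%g) +
    (C1.+1 * size u')%N%:Z - (C1.+1 * size u)%N%:Z.
Proof.
move=> fP ue ue'; rewrite /cost.
have -> : ((word_lift u')^-1 * e = ((word_lift u')^-1 * word_lift u) * ((word_lift u)^-1 * e))%g.
  by rewrite mulgA mulgK.
have k1 : pi ((word_lift u')^-1 * word_lift u)%g = 1%g.
  rewrite gmulfM ext_projV !word_liftK.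
  by move/andP: ue => [_ /eqP ->]; move/andP: ue' => [_ /eqP ->]; rewrite mulVg.
rewrite (iota_invM k1) ?represents_kernel//.
by rewrite (PhiD fP); ring.
Qed.

Lemma min_cost_exists phi e : phi \in Phi -> exists z : int,
  (exists2 u, represents u e & cost phi u e = z) /\ forall u, represents u e -> z <= cost phi u e.
Proof.
move=> fP; have [u0 u0e _] := represented e.
(* By [compare], passing from [u0] to [u] lowers the functional by at most
   [C1 * (size u + size u0)], while [size u] enters the cost with the larger factor [C1.+1]. *)
pose m : int := cost phi u0 e - (C1.+1 * size u0)%N%:Z - (C1 * size u0)%N%:Z.
have mP u : represents u e -> m <= cost phi u e.
  move=> ue; have := cost_diff fP u0e ue.
  have /andP[ul /eqP uE] := ue; have /andP[ul0 /eqP uE0] := u0e.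
  have := compare fP ul0 ul; rewrite uE uE0 => /(_ erefl).
  rewrite /m; move: (cost _ _ _) (cost _ _ _) (phi _) (size u) (size u0).
  by clear; nia.
have [[u ue] umin] := minimizer
  (fun w : {u | represents u e} => absz (cost phi (val w) e - m)) (exist _ u0 u0e).
exists (cost phi u e); split; first by exists u.
move=> w we; have := umin (exist _ w we); rewrite /=; have := mP _ we; have := mP _ ue.
move: (cost _ _ _) (cost _ _ _) (m); clear; lia.
Qed.

Definition min_cost phi e : int := xget 0 [set z : int |
  (exists2 u, represents u e & cost phi u e = z) /\ forall u, represents u e -> z <= cost phi u e].
Local Notation H := min_cost.

Lemma min_cost_attained phi e : phi \in Phi -> exists2 u, represents u e & cost phi u e = H phi e.
Proof. by move=> fP; have [] := xgetPex 0 (min_cost_exists e fP). Qed.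

Lemma min_cost_le phi u e : phi \in Phi -> represents u e -> H phi e <= cost phi u e.
Proof. by move=> fP; have [_] := xgetPex 0 (min_cost_exists e fP); exact. Qed.

Lemma representsM u e u' e' : represents u e -> represents u' e' -> represents (u ++ u') (e * e')%g.
Proof.
move=> /andP[ul /eqP uE] /andP[ul' /eqP uE'].
by rewrite /represents all_cat ul ul' big_cat /= uE uE' gmulfM eqxx.
Qed.

(** The element of [A] left over by the first factor is moved to the right past [e'], which twists
    [phi]. *)
Lemma cost_mul phi u e u' e' : phi \in Phi -> represents u e -> represents u' e' ->
  cost phi (u ++ u') (e * e')%g = cost (phi \o act e'^-1%g) u e + cost phi u' e'.
Proof.
move=> fP ue ue'; rewrite /cost word_lift_cat size_cat mulnDr PoszD /=.
set x := ((word_lift u)^-1 * e)%g; have x1 : pi x = 1%g by exact: represents_kernel.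
have -> : ((word_lift u * word_lift u')^-1 * (e * e') =
    ((word_lift u')^-1 * e') * iota (act e'^-1 (iota_inv x)))%g.
  by rewrite -mulgA -iotaJ iota_invK// invgM /x !mulgA.
rewrite iota_invM ?ext_proj_iota ?represents_kernel// iotaK (PhiD fP); ring.
Qed.

Lemma min_costM phi e e' : phi \in Phi -> H phi (e * e')%g <= H (phi \o act e'^-1%g) e + H phi e'.
Proof.
move=> fP; have [u ue <-] := min_cost_attained e (Phi_act e'^-1%g fP).
have [u' ue' <-] := min_cost_attained e' fP.
by rewrite -cost_mul//; apply: min_cost_le => //; exact: representsM.
Qed.

Lemma represents_iota u e a : represents u (e * iota a)%g = represents u e.
Proof. by rewrite /represents gmulfM ext_proj_iota mulg1. Qed.

Lemma cost_iota phi u e a : phi \in Phi -> represents u e ->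
  cost phi u (e * iota a)%g = cost phi u e + phi a.
Proof.
move=> fP ue; rewrite /cost mulgA iota_invM ?ext_proj_iota ?represents_kernel//.
by rewrite iotaK (PhiD fP) addrAC.
Qed.

Lemma min_cost_iota phi e a : phi \in Phi -> H phi (e * iota a)%g = H phi e + phi a.
Proof.
move=> fP; apply/eqP; rewrite eq_le; apply/andP; split.
  have [u ue <-] := min_cost_attained e fP; rewrite -cost_iota//.
  by apply: min_cost_le; rewrite ?represents_iota.
have [u] := min_cost_attained (e * iota a)%g fP; rewrite represents_iota => ue <-.
by rewrite cost_iota// lerD2r min_cost_le.
Qed.

Lemma min_cost0 e : H (fun=> 0) e = (C1.+1 * len (pi e))%N%:Z.
Proof.
apply/eqP; rewrite eq_le; apply/andP; split.
  have [u ue <-] := represented e; apply: le_trans (min_cost_le Phi0 ue) _.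
  by rewrite /cost add0r.
have [u /andP[ul /eqP <-] <-] := min_cost_attained e Phi0.
by rewrite /cost add0r lez_nat leq_mul2l len_gprod.
Qed.

Lemma all_takeT (T : Type) (p : pred T) i (s : seq T) : all p s -> all p (take i s).
Proof. by rewrite -{1}(cat_take_drop i s) all_cat => /andP[]. Qed.

Lemma all_dropT (T : Type) (p : pred T) i (s : seq T) : all p s -> all p (drop i s).
Proof. by rewrite -{1}(cat_take_drop i s) all_cat => /andP[]. Qed.

(** Replace a subword [w2] by a geodesic word [w]. By [compare] the functional gains at most
    [C1 * (size w2 + size w)], so minimality gives [size w2 <= (C1 + C1).+1 * size w]. *)
Lemma min_cost_quasigeodesic phi u e : phi \in Phi -> represents u e -> cost phi u e = H phi e ->
  forall i j, (i <= j <= size u)%N ->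
  (j - i <= (C1 + C1).+1 * d (\gprod (take i u)) (\gprod (take j u)))%N.
Proof.
move=> fP ue uH i j /andP[ij ju]; have /andP[ul /eqP uE] := ue.
pose w1 := take i u; pose w2 := take (j - i) (drop i u); pose w3 := drop j u.
have uw : u = w1 ++ (w2 ++ w3).
  have -> : w3 = drop (j - i) (drop i u) by rewrite drop_drop subnK.
  by rewrite cat_take_drop /w1 cat_take_drop.
have w12 : take j u = w1 ++ w2.
  rewrite -[in LHS](cat_take_drop i u) take_cat size_take.
  have -> : (if (i < size u)%N then i else size u) = i.
    by case: ltnP => // h; apply/eqP; rewrite eqn_leq h (leq_trans ij).
  by rewrite ltnNge ij.
have [w [wl wE sw]] := len_word (\gprod w2).
have w2l : letters w2 by exact/all_takeT/all_dropT.
have w1l : letters w1 by exact: all_takeT.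
have w3l : letters w3 by exact: all_dropT.
pose u' := w1 ++ (w ++ w3).
have ue' : represents u' e.
  apply/andP; split; first by rewrite /u' !all_cat w1l wl w3l.
  by rewrite -uE uw /u' !big_cat /= wE eqxx.
have -> : d (\gprod (take i u)) (\gprod (take j u)) = size w.
  by rewrite w12 big_cat /= sw /wdist mulKg.
have sw2 : size w2 = (j - i)%N by rewrite size_takel// size_drop leq_sub2r.
have := min_cost_le fP ue'; rewrite -uH -subr_ge0 cost_diff//.
have -> : iota_inv ((word_lift u')^-1 * word_lift u)%g =
    act (word_lift w3)^-1%g (iota_inv ((word_lift w)^-1 * word_lift w2)%g).
  apply: iota_inj; rewrite iota_act !iota_invK.
  - by rewrite invgK {1}uw /u' !word_lift_cat !invgM !mulgA mulgVK.
  - by rewrite gmulfM ext_projV !word_liftK wE mulVg.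
  - by rewrite gmulfM ext_projV !word_liftK uw /u' !big_cat /= wE mulVg.
have := compare (Phi_act (word_lift w3)^-1%g fP) w2l wl (esym wE).
rewrite uw /u' !size_cat -sw2 /=; move: (phi _) (size w) (size w1) (size w2) (size w3).
by clear; nia.
Qed.

(** An optimal word for [e * v] is quasi-geodesic, so it passes near [pi e], which lies on a
    geodesic from 1 to [y]; cut it there. Allowing [y] at distance 1 from [pi (e * v)] serves the
    case where the last step is not yet known to prolong a geodesic. *)
Lemma min_cost_split : exists k : nat, forall phi e (v : E) (y : G), phi \in Phi ->
  (len (pi e) + d (pi e) y = len y)%N -> (d y (pi (e * v)%g) <= 1)%N ->
  exists2 z, (len z <= k)%N &
    H phi (e * v)%g = H (phi \o act ((sigma z)^-1 * v)^-1%g) (e * sigma z)%g + H phi ((sigma z)^-1 * v)%g.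
Proof.
have [k kP] := geodesic_near_quasigeodesic len1 lenM lenV len_word filling (C1 + C1).+1 0.
exists k => phi e v y fP ey yv.
have [u ue uH] := min_cost_attained (e * v)%g fP.
have len_d x : len x = d 1%g x by rewrite /wdist invg1 mul1g.
have [f [fg f0 fe fy]] : exists f,
    [/\ geodesic len f (d 1%g y), f 0%N = 1%g, f (d 1%g (pi e)) = pi e & f (d 1%g y) = y].
  by apply: (geodesic_through len_word); rewrite -!len_d.
have /andP[ul /eqP uE] := ue.
have [|||||i iu iP] := kP f (fun i => \gprod (take i u)) _ (size u) fg _ _ _ _ (d 1%g (pi e)).
- move=> i iu; rewrite (take_nth 1%g)// -cats1 big_cat big_seq1 /wdist mulKg.
  by apply: (allP ul); exact: mem_nth.
- by move=> i j ij; rewrite addn0; exact: (min_cost_quasigeodesic fP ue uH).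
- by rewrite f0 take0 big_nil wdistxx.
- by rewrite fy take_size uE.
- by rewrite -!len_d -ey leq_addr.
exists ((pi e)^-1 * \gprod (take i u))%g; first by rewrite -[X in (X <= _)%N]/(d _ _) -fe.
set z := ((pi e)^-1 * _)%g; set s := sigma z.
have esv : (e * v = (e * s) * (s^-1 * v))%g by rewrite mulgA mulgK.
apply/eqP; rewrite eq_le; apply/andP; split; first by rewrite {1}esv min_costM.
have r1 : represents (take i u) (e * s)%g.
  by rewrite /represents all_takeT//= gmulfM sectionK /z mulVKg.
have r2 : represents (drop i u) (s^-1 * v)%g.
  rewrite /represents all_dropT//=; apply/eqP; apply: (mulgI (\gprod (take i u))).
  rewrite -big_cat cat_take_drop uE gmulfM; have /andP[_ /eqP ->] := r1.
  by rewrite -!gmulfM -esv.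
rewrite -uH -{1}(cat_take_drop i u) {1}esv cost_mul//.
by apply: lerD; apply: min_cost_le => //; exact: Phi_act.
Qed.

(** Subadditivity, used with [j] and with its inverse. The bound for left multiplication is what
    makes the final structure two-sided. *)
Lemma min_cost_lipschitz (js : seq E) : exists R1 : nat, forall phi j e, phi \in Phi -> j \in js ->
  `|H phi (e * j)%g - H (phi \o act j^-1%g) e| <= R1%:Z /\ `|H phi (j * e)%g - H phi e| <= R1%:Z.
Proof.
have [D DP] := nat_bound [seq (phi, j) | phi <- Phi, j <- js]
  (fun p => (absz (H p.1 p.2) + absz (H p.1 p.2^-1%g))%N).
have {}DP phi j : phi \in Phi -> j \in js -> H phi j <= D%:Z /\ H phi j^-1%g <= D%:Z.
  move=> fP jP; have := DP (phi, j); rewrite allpairs_f//= => /(_ isT).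
  by move: (H _ _) (H _ _); clear; lia.
exists D => phi j e fP jP; split; rewrite ler_norml.
  have [h1 _] := DP _ _ fP jP; have [_ h2] := DP _ _ (Phi_act j^-1%g fP) jP.
  have := min_costM e j fP; have := min_costM (e * j)%g j^-1%g (Phi_act j^-1%g fP).
  have -> : (phi \o act j^-1%g) \o act j^-1^-1%g = phi.
    by apply/funext => a /=; rewrite invgK -ext_actM mulVg ext_act1.
  rewrite mulgK; move: h1 h2; move: (H _ _) (H _ _) (H _ _) (H _ _).
  by clear; lia.
have [h1 _] := DP _ _ (Phi_act e^-1%g fP) jP; have [_ h2] := DP _ _ (Phi_act (j * e)^-1%g fP) jP.
have := min_costM j e fP; have := min_costM j^-1%g (j * e)%g fP; rewrite mulKg.
move: h1 h2; move: (H _ _) (H _ _) (H _ _) (H _ _).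
by clear; lia.
Qed.

(** Half the derivative of the sum of the squares of [H f] at [e], along the fibre in the direction
    [b]. *)
Definition moment e b : int := \sum_(f <- Phi) H f e * f b.
Definition central (c : nat) e := forall b, b \in BB -> `|moment e b| <= c%:Z.

Lemma sum_Phi_act (V : nmodType) (F : (A -> int) -> V) e :
  \sum_(f <- Phi) F (f \o act e) = \sum_(f <- Phi) F f.
Proof. by rewrite -[RHS](perm_big _ (PhiP e)) big_map. Qed.

Lemma moment_act e j b : \sum_(f <- Phi) H (f \o act j^-1%g) e * f b = moment e (act j b).
Proof.
rewrite -(sum_Phi_act _ j); apply: eq_bigr => f _; congr (H _ _ * _).
by apply/funext => a /=; rewrite -!ext_actM mulgV ext_act1.
Qed.

(* A minimizer of [sum_f (H f (e a))^2] over [a] has bounded moments. *)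
Lemma central_in_fibre : exists C0 : nat, central C0 1%g /\ forall e, exists a, central C0 (e * iota a)%g.
Proof.
have [D DP] := nat_bound BB (fun b => (absz (moment 1%g b) + absz (pairing Phi b b))%N).
exists D; split.
  by move=> b /DP; move: (moment _ _) (pairing _ _ _); clear; lia.
move=> e; pose Q a := \sum_(f <- Phi) (H f e + f a) ^+ 2.
have Q0 a : 0 <= Q a by apply: sumr_ge0 => f _; exact: sqr_ge0.
have [a amin] := minimizer (fun a => absz (Q a)) 0; exists a => b /DP bD.
have {}amin b' : Q a <= Q b' by have := amin b'; have := Q0 a; have := Q0 b'; clear; lia.
have mE : moment (e * iota a)%g b = \sum_(f <- Phi) (H f e + f a) * f b.
  by apply: eq_big_seq => f fP; rewrite min_cost_iota.
have Qp : Q (a + b) = Q a + (moment (e * iota a)%g b *+ 2 + pairing Phi b b).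
  rewrite mE /Q /pairing -sumrMnl -!big_split /=; apply: eq_big_seq => f fP.
  by rewrite (PhiD fP); ring.
have Qm : Q (a - b) = Q a + (pairing Phi b b - moment (e * iota a)%g b *+ 2).
  rewrite mE /Q /pairing -sumrMnl -sumrB -!big_split /=; apply: eq_big_seq => f fP.
  by rewrite (PhiD fP) Phi_N//; ring.
have := amin (a + b); have := amin (a - b); rewrite Qp Qm !lerDl; move: bD.
by move: (moment _ _) (moment _ _) (pairing _ _ _); clear; lia.
Qed.

(** Write [e'] as [e * sigma y * iota a] with [y] short. Up to a bounded error, the moment of [e']
    at [b] is that of [e] at the translate of [b], again in [BB], plus the pairing of [a] with [b].
    So all these pairings are bounded, which leaves finitely many [a]. *)
Lemma central_differences (c r : nat) : exists F : seq E, forall e e', central c e -> central c e' ->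
  (d (pi e) (pi e') <= r)%N -> (e^-1 * e')%g \in F.
Proof.
have [l lP] := len_fin r; have [R1 R1P] := min_cost_lipschitz [seq sigma y | y <- l].
have [D DP] := nat_bound BB (fun b => \sum_(f <- Phi) absz (f b))%N.
have [la laP] := BB_fin (c + c + R1 * D)%N.
exists [seq (sigma y * iota a)%g | y <- l, a <- la] => e e' ec ec' ee'.
set y := ((pi e)^-1 * pi e')%g; have yl : y \in l by exact: lP.
have yk : pi ((sigma y)^-1 * (e^-1 * e'))%g = 1%g.
  by rewrite !gmulfM !ext_projV sectionK /y mulVg.
apply/allpairsP; exists (y, iota_inv ((sigma y)^-1 * (e^-1 * e'))%g).
rewrite /= iota_invK// mulVKg; split=> //; apply: laP => b bB.
set a := iota_inv _; have e'E : e' = (e * sigma y * iota a)%g.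
  by rewrite /a iota_invK// !mulgA mulgK mulgV mul1g.
have := ec' _ bB; have := ec _ (BB_act (sigma y) bB).
have -> : moment e' b = moment e (act (sigma y) b) + pairing Phi a b +
    \sum_(f <- Phi) (H f (e * sigma y)%g - H (f \o act (sigma y)^-1%g) e) * f b.
  rewrite -moment_act /pairing -!big_split /=; apply: eq_big_seq => f fP.
  by rewrite e'E min_cost_iota//; ring.
have : `|\sum_(f <- Phi) (H f (e * sigma y)%g - H (f \o act (sigma y)^-1%g) e) * f b| <= (R1 * D)%N%:Z.
  apply: le_trans (ler_norm_sum _ _ _) _.
  apply: (@le_trans _ _ (R1 * \sum_(f <- Phi) absz (f b))%N%:Z); last first.
    by rewrite lez_nat leq_mul2l DP ?orbT.
  rewrite big_distrr /= (big_morph _ PoszD (erefl _)) !big_seq; apply: ler_sum => f fP.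
  rewrite normrM PoszM; apply: ler_pM => //.
  by have [] := R1P f (sigma y) e fP (map_f _ yl).
move: (\sum_(_ <- _) _) (moment _ _) (pairing _ _ _) => s m p.
by move: (R1 * D)%N; clear; lia.
Qed.


(** The point at time [t] is within [k] of some point of the other geodesic, at a time [i] say.
    Comparing distances to the two starting points gives [i] within [k + 1] of [t]. After the end of
    [f], the lengths differ by at most 2. *)
Lemma geodesics_fellow_travel : exists r : nat, forall (f f' : nat -> G) n n',
  geodesic len f n -> geodesic len f' n' ->
  (forall i, (n <= i)%N -> f i = f n) -> (forall i, (n' <= i)%N -> f' i = f' n') ->
  (d (f 0%N) (f' 0%N) <= 1)%N -> (d (f n) (f' n') <= 1)%N -> forall t, (d (f t) (f' t) <= r)%N.
Proof.
have [k kP] := geodesic_near_quasigeodesic len1 lenM lenV len_word filling 1 0.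
exists (k + k + 3)%N => f f' n n' fg fg' fe fe' ff ff' t.
have tri := wdist_triangle lenM; have sym := wdistC lenV.
have fd := geodesicP len1 lenM fg; have fd' := geodesicP len1 lenM fg'.
have nn' : (n' <= n.+2)%N.
  have := tri (f 0%N) (f' 0%N) (f' n'); have := tri (f n) (f 0%N) (f' n').
  rewrite (fd 0%N n) ?(fd' 0%N n') ?leqnn//; rewrite (sym (f' 0%N)); move: ff ff'; clear; lia.
have step i j : (i <= j)%N -> (d (f' i) (f' j) <= j - i)%N.
  move=> ij; apply: (wdist_path len1 lenM (n := j)); last by rewrite ij leqnn.
  move=> l _; have [ln|nl] := ltnP l n'; first exact: fg'.1.
  by rewrite fe'// (fe' l.+1) ?wdistxx// ltnW.
have [tn|nt] := leqP t n.
  have [|i im iP] := kP f f' n n' fg fg'.1 _ ff ff' t tn.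
    by move=> i j ij; rewrite fd'// mul1n addn0.
  have h1 := tri (f' 0%N) (f 0%N) (f t); have h2 := tri (f' i) (f' 0%N) (f t).
  have h3 := tri (f 0%N) (f' 0%N) (f' i); have h4 := tri (f t) (f 0%N) (f' i).
  have h5 := tri (f' i) (f t) (f' t).
  move: h1 h2 h3 h4 h5; rewrite (fd 0%N t) ?tn// (fd' 0%N i) ?im// (sym (f' 0%N) (f 0%N)) (sym (f' i) (f t)).
  have [it|ti] := leqP i t.
    by have := step i t it; move: ff iP it; clear; lia.
  by have := step t i (ltnW ti); rewrite (sym (f' i) (f' t)); move: ff iP ti; clear; lia.
rewrite fe ?(ltnW nt)//; have := tri (f' n') (f n) (f' t).
have [tn'|n't] := leqP t n'.
  by have := step t n' tn'; rewrite (sym (f' t)); move: nn' nt ff'; clear; lia.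
by rewrite (fe' t) ?(ltnW n't)// wdistxx//; move: ff'; clear; lia.
Qed.

(** * Cone types and the regular language of central paths *)

Definition min_cost_splits (k : nat) := forall phi e (v : E) (y : G), phi \in Phi ->
  (len (pi e) + d (pi e) y = len y)%N -> (d y (pi (e * v)%g) <= 1)%N ->
  exists2 z, (len z <= k)%N &
    H phi (e * v)%g = H (phi \o act ((sigma z)^-1 * v)^-1%g) (e * sigma z)%g + H phi ((sigma z)^-1 * v)%g.

(* The data at [e] that determines which continuations of a central path ending at [e] are central
   paths. *)
Definition same_cone_type k e e' := (forall b, b \in BB -> moment e b = moment e' b) /\
  forall phi z, phi \in Phi -> (len z <= k)%N ->
    H phi (e * sigma z)%g - H (phi \o act (sigma z)^-1%g) e =
    H phi (e' * sigma z)%g - H (phi \o act (sigma z)^-1%g) e'.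

(** Cut an optimal word for [e * v] near [e]. The cone type records the increment up to the cut, and
    the rest of the word serves after [e'] as well; subadditivity then bounds the increment at
    [e']. *)
Lemma cone_type_le k phi e e' (v : E) (y : G) : min_cost_splits k -> phi \in Phi -> same_cone_type k e e' ->
  (len (pi e) + d (pi e) y = len y)%N -> (d y (pi (e * v)%g) <= 1)%N ->
  H phi (e' * v)%g - H (phi \o act v^-1%g) e' <= H phi (e * v)%g - H (phi \o act v^-1%g) e.
Proof.
move=> splitk fP [_ ee'] ey yv; have [z zk ->] := splitk _ _ _ _ fP ey yv.
set j := sigma z; set psi := phi \o act (j^-1 * v)^-1%g.
have psiP : psi \in Phi by exact: Phi_act.
have psiE : psi \o act j^-1%g = phi \o act v^-1%g.
  by apply/funext => a; rewrite /psi /= -ext_actM invgM invgK mulgK.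
have := ee' psi z psiP zk; rewrite -/j psiE.
have := min_costM (e' * j)%g (j^-1 * v)%g fP; rewrite -mulgA mulVKg -/psi.
by move: (H _ _) (H _ _) (H _ _) (H _ _) (H _ _) (H _ _); clear; lia.
Qed.

Local Notation small := (fun x : E => len (pi x) <= 1)%N.

Lemma len_proj_prod (u : seq E) : all small u -> (len (pi (\gprod u)) <= size u)%N.
Proof.
move=> us; rewrite ext_proj_prod -(size_map pi); apply: len_gprod.
by rewrite all_map; apply: sub_all us => x.
Qed.

(** Along a continuation that is central after [e], the increments of every [H phi] after [e'] equal
    those after [e]: [cone_type_le] is applied in both directions, by induction on the time. Moments
    and word lengths are read off from the increments. *)
Lemma cone_transfer k c e e' (u : seq E) : min_cost_splits k -> all small u -> same_cone_type k e e' ->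
  central c e' -> (forall t, (t <= size u)%N ->
    len (pi (e * \gprod (take t u))%g) = (len (pi e) + t)%N /\ central c (e * \gprod (take t u))%g) ->
  forall t, (t <= size u)%N ->
    len (pi (e' * \gprod (take t u))%g) = (len (pi e') + t)%N /\ central c (e' * \gprod (take t u))%g.
Proof.
move=> splitk us ee' ce' eu; have e'e : same_cone_type k e' e.
  by case: ee' => h1 h2; split=> [b bB|phi z fP zk]; rewrite ?h1 ?h2.
elim=> [|t IH] tu; first by rewrite take0 big_nil mulg1 addn0.
have [IHl _] := IH (ltnW tu); have [el _] := eu _ tu; have [_ ec] := eu _ tu.
set v := \gprod (take t.+1 u); set w := \gprod (take t u).
have vE : v = (w * nth 1%g u t)%g by rewrite /v (take_nth 1%g)// -cats1 big_cat big_seq1.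
have vs : (len (pi v) <= t.+1)%N.
  by apply: leq_trans (len_proj_prod _) _; rewrite ?all_takeT// size_takel.
have ws : (len (pi w) <= t)%N.
  by apply: leq_trans (len_proj_prod _) _; rewrite ?all_takeT// size_takel// ltnW.
have geo (x x' : E) n : (len (pi x') <= n)%N -> len (pi (x * x')%g) = (len (pi x) + n)%N ->
    (len (pi x) + d (pi x) (pi (x * x')%g) = len (pi (x * x')%g))%N.
  move=> x'n xE; rewrite /wdist !gmulfM mulKg -gmulfM xE; apply/eqP.
  rewrite eqn_add2l eqn_leq x'n -(leq_add2l (len (pi x))) -xE gmulfM; exact: lenM.
have key phi : phi \in Phi ->
    H phi (e' * v)%g - H (phi \o act v^-1%g) e' = H phi (e * v)%g - H (phi \o act v^-1%g) e.
  move=> fP; apply/eqP; rewrite eq_le; apply/andP; split.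
    apply: (cone_type_le (y := pi (e * v)%g) splitk fP ee'); last by rewrite wdistxx.
    exact: geo vs el.
  (* That [e' * v] prolongs a geodesic is not known yet, so the geodesic is taken to the previous
     prefix [e' * w], one letter short. *)
  apply: (cone_type_le (y := pi (e' * w)%g) splitk fP e'e); first exact: geo ws IHl.
  rewrite vE mulgA [pi (e' * w * _)%g]gmulfM /wdist mulKg.
  by apply: (allP us); exact: mem_nth.
split.
  (* For the zero functional the minimal cost is [C1.+1] times the word length. *)
  have := key _ Phi0; rewrite -![(fun=> 0) \o _]/(fun=> 0) !min_cost0 el; clear.
  by move: (len _) (len _) (len _); nia.
move=> b bB; have -> : moment (e' * v)%g b = moment (e * v)%g b; last exact: ec.
have E1 x : moment (x * v)%g b = moment x (act v b) +
    \sum_(f <- Phi) (H f (x * v)%g - H (f \o act v^-1%g) x) * f b.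
  rewrite -moment_act -big_split /=; apply: eq_bigr => f _; ring.
rewrite !E1; congr (_ + _); first by case: ee' => /(_ _ (BB_act v bB)).
by apply: eq_big_seq => f fP; rewrite key.
Qed.

Definition central_path c (u : seq E) := forall t, (t <= size u)%N ->
  len (pi (\gprod (take t u))) = t /\ central c (\gprod (take t u)).

Lemma central_path_prefix c (u v : seq E) : central_path c (u ++ v) -> central_path c u.
Proof.
move=> uv t tu; have := uv t; rewrite size_cat takel_cat//; apply.
exact: leq_trans (leq_addr _ _).
Qed.

(** The state is the cone type, clipped; clipping is faithful because moments of central elements
    are at most [c] and the recorded differences at most [R1]. Words that are not central paths
    share the state [None], as none of their continuations is one. *)
Lemma central_path_quotients (c : nat) (X : finType) (xbar : X -> E) : (forall x, small (xbar x)) ->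
  finite_quotients [set w : seq X | central_path c (map xbar w)].
Proof.
move=> xs; have [k splitk] := min_cost_split; have [lk lkP] := len_fin k.
have [R1 R1P] := min_cost_lipschitz [seq sigma z | z <- lk].
pose diff e (p : 'I_(size Phi) * 'I_(size lk)) :=
  let f := nth (fun=> 0) Phi p.1 in let j := sigma (nth 1%g lk p.2) in
  H f (e * j)%g - H (f \o act j^-1%g) e.
pose st e := ([ffun i : 'I_(size BB) => clip c (moment e (nth 0 BB i))], [ffun p => clip R1 (diff e p)]).
pose q (w : seq X) := let u := map xbar w in if `[< central_path c u >] then Some (st (\gprod u)) else None.
exists (option ({ffun 'I_(size BB) -> 'I_(c + c).+1} *
  {ffun 'I_(size Phi) * 'I_(size lk) -> 'I_(R1 + R1).+1})%type), q.
move=> u u' + v /=; rewrite /q !map_cat; set U := map xbar u; set U' := map xbar u'; set V := map xbar v.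
have Vs : all small V by rewrite all_map; apply/allP => x _; exact: xs.
move=> + UV; have cU := central_path_prefix UV; rewrite (asboolT cU).
case: asboolP => // cU' [/ffunP sB /ffunP sP].
have cUe : central c (\gprod U) by have := (cU _ (leqnn _)).2; rewrite take_size.
have cUe' : central c (\gprod U') by have := (cU' _ (leqnn _)).2; rewrite take_size.
have lU : len (pi (\gprod U)) = size U by have := (cU _ (leqnn _)).1; rewrite take_size.
have lU' : len (pi (\gprod U')) = size U' by have := (cU' _ (leqnn _)).1; rewrite take_size.
have same : same_cone_type k (\gprod U) (\gprod U').
  split=> [b bB|phi z fP zk].
    have iB : (index b BB < size BB)%N by rewrite index_mem.
    have := sB (Ordinal iB); rewrite !ffunE /= nth_index// => /clip_inj; apply; [exact: cUe|exact: cUe'].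
  have zl : z \in lk by exact: lkP.
  have iP : (index phi Phi < size Phi)%N by rewrite index_mem.
  have iz : (index z lk < size lk)%N by rewrite index_mem.
  have := sP (Ordinal iP, Ordinal iz); rewrite !ffunE /diff /= !nth_index// => /clip_inj; apply.
    by have [] := R1P phi (sigma z) (\gprod U) fP (map_f _ zl).
  by have [] := R1P phi (sigma z) (\gprod U') fP (map_f _ zl).
have tr := cone_transfer splitk Vs same cUe' (c := c).
move=> t; rewrite size_cat take_cat => tUV; have [tU|Ut] := ltnP t (size U'); first exact: cU' (ltnW tU).
rewrite big_cat /=; have [||-> ce] := tr _ (t - size U')%N.
- move=> s sV; have := UV (size U + s)%N; rewrite size_cat leq_add2l => /(_ sV).
  by rewrite take_cat ltnNge leq_addr /= addKn big_cat /= lU.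
- by rewrite leq_subLR.
by rewrite lU' subnKC.
Qed.

(** Choose a central element over each vertex of a geodesic, starting with 1; by
    [central_differences] the consecutive quotients lie in a finite set. *)
Lemma central_path_exists c : central c 1%g -> (forall e, exists a, central c (e * iota a)%g) ->
  exists D : seq E, all small D /\
    forall e, exists u : seq E, [/\ central_path c u, all (mem D) u & pi (\gprod u) = pi e].
Proof.
move=> c1 cf; have [F FP] := central_differences c 1.
exists [seq x <- F | (len (pi x) <= 1)%N]; split; first exact: filter_all.
move=> e; have [f [fg f0 fe]] := geodesic_exists len_word 1%g (pi e).
set n := d 1%g (pi e) in fg fe.
have /choice[p pP] : forall t, exists x, [/\ central c x, pi x = f t & t = 0%N -> x = 1%g].
  move=> [|t]; first by exists 1%g; rewrite ext_proj1 f0.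
  have [a ca] := cf (sigma (f t.+1)); exists (sigma (f t.+1) * iota a)%g; split=> //.
  by rewrite gmulfM sectionK ext_proj_iota mulg1.
pose u := mkseq (fun t => (p t)^-1 * p t.+1)%g n.
have uE t : (t <= n)%N -> \gprod (take t u) = p t.
  elim: t => [|t IH] tn; first by rewrite take0 big_nil; have [_ _ ->] := pP 0%N.
  rewrite (take_nth 1%g) ?size_mkseq// -cats1 big_cat big_seq1 /= IH ?(ltnW tn)//.
  by rewrite nth_mkseq// mulVKg.
exists u; split.
- move=> t; rewrite size_mkseq => tn; rewrite uE//; have [ct pt _] := pP t; split=> //.
  have := geodesicP len1 lenM fg (i := 0%N) (j := t); rewrite f0 subn0 /wdist invg1 mul1g.
  by rewrite pt; apply; rewrite leq0n.
- apply/allP => x /mapP[t]; rewrite mem_iota add0n => /= tn -> /=.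
  have [ct pt _] := pP t; have [ct' pt' _] := pP t.+1.
  have dt : (d (pi (p t)) (pi (p t.+1)) <= 1)%N by rewrite pt pt'; exact: fg.1.
  by rewrite mem_filter FP// andbT gmulfM ext_projV.
- by rewrite -[u]take_size size_mkseq uE//; have [_ -> _] := pP n.
Qed.

Lemma central_path_geodesic c (u : seq E) : all small u -> central_path c u ->
  geodesic len (fun t => pi (\gprod (take t u))) (size u).
Proof.
move=> us cu; split=> [i iu|].
  rewrite (take_nth 1%g)// -cats1 big_cat big_seq1 gmulfM /wdist mulKg.
  by apply: (allP us); exact: mem_nth.
by rewrite take0 big_nil ext_proj1 /wdist invg1 mul1g (cu _ (leqnn _)).1.
Qed.

(** The projections are geodesics and fellow-travel in [G]. Left multiplication by [x] changes
    moments by at most [R1 * D], so the translated prefixes are still central with a larger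
    constant, and [central_differences] applies. *)
Lemma central_path_fellow c (xs : seq E) : exists F : seq E, forall (u u' : seq E) x,
  all small u -> all small u' -> central_path c u -> central_path c u' -> x \in xs -> small x ->
  (d (pi (x * \gprod u)%g) (pi (\gprod u')) <= 1)%N ->
  forall t, ((x * \gprod (take t u))^-1 * \gprod (take t u'))%g \in F.
Proof.
have [r rP] := geodesics_fellow_travel; have [R1 R1P] := min_cost_lipschitz xs.
have [D DP] := nat_bound BB (fun b => \sum_(f <- Phi) absz (f b))%N.
have [F FP] := central_differences (c + R1 * D) r; exists F => u u' x us us' cu cu' xxs x1 uu' t.
have ct (w : seq E) : central_path c w -> central c (\gprod (take t w)).
  move=> cw; have [tw|wt] := leqP t (size w); first exact: (cw _ tw).2.
  by rewrite take_oversize ?(ltnW wt)//; have := (cw _ (leqnn _)).2; rewrite take_size.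
apply: FP.
- move=> b bB; have := ct _ cu _ bB; set e := \gprod _.
  have -> : moment (x * e)%g b = moment e b + \sum_(f <- Phi) (H f (x * e)%g - H f e) * f b.
    by rewrite -big_split /=; apply: eq_bigr => f _; ring.
  have : `|\sum_(f <- Phi) (H f (x * e)%g - H f e) * f b| <= (R1 * D)%N%:Z.
    apply: le_trans (ler_norm_sum _ _ _) _.
    apply: (@le_trans _ _ (R1 * \sum_(f <- Phi) absz (f b))%N%:Z); last first.
      by rewrite lez_nat leq_mul2l DP ?orbT.
    rewrite big_distrr /= (big_morph _ PoszD (erefl _)) !big_seq; apply: ler_sum => f fP.
    rewrite normrM PoszM; apply: ler_pM => //.
    by have [_] := R1P f x e fP xxs.
  move: (\sum_(_ <- _) _) (moment _ _) => s m; move: (R1 * D)%N; clear; lia.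
- by move=> b bB; have := ct _ cu' _ bB; move: (moment _ _) (R1 * D)%N; clear; lia.
have g1 := central_path_geodesic us cu; have g2 := central_path_geodesic us' cu'.
rewrite gmulfM; apply: (rP (fun t => pi x * pi (\gprod (take t u)))%g _ (size u) (size u') _ g2).
- by case: g1 => g1 g1'; split=> [i iu|]; rewrite wdistM//; exact: g1.
- by move=> i iu; rewrite !take_oversize.
- by move=> i iu; rewrite !take_oversize.
- by rewrite !take0 !big_nil ext_proj1 mulg1 /wdist mulg1 lenV.
- by rewrite !take_size -gmulfM.
Qed.

End Extension.

(** * The normal form *)

Lemma word_metric_filling (R : realType) (G : groupType) (len : G -> nat) : fuchsian R G ->
  (forall n : nat, exists l : seq G, forall g, (len g <= n)%N -> g \in l) ->
  exists M C : nat, (0 < M)%N /\ forall c : G -> G -> R,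
    (forall g h k, (wdist len g h <= M)%N -> (wdist len h k <= M)%N -> (wdist len g k <= M)%N ->
       `|c g h + c h k - c g k| <= 1) ->
    forall x s, path (fun g h => wdist len g h <= 1)%N x s -> last x s = x ->
      `|path_sum c x s| <= C%:R * (size s)%:R.
Proof.
move=> fG len_fin; have [S SP] := len_fin 1%N.
have [T [C [C0 fill]]] := fuchsian_filling S fG.
have [M MP] := nat_bound T len.
exists M.+1, (Num.bound C); split=> // c cP x s xs sx.
apply: (@le_trans _ _ (C * (size s)%:R)); last first.
  by rewrite ler_wpM2r// ltW// archi_boundP.
apply: fill sx.
  by move=> g h k gh hk gk; apply: cP; apply: leqW; exact: MP.
by apply: sub_path xs => g h; exact: SP.
Qed.

Section NormalForms.
Variables (A : zmodType) (E G : groupType) (iota : A -> E) (pi : {multiplicative E -> G}).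
Hypothesis ext : group_extension iota pi.
Local Notation act := (ext_act iota).
Variable len : G -> nat.
Hypotheses (len1 : len 1%g = 0%N) (lenM : forall g h, (len (g * h)%g <= len g + len h)%N)
  (lenV : forall g, len g^-1%g = len g).
Variable Phi : seq (A -> int).
Hypotheses (PhiD : forall f, f \in Phi -> {morph f : a b / a + b})
  (Phi_act : forall f e, f \in Phi -> f \o act e \in Phi)
  (Phi_fin : forall n : nat, exists l : seq A, forall a,
     (forall f, f \in Phi -> `|f a| <= n%:Z) -> a \in l).
Variables (C Rem : seq A) (chain : seq A -> bool).
Hypotheses (chain_sub : forall v, chain v -> {subset v <= C})
  (chain_act : forall e v, chain v -> chain (map (act e) v))
  (chain_prefix : forall n : nat, exists n' : nat, forall v v', chain v -> chain v' ->
    (forall f, f \in Phi -> `|f (\sum_(x <- v) x - \sum_(x <- v') x)| <= n%:Z) ->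
    forall t f, f \in Phi -> `|f (\sum_(x <- take t v) x - \sum_(x <- take t v') x)| <= n'%:Z).
Variables (N : seq E) (central : seq E -> Prop).
Hypotheses (N_small : forall n, n \in N -> (len (pi n) <= 1)%N)
  (central_size : forall u, central u -> len (pi (\gprod u)) = size u)
  (central_fellow : exists F : seq E, forall (u u' : seq E) x,
    {subset u <= N} -> {subset u' <= N} -> central u -> central u' -> x \in 1%g :: N ->
    (wdist len (pi (x * \gprod u)%g) (pi (\gprod u')) <= 1)%N ->
    forall t, ((x * \gprod (take t u))^-1 * \gprod (take t u'))%g \in F).

Let actN e a : act e (- a) = - act e a.
Proof. by apply: (iota_inj ext); rewrite (iotaN ext) !(iota_act ext) (iotaN ext) !invgM invgK mulgA. Qed.

Lemma sum_take_cat s (v r : seq A) :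
  \sum_(a <- take s (v ++ r)) a = \sum_(a <- take s v) a + \sum_(a <- take (s - size v) r) a.
Proof.
rewrite take_cat; case: ltnP => [sv|vs]; last by rewrite big_cat /= (take_oversize vs).
by have /eqP -> : (s - size v == 0)%N; [rewrite subn_eq0 ltnW|rewrite take0 big_nil addr0].
Qed.

Definition normal (u : seq E) (v r : seq A) :=
  [/\ central u, {subset u <= N}, chain v, {subset r <= Rem} & (size r <= 1)%N].

Lemma gprod_iota (z : seq A) : \gprod (map iota z) = iota (\sum_(a <- z) a).
Proof.
elim: z => [|a z IH]; first by rewrite !big_nil (iota0 ext).
by rewrite /= !big_cons IH (iotaD ext).
Qed.

Lemma gprod_take_iota t (u : seq E) (z : seq A) : \gprod (take t (u ++ map iota z)) =
  (\gprod (take t u) * iota (\sum_(a <- take (t - size u) z) a))%g.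
Proof.
rewrite take_cat; case: ltnP => [tu|ut].
  have /eqP -> : (t - size u == 0)%N by rewrite subn_eq0 ltnW.
  by rewrite take0 big_nil (iota0 ext) mulg1.
by rewrite big_cat /= -map_take gprod_iota (take_oversize ut).
Qed.

Lemma sum_take_diff (D : seq A) (K : nat) f (w : seq A) i j m : f \in Phi ->
  (forall x g, x \in D -> g \in Phi -> (absz (g x) <= K)%N) -> {subset w <= D} ->
  (i <= j + m)%N -> (j <= i + m)%N ->
  `|f (\sum_(x <- take i w) x - \sum_(x <- take j w) x)| <= (K * m)%N%:Z.
Proof.
move=> fP KP wD; wlog ij : i j / (i <= j)%N.
  move=> h; have [ij|/ltnW ji] := leqP i j; first exact: h.
  by move=> im jm; rewrite -opprB (Phi_opp PhiD)// normrN; exact: h.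
move=> _ jm; have -> : take j w = take i w ++ take (j - i) (drop i w).
  by rewrite -takeD subnKC.
rewrite big_cat /= opprD addNKr (Phi_opp PhiD)// normrN (Phi_sum PhiD)//.
apply: le_trans (ler_norm_sum _ _ _) _.
apply: (@le_trans _ _ (\sum_(x <- take (j - i) (drop i w)) K%:Z)).
  rewrite !big_seq; apply: ler_sum => x /mem_take/mem_drop/wD xD.
  by rewrite -abszE lez_nat KP.
rewrite big_const_seq count_predT iter_addr_0 pmulrn mulrzz -PoszM lez_nat leq_mul2l.
apply/orP; right; rewrite size_take_min; apply: leq_trans (geq_minl _ _) _.
by rewrite leq_subLR.
Qed.

Lemma sum_small_mem (r : seq A) : {subset r <= Rem} -> (size r <= 1)%N -> \sum_(a <- r) a \in 0 :: Rem.
Proof.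
case: r => [|a [|//]] rR _; first by rewrite big_nil mem_head.
by rewrite big_seq1 inE rR ?orbT// mem_head.
Qed.

(** The path parts fellow-travel and their lengths differ by at most 2, so both words reach their
    abelian parts at nearly the same time. From then on the difference [f] of the path parts is
    constant, and [v] is compared with the translate of [v'] by [f], which is again a chain; their
    sums differ by one of finitely many elements, as [chain_prefix] requires. *)
Lemma normal_fellow : exists F : seq E, forall u v r u' v' r' x n, normal u v r -> normal u' v' r' ->
  x \in 1%g :: N -> n \in 1%g :: N ->
  \gprod (u' ++ map iota (v' ++ r')) = (x * \gprod (u ++ map iota (v ++ r)) * n)%g ->
  forall t, ((x * \gprod (take t (u ++ map iota (v ++ r))))^-1 *
    \gprod (take t (u' ++ map iota (v' ++ r'))))%g \in F.
Proof.
have [F0 F0P] := central_fellow.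
have [K KP] : exists K : nat, forall x g, x \in C ++ Rem -> g \in Phi -> (absz (g x) <= K)%N.
  have [K KP] := nat_bound [seq (x, g) | x <- C ++ Rem, g <- Phi] (fun p => absz (p.2 p.1)).
  by exists K => x g xD gP; apply: (KP (x, g)); exact: allpairs_f.
(* [Lc] contains every possible difference between the sum of [v] and that of the translate of [v']:
   it combines [f], the two remainders and [n], as computed in [diffE]. *)
pose La := [seq (iota a * n)%g | a <- 0 :: Rem, n <- 1%g :: N].
pose Lb := [seq (y * iota (- a))%g | y <- La, a <- 0 :: Rem].
pose Lc := [seq (f * y^-1)%g | f <- F0, y <- Lb].
have [n0 n0P] := nat_bound [seq (g, e) | g <- Phi, e <- Lc] (fun p => absz (p.1 (iota_inv iota p.2))).
have [n1 n1P] := chain_prefix n0.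
(* A shift by two letters and two remainders cost [K * 4]; the 8 is generous. *)
have [l lP] := Phi_fin (n1 + K * 8)%N.
exists [seq (f * iota b)%g | f <- F0, b <- l].
move=> u v r u' v' r' x n [cu uN vc rR r1] [cu' uN' vc' rR' r1'] xN nN val t.
have small y : y \in 1%g :: N -> (len (pi y) <= 1)%N.
  rewrite in_cons => /orP[/eqP {y}->|]; last exact: N_small.
  by rewrite ext_proj1 len1.
have piv : pi (\gprod u') = (pi (x * \gprod u) * pi n)%g.
  have := congr1 pi val; rewrite !big_cat /= !gprod_iota !gmulfM !(ext_proj_iota ext).
  by rewrite !mulg1.
have uu' : (wdist len (pi (x * \gprod u)%g) (pi (\gprod u')) <= 1)%N.
  by rewrite piv /wdist mulKg small.
have size1 : (size u' <= size u + 2)%N.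
  rewrite -!central_size// piv gmulfM; apply: leq_trans (lenM _ _) _; have := lenM (pi x) (pi (\gprod u)).
  have := small _ xN; have := small _ nN; clear; lia.
have size2 : (size u <= size u' + 2)%N.
  rewrite -!central_size//; have -> : pi (\gprod u) = ((pi x)^-1 * (pi (\gprod u') * (pi n)^-1))%g.
    by rewrite piv mulgK gmulfM mulKg.
  apply: leq_trans (lenM _ _) _; have := lenM (pi (\gprod u')) (pi n)^-1%g; rewrite !lenV.
  have := small _ xN; have := small _ nN; clear; lia.
have ft := F0P u u' x uN uN' cu cu' xN uu'.
rewrite !gprod_take_iota; set f := ((x * \gprod (take t u))^-1 * \gprod (take t u'))%g.
set z := v ++ r; set z' := v' ++ r'; set a := \sum_(y <- take _ z) y; set a' := \sum_(y <- take _ z') y.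
have -> : ((x * (\gprod (take t u) * iota a))^-1 * (\gprod (take t u') * iota a') =
    f * iota (a' - act f^-1%g a))%g.
  rewrite [(x * (_ * _))%g]mulgA invgM -(iotaN ext) -[LHS]mulgA [((x * _)^-1 * (_ * _))%g]mulgA -/f.
  by rewrite mulgA (iotaJ ext) -mulgA -(iotaD ext) actN addrC.
apply/allpairsP; exists (f, a' - act f^-1%g a); split=> //=; first exact: ft.
apply: lP => g0 g0P; pose g := g0 \o act f^-1%g; have gP : g \in Phi by exact: Phi_act.
have -> : g0 (a' - act f^-1%g a) = g (act f a' - a).
  by rewrite /g /= (ext_actD ext) actN -(ext_actM ext) mulVg (ext_act1 ext).
pose gf := g \o act f; have gfP : gf \in Phi by exact: Phi_act.
have gfE b : g (act f b) = gf b by [].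
have zZ : {subset z <= C ++ Rem}.
  by move=> y; rewrite !mem_cat => /orP[/(chain_sub vc)->//|/rR->]; rewrite orbT.
have zZ' : {subset z' <= C ++ Rem}.
  by move=> y; rewrite !mem_cat => /orP[/(chain_sub vc')->//|/rR'->]; rewrite orbT.
rewrite (Phi_sub PhiD)// gfE; have [big|] := boolP ((size u <= t) && (size u' <= t))%N; last first.
  (* One of the words is still on its path part, so the other has read at most two letters of its
     abelian part. *)
  rewrite negb_and -!ltnNge => tu.
  have := sum_take_diff gP KP zZ (i := (t - size u)%N) (j := 0%N) (m := 2%N).
  have := sum_take_diff gfP KP zZ' (i := (t - size u')%N) (j := 0%N) (m := 2%N).
  rewrite !take0 !big_nil !subr0 -/a -/a' !add0n !addn2 => /(_ _ isT) h1 /(_ _ isT) h2.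
  have {}h1 : `|gf a'| <= (K * 2)%N%:Z by apply: h1; move: tu size1 size2; clear; lia.
  have {}h2 : `|g a| <= (K * 2)%N%:Z by apply: h2; move: tu size1 size2; clear; lia.
  by move: h1 h2; move: (gf _) (g _); clear; lia.
move/andP: big => [ut ut'].
have fE : f = ((x * \gprod u)^-1 * \gprod u')%g by rewrite /f !take_oversize.
have diffE : \sum_(y <- v) y - \sum_(y <- [seq act f y | y <- v']) y = iota_inv iota
    (f * (iota (\sum_(y <- r) y) * n * iota (- \sum_(y <- r') y))^-1)%g.
  rewrite big_map -(act_sum (ext_actD ext)) -[LHS](iotaK ext); congr (iota_inv _ _).
  apply: (mulIg (iota (\sum_(y <- r) y) * n * iota (- \sum_(y <- r') y))%g); rewrite mulgVK.
  have fv : (f * iota (\sum_(y <- v') y) = iota (\sum_(y <- v) y) *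
      (iota (\sum_(y <- r) y) * n * iota (- \sum_(y <- r') y)))%g.
    rewrite fE -!mulgA; apply: (mulgI (x * \gprod u)%g); rewrite mulVKg.
    have := congr1 (fun e => e * iota (- \sum_(y <- r') y))%g val.
    by rewrite !big_cat /= !gprod_iota !big_cat /= !(iotaD ext) (iotaN ext) !mulgA mulgK.
  by rewrite addrC (iotaD ext) (iotaN ext) (iota_act ext) -mulgA -fv invgM invgK mulgVK.
have tZ i w : {subset w <= Rem} -> (size w <= 1)%N -> forall g1, g1 \in Phi ->
    `|g1 (\sum_(y <- take i w) y)| <= K%:Z.
  move=> wR w1 g1 g1P; have : \sum_(y <- take i w) y \in 0 :: Rem.
    apply: sum_small_mem => [y /mem_take/wR//|]; rewrite size_take_min.
    exact: leq_trans (geq_minr _ _) w1.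
  rewrite inE => /predU1P[->|yR]; first by rewrite (Phi_zero PhiD)// normr0.
  by rewrite -abszE lez_nat KP// mem_cat yR orbT.
have h1 := sum_take_diff gfP KP zZ' (i := (t - size u')%N) (j := (t - size u)%N) (m := 2%N).
have {}h1 : `|gf a' - gf (\sum_(y <- take (t - size u)%N z') y)| <= (K * 2)%N%:Z.
  by rewrite -(Phi_sub PhiD)//; apply: h1; move: ut ut' size1 size2; clear; lia.
have h2 := tZ (t - size u - size v')%N r' rR' r1' gf gfP.
have h3 := tZ (t - size u - size v)%N r rR r1 g gP.
have h4 : `|g (\sum_(y <- take (t - size u) v) y) - gf (\sum_(y <- take (t - size u) v') y)| <= n1%:Z.
  rewrite -gfE -(Phi_sub PhiD)// (act_sum (ext_actD ext)) -(big_map (act f) xpredT id) map_take.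
  apply: n1P => // [|g1 g1P]; first exact: chain_act.
  rewrite diffE -abszE lez_nat; apply: (n0P (g1, _)); apply: allpairs_f => //.
  apply: allpairs_f; first by have := ft t.
  apply/allpairsP; exists (iota (\sum_(y <- r) y) * n, \sum_(y <- r') y)%g.
  split=> //=; last exact: sum_small_mem.
  by apply/allpairsP; exists (\sum_(y <- r) y, n); split=> //; exact: sum_small_mem.
move: h1; rewrite /z' sum_take_cat (PhiD gfP) /a /z sum_take_cat (PhiD gP).
move: h2 h3 h4; move: (gf _) (gf _) (gf _) (g _) (g _); clear; lia.
Qed.

End NormalForms.

(** * The alphabet and the shape of the words *)

Section Alphabet.
Variables (E : groupType) (A : zmodType) (N : seq E) (iota : A -> E) (ival : E -> A)
  (iotaK : cancel iota ival) (C Rem : seq A) (face : rel A).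

(* A letter carries its position in the normal form: [0] for the central path, [1] for the chain,
   [2] for the remainder. *)
Definition letter := ('I_3 * seq_sub N)%type.
Definition letter_value (x : letter) : E := ssval x.2.

(** Together with [letter_ok] this expresses the shape of a normal form by conditions on pairs of
    letters and on single letters, for which regularity is immediate; only the centrality of the
    path part needs cone types. *)
Definition letter_rel (x y : letter) :=
  [&& (x.1 <= y.1)%N, ~~ ((x.1 == 2 :> nat) && (y.1 == 2 :> nat)) &
    (x.1 == 1 :> nat) && (y.1 == 1 :> nat) ==> face (ival (letter_value x)) (ival (letter_value y))].

Definition letter_ok (x : letter) :=
  ((x.1 == 1 :> nat) ==> (letter_value x \in map iota C)) &&
  ((x.1 == 2 :> nat) ==> (letter_value x \in map iota Rem)).

Definition path_part (w : seq letter) : seq E :=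
  map (@ssval _ N) (pmap (fun x : letter => if x.1 == 0 :> nat then Some x.2 else None) w).

Definition tagged_part (i : nat) (w : seq letter) : seq E :=
  map letter_value [seq x : letter <- w | x.1 == i :> nat].

Lemma path_partE w : path_part w = tagged_part 0 w.
Proof. by elim: w => //= x w; rewrite /path_part /tagged_part /=; case: eqP => //= _ ->. Qed.

Lemma letter_split w : pairwise letter_rel w ->
  map letter_value w = tagged_part 0 w ++ tagged_part 1 w ++ tagged_part 2 w.
Proof.
elim: w => //= x w IH /andP[/allP xw /IH ->].
have nil i : (i < x.1)%N -> [seq y : letter <- w | y.1 == i :> nat] = [::].
  move=> ix; apply/eqP; rewrite -[_ == _]negbK -has_filter; apply/hasPn => y /xw /and3P[xy _ _].
  by apply: contraTneq xy => ->; rewrite -ltnNge.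
rewrite /tagged_part /=; case: x xw nil => [[[|[|[|//]]] i3] n] xw nil //=.
  by rewrite (nil 0%N).
by rewrite (nil 0%N)// (nil 1%N).
Qed.

Lemma normal_word_parts w : pairwise letter_rel w -> all letter_ok w ->
  exists v r, [/\ map letter_value w = path_part w ++ map iota (v ++ r),
    all (mem C) v && pairwise face v, {subset r <= Rem} & (size r <= 1)%N].
Proof.
move=> ww /allP wok; exists (map ival (tagged_part 1 w)), (map ival (tagged_part 2 w)).
have part1 x : x \in tagged_part 1 w -> x \in map iota C.
  move=> /mapP[y]; rewrite mem_filter => /andP[y1 yw ->].
  by have /andP[+ _] := wok _ yw; rewrite y1.
have part2 x : x \in tagged_part 2 w -> x \in map iota Rem.
  move=> /mapP[y]; rewrite mem_filter => /andP[y2 yw ->].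
  by have /andP[_] := wok _ yw; rewrite y2.
have K D (s : seq E) : (forall x, x \in s -> x \in map iota D) -> map iota (map ival s) = s.
  by move=> sD; rewrite -map_comp map_id_in// => x /sD/mapP[a _ ->] /=; rewrite iotaK.
split.
- by rewrite letter_split// path_partE map_cat (K C)// (K Rem).
- apply/andP; split.
    rewrite all_map; apply/allP => x /part1/mapP[a aC ->] /=.
    by rewrite iotaK.
  rewrite pairwise_map /tagged_part pairwise_map.
  apply: (sub_in_pairwise _ (filter_all _ w)) (pairwise_filter _ ww) => x y x1 y1 /and3P[_ _].
  by rewrite [_ == _]x1 [_ == _]y1.
- by move=> a /mapP[x /part2/mapP[b bR ->] ->]; rewrite iotaK.
- rewrite size_map /tagged_part size_map.
  have := pairwise_filter (fun x : letter => x.1 == 2 :> nat) ww.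
  have := filter_all (fun x : letter => x.1 == 2 :> nat) w.
  case: (seq.filter _ w) => [|x [|y s]] //= /and3P[x2 y2 _].
  by rewrite /letter_rel x2 y2 /= andbF.
Qed.

Lemma normal_word_exists (u : seq E) v r : {subset u <= N} -> {subset map iota v <= N} -> iota r \in N ->
  all (mem C) v && pairwise face v -> r \in Rem ->
  exists w, [/\ pairwise letter_rel w, all letter_ok w, path_part w = u &
    map letter_value w = u ++ map iota (v ++ [:: r])].
Proof.
move=> uN vN rN /andP[/allP vC vf] rR.
have lift (s : seq E) : {subset s <= N} -> exists t : seq (seq_sub N), map (@ssval _ N) t = s.
  elim: s => [|x s IH] sN; first by exists [::].
  have [t <-] := IH (fun y ys => sN y (mem_behead (s := x :: s) ys)).
  by exists (SeqSub (sN x (mem_head _ _)) :: t).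
have [tu tuE] := lift _ uN; have [tv tvE] := lift _ vN.
pose w0 : seq letter := [seq (ord0, n) | n <- tu].
pose w1 : seq letter := [seq (inord 1, n) | n <- tv].
pose w2 : seq letter := [:: (inord 2, SeqSub rN)].
have tag1 : (inord 1 : 'I_3) = 1%N :> nat by rewrite inordK.
have tag2 : (inord 2 : 'I_3) = 2%N :> nat by rewrite inordK.
have V : map letter_value (w0 ++ w1 ++ w2) = u ++ map iota (v ++ [:: r]).
  by rewrite !map_cat /= -!map_comp -tuE -tvE.
have p0 : all (fun x : letter => x.1 == 0 :> nat) w0 by rewrite all_map; apply/allP.
have p1 : all (fun x : letter => x.1 == 1 :> nat) w1 by rewrite all_map; apply/allP => n _ /=; rewrite tag1.
exists (w0 ++ w1 ++ w2); split=> //.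
- rewrite !pairwise_cat allrel_catr; apply/and3P; split.
  + apply/andP; split; apply/allrelP => x y /(allP p0)/eqP x0.
      by move=> /(allP p1)/eqP y1; rewrite /letter_rel x0 y1.
    by rewrite mem_seq1 => /eqP ->; rewrite /letter_rel x0 tag2.
  + by rewrite pairwise_map; elim: (tu) => //= n s ->; rewrite andbT; apply/allP.
  apply/and3P; split=> //.
    apply/allrelP => x y /(allP p1)/eqP x1; rewrite mem_seq1 => /eqP ->.
    by rewrite /letter_rel x1 tag2.
  have : pairwise (fun x y => face (ival x) (ival y)) (map iota v).
    by rewrite pairwise_map; apply: sub_pairwise vf => a b; rewrite /= !iotaK.
  rewrite -tvE !pairwise_map; apply: sub_pairwise => m n; rewrite /letter_rel /= tag1 /=; exact.
- rewrite !all_cat; apply/and3P; split.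
  + by apply: sub_all p0 => x /eqP x0; rewrite /letter_ok x0.
  + rewrite all_map; apply/allP => n ntv; rewrite /letter_ok /= tag1 /= andbT.
    have : ssval n \in map iota v by rewrite -tvE; apply: map_f.
    by move=> /mapP[a /vC aC nE]; rewrite /letter_value /= nE; apply: map_f.
  + by rewrite /= /letter_ok /= tag2 /= andbT; apply: map_f.
- rewrite path_partE /tagged_part !filter_cat.
  rewrite (all_filterP p0) (_ : seq.filter _ w1 = [::]); last first.
    by apply/eqP; rewrite -[_ == _]negbK -has_filter; apply/hasPn => x /(allP p1)/eqP ->.
  by rewrite /= tag2 /= cats0 -tuE -map_comp.
Qed.

End Alphabet.

Theorem theorem3p1 (R : realType) (A : zmodType) (E G : groupType)
    (iota : A -> E) (pi : {multiplicative E -> G}) :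
  fuchsian R G ->
  finitely_generated_zmod A ->
  group_extension iota pi ->
  virtually_central iota pi ->
  has_biautomatic_structure R E.
Proof.
move=> fuchsG fgA ext vc.
have [len [len1 lenM lenV len_fin len_word]] := word_length fuchsG.1.
have [M [C0 [M_gt0 fill]]] := word_metric_filling fuchsG len_fin.
have act_fin := ext_act_fin ext vc.
have actD := ext_actD ext; have act1 := ext_act1 ext; have actM := ext_actM ext.
have [Phi [PhiU Phi0 PhiD Phi_act Phi_fin]] := invariant_functionals actD act1 actM act_fin fgA.
have [B [B_act B_gen]] := invariant_generators act1 actM act_fin fgA.
have B_fin := pairing_fin PhiD Phi_fin B_gen.
have PhiP := Phi_perm act1 actM PhiU Phi_act.
have [C [c [C_c c_sim sim_c c_C c_act]]] := invariant_centers actD act1 actM act_fin PhiD Phi_act.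
have [Rem RemP] := chain_decomposition PhiU PhiD Phi_fin sim_c c_C.
have chain_pre := chain_prefix PhiU PhiD C_c c_sim sim_c.
have chain_inv := chain_act actD act1 actM Phi_act C_c c_C c_act.
have [C1 cmp] := word_lift_compare ext len1 lenV len_fin M_gt0 fill PhiD Phi_act.
have [c0 [cen1 cenf]] := central_in_fibre ext len_word B PhiD cmp.
have [D [/allP Ds DP]] :=
  central_path_exists ext len1 lenM len_fin len_word PhiD Phi_act PhiP B_act B_fin cmp cen1 cenf.
(* Steps of central paths, centers of cells and remainders; adding the inverses makes the alphabet
   symmetric. *)
pose N0 := D ++ map iota C ++ map iota Rem; pose N := N0 ++ [seq n^-1%g | n <- N0].
have N0N n : n \in N0 -> n \in N by rewrite (mem_cat _ N0) => ->.
have NV n : n \in N -> n^-1%g \in N.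
  rewrite !(mem_cat _ N0) => /orP[nN|/mapP[m mN ->]]; last by rewrite invgK mN.
  by rewrite map_f ?orbT.
have N_small n : n \in N -> (len (pi n) <= 1)%N.
  have N0s m : m \in N0 -> (len (pi m) <= 1)%N.
    rewrite !mem_cat => /or3P[/Ds//| |] /mapP[a _ ->]; by rewrite (ext_proj_iota ext) len1.
  by rewrite mem_cat => /orP[/N0s//|/mapP[m /N0s ms ->]]; rewrite ext_projV lenV.
have all_small (u : seq E) : {subset u <= N} -> all (fun x => len (pi x) <= 1)%N u.
  by move=> uN; apply/allP => x /uN /N_small.
pose cen := central_path iota pi len Phi B C1 c0.
have cen_size u : cen u -> len (pi (\gprod u)) = size u.
  by move=> cu; have [] := cu (size u) (leqnn _); rewrite take_size.
have cen_fellow : exists F : seq E, forall (u u' : seq E) x,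
    {subset u <= N} -> {subset u' <= N} -> cen u -> cen u' -> x \in 1%g :: N ->
    (wdist len (pi (x * \gprod u)%g) (pi (\gprod u')) <= 1)%N ->
    forall t, ((x * \gprod (take t u))^-1 * \gprod (take t u'))%g \in F.
  have [F FP] := central_path_fellow ext len1 lenM lenV len_fin len_word fill PhiD Phi_act PhiP
    B_act B_fin cmp c0 (1%g :: N).
  exists F => u u' x uN uN' cu cu' xN; apply: FP => //; try exact: all_small.
  by move: xN; rewrite in_cons => /orP[/eqP ->|/N_small//]; rewrite ext_proj1 len1.
have [F FP] := normal_fellow ext len1 lenM lenV PhiD Phi_act Phi_fin Rem
  (chain := chain Phi C) (fun v vc => allP (andP vc).1) chain_inv chain_pre N_small cen_size cen_fellow.
pose h (x : letter N) : option (seq_sub N) := if x.1 == 0 :> nat then Some x.2 else None.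
pose L : set (seq ('I_3 * seq_sub N)) :=
  [set w | pairwise (letter_rel (iota_inv iota) (face Phi)) w] `&`
  ([set w | all (letter_ok iota C Rem) w] `&` [set w | cen (path_part w)]).
have valE w : word_value (@letter_value E N) w = \gprod (map (@letter_value E N) w).
  by rewrite /word_value big_map.
have pathN (w : seq (letter N)) : {subset path_part w <= N}.
  by move=> _ /mapP[[x xN] _ ->].
have Lsurj : [set word_value (@letter_value E N) w | w in L] = setT.
  apply/seteqP; split=> // e _; have [u [cu uD ue]] := DP e.
  have ker : pi ((\gprod u)^-1 * e)%g = 1%g by rewrite gmulfM ext_projV ue mulVg.
  have [v [r [vch rR aE]]] := RemP (iota_inv iota ((\gprod u)^-1 * e)%g).
  have [|||w [w1 w2 wu wE]] := @normal_word_exists E A N iota _ (iotaK ext) C Rem (face Phi) u v r _ _ _ vch rR.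
  - by move=> x /(allP uD); rewrite inE => xD; apply: N0N; rewrite mem_cat xD.
  - move=> _ /mapP[a av ->]; apply: N0N; rewrite !mem_cat map_f ?orbT//.
    by move/andP: vch => [/allP/(_ _ av)].
  - by apply: N0N; rewrite !mem_cat (map_f iota rR) ?orbT.
  exists w; first by split=> //; split=> //; rewrite /= wu.
  rewrite valE wE big_cat /= (gprod_iota ext) big_cat big_seq1 /= -aE (iota_invK ext)//.
  by rewrite mulVKg.
have rangeN : range (@letter_value E N) = [set` N].
  apply/seteqP; split=> [_ [[i [x xN]] _ <-]//|x xN].
  by exists (ord0, SeqSub xN).
exists ('I_3 * seq_sub N)%type, (@letter_value E N), L.
apply: (@biautomatic_of_discrete _ _ _ _ _ _ L F) => //.
- rewrite rangeN; apply/seteqP; split=> [x xN|_ [x xN <-]]; last exact: NV.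
  by exists x^-1%g; rewrite ?invgK//; exact: NV.
- apply/seteqP; split=> // e _.
  by have [w _ <-] : [set word_value (@letter_value E N) w | w in L] e by rewrite Lsurj.
- apply: regular_of_finite_quotients; apply: finite_quotientsI; first exact: finite_quotients_pairwise.
  apply: finite_quotientsI; first exact: finite_quotients_all.
  apply: (@finite_quotients_pmap _ _ h [set w | cen (map (@ssval _ N) w)]).
  apply: (central_path_quotients ext len1 lenM lenV len_fin len_word fill PhiD Phi0 Phi_act PhiP B_act cmp).
  by move=> [x xN]; exact: N_small.
move=> w w' x n [w1 [w2 cw]] [w1' [w2' cw']] xN nN val t.
have [v [r [wE vch rR r1]]] := normal_word_parts (iotaK ext) w1 w2.
have [v' [r' [wE' vch' rR' r1']]] := normal_word_parts (iotaK ext) w1' w2'.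
have mem1 y : y = 1%g \/ (exists z : letter N, y = letter_value z) -> y \in 1%g :: N.
  case=> [->|[[i [z zN]] ->]]; first exact: mem_head.
  by rewrite in_cons zN orbT.
have nw : normal Rem (chain Phi C) N cen (path_part w) v r by split=> //; exact: pathN.
have nw' : normal Rem (chain Phi C) N cen (path_part w') v' r' by split=> //; exact: pathN.
rewrite !valE !map_take wE wE'; apply: (FP _ _ _ _ _ _ _ n nw nw' (mem1 _ xN) (mem1 _ nN)).
by rewrite -wE -wE' -!valE.
Qed.
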